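(* Let $d\ge 1$, let $\bar\rho_0\in\mathcal P(\mathbf R^d\times\mathbf R^d)$ have compact support, and suppose that the communication strength $K>0$ satisfies $$K>\frac{\overline{\mathcal D}_V(0)}{\int_{\overline{\mathcal D}_X(0)}^{\infty}\psi(s)\,\mathrm ds}.$$ Let $(X^j_t,V^j_t)_{1\le j\le J}$ be the solution of the $J$-particle Cucker--Smale system and $(\bar X^j_t,\bar V^j_t)_{1\le j\le J}$ the synchronously coupled mean-field particles, both started from the same i.i.d. initial conditions $(x^j_0,v^j_0)\sim\bar\rho_0$. Then there exists a constant $C_{\rm Chaos}=C_{\rm Chaos}\bigl(K,\overline{\mathcal D}_V(0),\overline{\mathcal D}_X(0),L_\psi\bigr)>0$ such that for all $J\in\mathbf N^+$ and all $j\in\{1,\dots,J\}$, $$\forall t\ge 0,\qquad \mathbf E\Bigl[\bigl|\Delta X^j_t-\Delta\bar X^j_t\bigr|^2+\bigl|\Delta V^j_t-\Delta\bar V^j_t\bigr|^2\Bigr]\le\frac{C_{\rm Chaos}^2}{J}.$$ Consequently, for all $t\ge 0$, $$W_2\bigl(\mathcal R^J\rho^J_t,\mathcal R^J\bar\rho_t^{\otimes J}\bigr)\le C_{\rm Chaos}J^{-\frac12},$$ where $\rho^J_t\in\mathcal P(\mathbf R^{2dJ})$ is the law of $(X^j_t,V^j_t)_{1\le j\le J}$ and $W_2$ denotes the Wasserstein-2 distance on $\mathcal P(\mathbf R^{2dJ})$ with respect to the normalized distance $$d(\mathrm x,\mathrm y)=\frac1J\Bigl(\sum_{j=1}^J|\mathrm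 x_j-\mathrm y_j|^2\Bigr)^{\frac12},\qquad \mathrm x=(\mathrm x_1,\dots,\mathrm x_J),\ \mathrm y=(\mathrm y_1,\dots,\mathrm y_J)\in\mathbf R^{2dJ},\ \mathrm x_j,\mathrm y_j\in\mathbf R^{2d}.$$
   Context: Communication rate (standing assumption): $\psi:(0,\infty)\to(0,\infty)$ is a fixed function that is globally Lipschitz continuous with Lipschitz constant $L_\psi$, non-increasing, and bounded above by $1$; it is extended to $0$ by continuity. The function $\psi$ is fixed throughout; the notation $C_{\rm Chaos}(\cdots)$ indicates that, for this $\psi$, the constant depends on the initial law only through the listed quantities. Cucker--Smale system with $J$ particles in $\mathbf R^d$: for $j=1,\dots,J$, $$\frac{\mathrm dX^j_t}{\mathrm dt}=V^j_t,\qquad \frac{\mathrm dV^j_t}{\mathrm dt}=-\frac KJ\sum_{k=1}^J\psi\bigl(|X^j_t-X^k_t|\bigr)(V^j_t-V^k_t),\qquad (X^j_0,V^j_0)=(x^j_0,v^j_0).$$ Mean-field law: with $H(x,v)=\psi(|x|)v$ and $(H\star\mu)(x,v)=\iint H(x-y,v-w)\,\mu(\mathrm dy\,\mathrm dw)$, $\bar\rho_t$ is the law of $(\bar X_t,\bar V_t)$, where $$\frac{\mathrm d\bar X_t}{\mathrm dt}=\bar V_t,\qquad \frac{\mathrm d\bar V_t}{\mathrm dt}=-K(H\star\bar\rho_t)(\bar X_t,\bar V_t),\qquad \bar\rho_t=\mathrm{Law}(\bar X_t,\bar V_t),\qquad (\bar X_0,\bar V_0)\sim\bar\rho_0.$$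 Synchronously coupled mean-field particles: for $j=1,\dots,J$, $$\frac{\mathrm d\bar X^j_t}{\mathrm dt}=\bar V^j_t,\qquad \frac{\mathrm d\bar V^j_t}{\mathrm dt}=-K(H\star\bar\rho_t)(\bar X^j_t,\bar V^j_t),\qquad (\bar X^j_0,\bar V^j_0)=(X^j_0,V^j_0)=(x^j_0,v^j_0)\overset{\text{i.i.d.}}{\sim}\bar\rho_0.$$ Recentered quantities: $\Delta X^j_t=X^j_t-\frac1J\sum_{i=1}^JX^i_t$, $\Delta V^j_t=V^j_t-\frac1J\sum_{i=1}^JV^i_t$, $\Delta\bar X^j_t=\bar X^j_t-\frac1J\sum_{i=1}^J\bar X^i_t$, $\Delta\bar V^j_t=\bar V^j_t-\frac1J\sum_{i=1}^J\bar V^i_t$. Recentering of joint laws: $\mathcal R^J:\mathcal P(\mathbf R^{2dJ})\to\mathcal P(\mathbf R^{2dJ})$ is the pushforward under the map $$R^J(Z^1,\dots,Z^J)=\Bigl(Z^1-\frac1J\sum_{i=1}^JZ^i,\dots,Z^J-\frac1J\sum_{i=1}^JZ^i\Bigr),\qquad Z^j\in\mathbf R^{2d}.$$ Diameters: $\overline{\mathcal D}_X(0)=\max|x-y|$ over $x,y$ in the support of the position marginal of $\bar\rho_0$, and $\overline{\mathcal D}_V(0)=\max|v-w|$ over $v,w$ in the support of the velocity marginal of $\bar\rho_0$. If the integral in the condition on $K$ is $+\infty$, the quotient is read as $0$. *)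

(* Defs.v *)
From HB Require Import structures.
From mathcomp Require Export all_boot all_order all_algebra.
From mathcomp Require Export all_classical all_reals all_analysis.
Export Order.TTheory GRing.Theory Num.Theory.
Export numFieldNormedType.Exports.

Set Implicit Arguments.
Unset Strict Implicit.
Unset Printing Implicit Defensive.

Local Open Scope classical_set_scope.
Local Open Scope ring_scope.

(* The library norm on matrices is the sup norm; it is used only through the
   topology it induces. *)
Definition enorm (R : realType) (d : nat) (x : 'rV[R]_d) : R :=
  Num.sqrt (\sum_(i < d) x ord0 i ^+ 2).

Notation phase R d := ('rV[R]_d * 'rV[R]_d)%type.

Definition phase_norm (R : realType) (d : nat) (z : phase R d) : R :=
  Num.sqrt (enorm z.1 ^+ 2 + enorm z.2 ^+ 2).

Definition borel_rV_display : measure_display.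
Proof. exact: default_measure_display. Qed.

Section borel_rV.
Variables (R : realType) (d : nat).

Let borel0 : <<s (@open 'rV[R]_d) >> set0.
Proof. exact: sigma_algebra0. Qed.

Let borelC A : <<s (@open 'rV[R]_d) >> A -> <<s (@open 'rV[R]_d) >> (~` A).
Proof. exact: sigma_algebraC. Qed.

Let borel_bigcup (F : _^nat) : (forall i, <<s (@open 'rV[R]_d) >> (F i)) ->
  <<s (@open 'rV[R]_d) >> (\bigcup_i (F i)).
Proof. exact: sigma_algebra_bigcup. Qed.

HB.instance Definition _ := @isMeasurable.Build borel_rV_display
  'rV[R]_d <<s (@open 'rV[R]_d) >> borel0 borelC borel_bigcup.

End borel_rV.

Definition msupport (R : realType) (T : topologicalType) (mu : set T -> \bar R)
    : set T :=
  [set x | forall U, open U -> U x -> (0 < mu U)%E].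

(* The maximum of |x - y| over the support; on a nonempty compact support the
   supremum is attained. *)
Definition diameter (R : realType) (d : nat) (mu : set 'rV[R]_d -> \bar R) : R :=
  sup [set r | exists x y, [/\ msupport mu x, msupport mu y &
                              r = enorm (x - y)]].

Definition diameterX (R : realType) (d : nat)
    (mu : probability (phase R d) R) : R := diameter (pushforward mu fst).
Definition diameterV (R : realType) (d : nat)
    (mu : probability (phase R d) R) : R := diameter (pushforward mu snd).

(* The values of a library measure outside the sigma-algebra carry no meaning,
   hence the restriction to measurable sets here and below. *)
Definition has_law (R : realType) d1 d2 (Om : measurableType d1)
    (T : measurableType d2) (P : probability Om R) (Z : Om -> T)
    (mu : probability T R) : Prop :=
  forall A, measurable A -> pushforward P Z A = mu A.

Definition mutually_independent (R : realType) d1 d2 (Om : measurableType d1)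
    (T : measurableType d2) (P : probability Om R) (J : nat)
    (Z : 'I_J -> Om -> T) : Prop :=
  forall (S : {set 'I_J}) (A : 'I_J -> set T), (forall j, measurable (A j)) ->
    P (\bigcap_(j in [set` S]) (Z j @^-1` A j)) =
    (\prod_(j in S) P (Z j @^-1` A j))%E.

Definition iid (R : realType) d1 d2 (Om : measurableType d1)
    (T : measurableType d2) (P : probability Om R) (J : nat)
    (Z : 'I_J -> Om -> T) (mu : probability T R) : Prop :=
  mutually_independent P Z /\ forall j, has_law P (Z j) mu.

Section tensor_power.
Variables (R : realType) (d : measure_display) (T : measurableType d).

Definition cons_pair (n : nat) (z : T * n.-tuple T) : n.+1.-tuple T :=
  [tuple of z.1 :: z.2].

Lemma measurable_cons_pair n : measurable_fun setT (@cons_pair n).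
Proof. exact: measurable_cons. Qed.

HB.instance Definition _ n := @isMeasurableFun.Build _ _ _ _
  (@cons_pair n) (@measurable_cons_pair n).

Fixpoint tensor_power (mu : probability T R) (n : nat) :
    probability (n.-tuple T) R :=
  match n with
  | 0 => \d_([tuple] : 0.-tuple T)
  | n.+1 => distribution (mu \x tensor_power mu n)%E (@cons_pair n)
  end.

End tensor_power.

Definition coupling (R : realType) d (T : measurableType d)
    (mu nu : set T -> \bar R) : set (probability (T * T)%type R) :=
  [set g | forall A, measurable A ->
     g (A `*` setT) = mu A /\ g (setT `*` A) = nu A].

Definition wasserstein2 (R : realType) d (T : measurableType d)
    (dist : T -> T -> R) (mu nu : set T -> \bar R) : \bar R :=
  poweR (ereal_inf [set (\int[g]_z (dist z.1 z.2 ^+ 2)%:E)%E |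
                     g in coupling mu nu]) 2^-1.

Definition recenter (R : realType) (E : lmodType R) (J : nat) (x : 'I_J -> E)
    (j : 'I_J) : E := x j - J%:R^-1 *: \sum_(i < J) x i.

Definition recenter_tuple (R : realType) (d J : nat)
    (z : J.-tuple (phase R d)) : J.-tuple (phase R d) :=
  [tuple recenter (tnth z) j | j < J].

Definition recenter_law (R : realType) (d J : nat)
    (mu : set (J.-tuple (phase R d)) -> \bar R) :
    set (J.-tuple (phase R d)) -> \bar R :=
  pushforward mu (@recenter_tuple R d J).

(* The factor 1/J stands outside the square root. *)
Definition normalized_dist (R : realType) (d J : nat)
    (z w : J.-tuple (phase R d)) : R :=
  J%:R^-1 * Num.sqrt (\sum_(j < J) phase_norm (tnth z j - tnth w j) ^+ 2).

(* A function on R is used only through its values on [0, +oo[; the value at 0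
   is the extension by continuity. *)
Definition communication_rate (R : realType) (L : R) (psi : R -> R) : Prop :=
  [/\ forall s, 0 < s -> 0 < psi s <= 1,
      forall r s, 0 < r -> r <= s -> psi s <= psi r,
      forall r s, 0 < r -> 0 < s -> `|psi r - psi s| <= L * `|r - s| &
      psi s @[s --> 0^'+] --> psi 0].

(* The filter makes the derivative at t = 0 one-sided. *)
Definition has_derivative (R : realType) (d : nat) (f g : R -> 'rV[R]_d) : Prop :=
  forall t, 0 <= t ->
    (s - t)^-1 *: (f s - f t) @[s --> within [set s | 0 <= s] t^'] --> g t.

Definition cucker_smale (R : realType) (d J : nat) (K : R) (psi : R -> R)
    (x0 v0 : 'I_J -> 'rV[R]_d) (x v : 'I_J -> R -> 'rV[R]_d) : Prop :=
  forall j, [/\ x j 0 = x0 j, v j 0 = v0 j,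
    has_derivative (x j) (v j) &
    has_derivative (v j) (fun t => - (K / J%:R) *:
      \sum_(k < J) psi (enorm (x j t - x k t)) *: (v j t - v k t))].

Definition interaction (R : realType) (d : nat) (psi : R -> R)
    (z : phase R d) : 'rV[R]_d := psi (enorm z.1) *: z.2.

Definition interaction_conv (R : realType) (d : nat) (psi : R -> R)
    (mu : probability (phase R d) R) (z : phase R d) : 'rV[R]_d :=
  \row_i \int[mu]_w (interaction psi (z - w) ord0 i).

Definition mean_field_ode (R : realType) (d : nat) (K : R) (psi : R -> R)
    (rho : R -> probability (phase R d) R) (x v : R -> 'rV[R]_d) : Prop :=
  has_derivative x v /\
  has_derivative v (fun t => - K *: interaction_conv psi (rho t) (x t, v t)).

(* The velocity moments are required to be locally bounded in time, so that the
   integrals H * rho_t converge (recall psi <= 1). *)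
Definition mean_field_law (R : realType) (d : nat) (K : R) (psi : R -> R)
    (rho0 : probability (phase R d) R) (rho : R -> probability (phase R d) R)
    : Prop :=
  (forall T : R, exists M : R, forall t, 0 <= t <= T ->
     (\int[rho t]_z (enorm z.2)%:E <= M%:E)%E) /\
  exists (dO : measure_display) (Om : measurableType dO) (P : probability Om R)
         (X V : R -> {RV P >-> 'rV[R]_d}),
    [/\ has_law P (fun w => (X 0 w, V 0 w)) rho0,
        forall t, 0 <= t -> has_law P (fun w => (X t w, V t w)) (rho t) &
        {ae P, forall w, mean_field_ode K psi rho (X ^~ w) (V ^~ w)}].

(* Main.v *)
(* Along both systems the velocity diameter D_V satisfies
   D_V' <= - K psi(D_X) D_V, so that D_V + K int_0^{D_X} psi does not increase;
   the condition on K therefore keeps the position diameters below a radius Dinf,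
   and the velocity diameters decay like exp (- lam t) with lam = K psi(Dinf).

   The recentered differences (x_j, w_j) between the two systems, where
   w_j = x_j', obey
     w_j' = - K/J sum_k psi(|X_j - X_k|) (w_j - w_k)
            + O(K L D_V(t)) |x_j - x_k| + sampling errors.
   Since sum_j w_j = 0, the first term is dissipative at rate lam for the total
   energy; the second has an integrable coefficient. In a Lyapunov functional
   with slowly growing weights on the velocities its growth rate is then
   integrable in time, hence it is bounded by the time integral of the sampling
   errors, uniformly in time.

   The sampling error of particle j is an empirical mean of J centered random
   vectors, pairwise uncorrelated and bounded by 2 D_V(t), so its second moment
   is at most 4 D_V(t)^2 / J. The mean-field particles are independent with law
   rho_t because each is a fixed measurable function (the flow of the mean-field
   ODE) of its own initial condition. *)

From HB Require Import structures.
Require Import Defs.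
From mathcomp Require Import measurable_realfun.
From mathcomp Require Import ring lra.

Set Implicit Arguments.
Unset Strict Implicit.
Unset Printing Implicit Defensive.

Local Open Scope classical_set_scope.
Local Open Scope ring_scope.

(** * The Euclidean inner product *)

(** Summing over j would control only the average of the squared deviations, while the bound is
    claimed for each j. Rather than derive exchangeability of the coupled solutions, the functional
    for particle j adds its own energy to the mean energy. For a single particle the alignment term
    does not close: its weights depend on k, so the zero sum of the velocity deviations does not
    cancel the cross terms, and the mean velocity energy enters with a constant coefficient. A
    larger weight on the mean energy makes that coefficient integrable.

    With s = exp (- lam t / 8) the weights are s^-2 and s^-4, the velocity diameters are of order
    s^8, and every growth coefficient is at most a constant times s, whose time integral is 8 / lam.
    A decreasing factor absorbs this growth along each path, so that after taking expectations only
    an integration in time is left.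

    The radius Dinf is chosen from [psi], K and the two initial diameters alone, so that the
    constant sees the initial law only through these diameters. *)

Section euclid.
Context {R : realType} {d : nat}.
Implicit Types x y z : 'rV[R]_d.

Definition dot x y : R := \sum_(i < d) x ord0 i * y ord0 i.

Lemma dotC x y : dot x y = dot y x.
Proof. by apply: eq_bigr => i _; rewrite mulrC. Qed.

Lemma dotDr x y z : dot x (y + z) = dot x y + dot x z.
Proof. by rewrite -big_split; apply: eq_bigr => i _; rewrite mxE mulrDr. Qed.

Lemma dotZr a x y : dot x (a *: y) = a * dot x y.
Proof. by rewrite big_distrr; apply: eq_bigr => i _; rewrite mxE mulrCA. Qed.

Lemma dotNr x y : dot x (- y) = - dot x y.
Proof. by rewrite -scaleN1r dotZr mulN1r. Qed.

Lemma dotBr x y z : dot x (y - z) = dot x y - dot x z.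
Proof. by rewrite dotDr dotNr. Qed.

Lemma dot0r x : dot x 0 = 0.
Proof. by rewrite -(scale0r 0) dotZr mul0r. Qed.

Lemma dot_sumr x (I : Type) (s : seq I) (P : pred I) (F : I -> 'rV[R]_d) :
  dot x (\sum_(i <- s | P i) F i) = \sum_(i <- s | P i) dot x (F i).
Proof. by elim/big_rec2: _ => [|i y1 y2 _ <-]; rewrite ?dot0r ?dotDr. Qed.

Lemma dotDl x y z : dot (x + y) z = dot x z + dot y z.
Proof. by rewrite !(dotC _ z) dotDr. Qed.

Lemma dotZl a x y : dot (a *: x) y = a * dot x y.
Proof. by rewrite !(dotC _ y) dotZr. Qed.

Lemma dotNl x y : dot (- x) y = - dot x y.
Proof. by rewrite !(dotC _ y) dotNr. Qed.

Lemma dotBl x y z : dot (x - y) z = dot x z - dot y z.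
Proof. by rewrite !(dotC _ z) dotBr. Qed.

Lemma dotxx_ge0 x : 0 <= dot x x.
Proof. by apply: sumr_ge0 => i _; rewrite -expr2 sqr_ge0. Qed.

Lemma enorm_sqr x : enorm x ^+ 2 = dot x x.
Proof.
rewrite sqr_sqrtr; first by apply: eq_bigr => i _; rewrite expr2.
by apply: sumr_ge0 => i _; rewrite sqr_ge0.
Qed.

Lemma enorm_ge0 x : 0 <= enorm x.
Proof. exact: sqrtr_ge0. Qed.

Lemma enorm_eq0 x : enorm x = 0 -> x = 0.
Proof.
move=> x0; have /eqP : dot x x = 0 by rewrite -enorm_sqr x0 expr0n.
rewrite psumr_eq0 => [/allP h|i _]; last by rewrite -expr2 sqr_ge0.
apply/rowP => i; rewrite mxE; apply/eqP.
by have := h i (mem_index_enum i); rewrite mulf_eq0 orbb.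
Qed.

Lemma enorm0 : enorm (0 : 'rV[R]_d) = 0.
Proof. by apply/eqP; rewrite -sqrf_eq0 enorm_sqr dot0r. Qed.

Lemma enormZ a x : enorm (a *: x) = `|a| * enorm x.
Proof.
apply/eqP; rewrite -(eqrXn2 (ltn0Sn 1)) ?enorm_ge0 ?mulr_ge0 ?enorm_ge0//.
by rewrite exprMn !enorm_sqr dotZl dotZr mulrA real_normK ?num_real// expr2.
Qed.

Lemma enormN x : enorm (- x) = enorm x.
Proof. by rewrite -scaleN1r enormZ normrN1 mul1r. Qed.

Lemma enormC x y : enorm (x - y) = enorm (y - x).
Proof. by rewrite -enormN opprB. Qed.

(** Cauchy-Schwarz: the square of |y| x - |x| y expands to 2 |x| |y| (|x| |y| - dot x y). *)
Lemma dot_le x y : dot x y <= enorm x * enorm y.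
Proof.
have [/enorm_eq0 ->|x0] := eqVneq (enorm x) 0.
  by rewrite dotC dot0r mulr_ge0 ?enorm_ge0.
have [/enorm_eq0 ->|y0] := eqVneq (enorm y) 0.
  by rewrite dot0r mulr_ge0 ?enorm_ge0.
have xy : 0 < enorm x * enorm y by rewrite mulr_gt0// lt0r ?x0 ?y0 enorm_ge0.
have := dotxx_ge0 (enorm y *: x - enorm x *: y).
rewrite dotBl !dotBr !dotZl !dotZr -!enorm_sqr (dotC y x) => h.
rewrite -(ler_pM2l xy); nra.
Qed.

Lemma normr_dot_le x y : `|dot x y| <= enorm x * enorm y.
Proof.
by rewrite ler_norml dot_le andbT lerNl -dotNl (le_trans (dot_le _ _))// enormN.
Qed.

(** Testing against every e turns a bound on a norm into bounds on scalar functions of time, to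
    which the mean value theorem applies. The proof takes e = x. *)
Lemma enorm_le_dual x c : 0 <= c -> (forall e, dot e x <= enorm e * c) ->
  enorm x <= c.
Proof.
move=> c0 h; have [->//|x0] := eqVneq (enorm x) 0.
have x1 : 0 < enorm x by rewrite lt0r x0 enorm_ge0.
by rewrite -(ler_pM2l x1) -expr2 enorm_sqr.
Qed.

Lemma enormD x y : enorm (x + y) <= enorm x + enorm y.
Proof.
apply: enorm_le_dual => [|e]; first by rewrite addr_ge0 ?enorm_ge0.
by rewrite dotDr mulrDr lerD ?dot_le.
Qed.

Lemma enormB x y : enorm (x - y) <= enorm x + enorm y.
Proof. by rewrite -(enormN y) enormD. Qed.

Lemma enorm_dist x y : `|enorm x - enorm y| <= enorm (x - y).
Proof.
rewrite ler_norml; apply/andP; split.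
  have := enormD x (y - x); rewrite [x + _]addrC subrK enormC; lra.
by have := enormD y (x - y); rewrite [y + _]addrC subrK; lra.
Qed.

Lemma enorm_sum (I : Type) (s : seq I) (P : pred I) (F : I -> 'rV[R]_d) :
  enorm (\sum_(i <- s | P i) F i) <= \sum_(i <- s | P i) enorm (F i).
Proof.
elim/big_rec2: _ => [|i y1 y2 _ h]; first by rewrite enorm0.
by rewrite (le_trans (enormD _ _))// lerD2l.
Qed.

Lemma normr_coord_le x i : `|x ord0 i| <= enorm x.
Proof.
rewrite -(ler_pXn2r (ltn0Sn 1)) ?nnegrE ?enorm_ge0// real_normK ?num_real//.
rewrite enorm_sqr /dot (bigD1 i)//= -expr2 lerDl.
by apply: sumr_ge0 => j _; rewrite -expr2 sqr_ge0.
Qed.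

(** Continuity and compactness refer to the sup norm of the library; this comparison carries them
    over to the Euclidean norm. *)
Lemma enorm_le_mx x : enorm x <= Num.sqrt d%:R * `|x|.
Proof.
have c x' i : `|x' ord0 i| <= `|x' : 'rV[R]_d|.
  by rewrite [leRHS]/Num.norm/= mx_normrE; apply: (le_bigmax _ _ (ord0, i)).
rewrite -(ler_pXn2r (ltn0Sn 1)) ?nnegrE ?enorm_ge0 ?mulr_ge0 ?sqrtr_ge0//.
rewrite enorm_sqr exprMn sqr_sqrtr//.
rewrite (le_trans (y := \sum_(i < d) `|x| ^+ 2))//.
  apply: ler_sum => i _; rewrite -expr2 -real_normK ?num_real//.
  by rewrite ler_pXn2r ?nnegrE.
by rewrite sumr_const card_ord mulr_natl.
Qed.

End euclid.

(** * Derivatives on the half-line *)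

Section half_line.
Context {R : realType}.
Implicit Types f g df dg : R -> R.

(* [df] is the derivative of [f] on ]0, +oo[ and [f] is continuous on
   [0, +oo[; this is all the mean value theorem needs. *)
Definition sderiv f df :=
  (forall t : R, 0 < t -> is_derive t 1 f (df t)) /\
  {within [set t : R | 0 <= t], continuous f}.

Lemma sderiv_ext f g df dg : sderiv f df ->
  (forall t, f t = g t) -> (forall t : R, 0 < t -> df t = dg t) -> sderiv g dg.
Proof.
move=> [d1 c1] /funext <- e; split => // t t0; rewrite -e//; exact: d1.
Qed.

Lemma sderivD f g df dg : sderiv f df -> sderiv g dg ->
  sderiv (fun t => f t + g t) (fun t => df t + dg t).
Proof.
move=> [d1 c1] [d2 c2]; split => [t t0|t].
  by apply: is_deriveD; [exact: d1|exact: d2].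
by apply: cvgD; [exact: c1|exact: c2].
Qed.

Lemma sderivM f g df dg : sderiv f df -> sderiv g dg ->
  sderiv (fun t => f t * g t) (fun t => df t * g t + f t * dg t).
Proof.
move=> [d1 c1] [d2 c2]; split => [t t0|t].
  apply: is_derive_eq; first by apply: is_deriveM; [exact: d1|exact: d2].
  by rewrite /GRing.scale/= addrC mulrC.
by apply: cvgM; [exact: c1|exact: c2].
Qed.

Lemma sderiv_cst (a : R) : sderiv (fun=> a) (fun=> 0).
Proof. by split => [t t0|t]; [exact: is_derive_cst|exact: cvg_cst]. Qed.

Lemma sderivZ (a : R) f df : sderiv f df ->
  sderiv (fun t => a * f t) (fun t => a * df t).
Proof.
move=> h; apply: sderiv_ext (sderivM (sderiv_cst a) h) _ _ => //= t _.
by rewrite mul0r add0r.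
Qed.

Lemma sderivN f df : sderiv f df -> sderiv (fun t => - f t) (fun t => - df t).
Proof.
by move=> /(sderivZ (-1)) h; apply: sderiv_ext h _ _ => t *; rewrite mulN1r.
Qed.

Lemma sderivB f g df dg : sderiv f df -> sderiv g dg ->
  sderiv (fun t => f t - g t) (fun t => df t - dg t).
Proof. by move=> h /sderivN; exact: sderivD. Qed.

Lemma sderiv_sum (I : Type) (s : seq I) (f df : I -> R -> R) :
  (forall i, sderiv (f i) (df i)) ->
  sderiv (fun t => \sum_(i <- s) f i t) (fun t => \sum_(i <- s) df i t).
Proof.
move=> h; elim: s => [|i s ih].
  by apply: sderiv_ext (sderiv_cst 0) _ _ => t *; rewrite big_nil.
by apply: sderiv_ext (sderivD (h i) ih) _ _ => t *; rewrite big_cons.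
Qed.

Lemma sderiv_id : sderiv id (fun=> 1).
Proof.
split=> [t _|]; first exact: is_derive_id.
by apply: continuous_subspaceT => t; exact: cvg_id.
Qed.

Lemma sderiv_expR f df : sderiv f df ->
  sderiv (fun t => expR (f t)) (fun t => df t * expR (f t)).
Proof.
move=> [d1 c1]; split => [t t0|t].
  have h := d1 _ t0.
  by have := @is_derive1_comp _ expR f t _ _ (is_derive_expR (f t)) h; rewrite mulrC.
by apply: (@cvg_comp _ _ _ f expR); [exact: c1|exact: continuous_expR].
Qed.

Lemma sderiv_expRM (a : R) : sderiv (fun t => expR (a * t)) (fun t => a * expR (a * t)).
Proof.
apply: sderiv_ext (sderiv_expR (sderivZ a sderiv_id)) _ _ => //= t _.
by rewrite mulr1.
Qed.

Lemma sderiv_MVT f df (a b : R) : sderiv f df -> 0 <= a -> a < b ->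
  exists2 c, a < c < b & f b - f a = df c * (b - a).
Proof.
move=> [d1 c1] a0 ab.
have [||c] := @MVT _ f df a b ab.
- move=> x; rewrite in_itv/= => /andP[ax _]; apply: d1; exact: le_lt_trans ax.
- apply: continuous_subspaceW c1 => x /=; rewrite in_itv/= => /andP[ax _].
  exact: le_trans ax.
by rewrite in_itv/= => cab e; exists c.
Qed.

Lemma sderiv_le0 f df (a b : R) : sderiv f df ->
  (forall t : R, a < t < b -> df t <= 0) -> 0 <= a -> a <= b -> f b <= f a.
Proof.
move=> h df0 a0; rewrite le_eqVlt => /predU1P[->//|ab].
have [c cab e] := sderiv_MVT h a0 ab.
by rewrite -subr_le0 e mulr_le0_ge0 ?subr_ge0 ?(ltW ab)// df0.
Qed.

(** The product of [f] with exp (- c t) is nonincreasing on [0, t]. *)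
Lemma gronwall f df (c t : R) : sderiv f df ->
  (forall s : R, 0 < s < t -> df s <= c * f s) -> 0 <= t -> f t <= f 0 * expR (c * t).
Proof.
move=> h dfc t0.
have H := sderivM h (sderiv_expRM (- c)).
have /= := sderiv_le0 H _ (lexx 0) t0.
rewrite mulr0 expR0 mulr1 mulNr expRN => H'.
rewrite -ler_pdivrMr ?expR_gt0//; apply: H' => s s0t.
have := dfc s s0t; have := expR_gt0 (- c * s); nra.
Qed.

Lemma has_derivative_coord d (f g : R -> 'rV[R]_d) i : has_derivative f g ->
  sderiv (fun t => f t ord0 i) (fun t => g t ord0 i).
Proof.
move=> fg.
have lim (t : R) : 0 <= t -> forall e : R, 0 < e -> exists2 r : R, 0 < r &
    forall s : R, 0 <= s -> s != t -> `|s - t| < r ->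
    `|g t ord0 i - (s - t)^-1 * (f s ord0 i - f t ord0 i)| < e.
  move=> t0 e e0.
  have /= h : (((s - t)^-1 *: (f s - f t)) : 'rV[R]_d) ord0 i
      @[s --> within [set s : R | 0 <= s] t^'] --> g t ord0 i.
    apply: (@cvg_comp _ _ _ (fun s => ((s - t)^-1 *: (f s - f t)) : 'rV[R]_d)
      (fun M : 'rV[R]_d => M ord0 i)); first exact: fg.
    exact: coord_continuous.
  move/cvgrPdist_lt : h => /(_ e e0) [r /= r0 H].
  exists r => // s s0 st sr.
  have /= := H s; rewrite /ball_/= distrC => /(_ sr) /(_ st) /(_ s0).
  by rewrite !mxE.
split=> [t t0|].
  apply: DeriveDef; last first.
    apply/cvg_lim => //=; apply/cvgrPdist_lt => e e0.
    have [r r0 H] := lim t (ltW t0) e e0.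
    (* The cap t on the radius keeps h + t nonnegative, where the one-sided limit is known. *)
    exists (Num.min r t) => /=; first by rewrite lt_min r0 t0.
    move=> h /=; rewrite sub0r normrN lt_min => /andP[hr ht] h0.
    rewrite scaler1.
    have := H (h + t); rewrite addrK; apply => //.
      have := ler_norm (- h); rewrite normrN; lra.
    by rewrite -subr_eq0 addrK.
  apply/cvg_ex; exists (g t ord0 i) => /=; apply/cvgrPdist_lt => e e0.
  have [r r0 H] := lim t (ltW t0) e e0.
  exists (Num.min r t) => /=; first by rewrite lt_min r0 t0.
  move=> h /=; rewrite sub0r normrN lt_min => /andP[hr ht] h0.
  rewrite scaler1.
  have := H (h + t); rewrite addrK; apply => //.
    have := ler_norm (- h); rewrite normrN; lra.
  by rewrite -subr_eq0 addrK.
apply/subspace_continuousP => t /= t0; apply/cvgrPdist_lt => e e0.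
have [r r0 H] := lim t t0 1 ltr01.
(* With tolerance 1 the difference quotients near t are at most M: a local Lipschitz bound, valid at
   t = 0 too. *)
pose M := `|g t ord0 i| + 1.
have M0 : 0 < M by rewrite ltr_wpDl.
exists (Num.min r (e / M)) => /=; first by rewrite lt_min r0 divr_gt0.
move=> s /=; rewrite distrC lt_min => /andP[sr se] s0.
have [->|st] := eqVneq s t; first by rewrite subrr normr0.
have := H s s0 st sr => {}H.
have st0 : s - t != 0 by rewrite subr_eq0.
have -> : f t ord0 i - f s ord0 i =
    (s - t) * - ((s - t)^-1 * (f s ord0 i - f t ord0 i)).
  by rewrite mulrN mulVKf// opprB.
rewrite normrM normrN; move: H se; set q := (_^-1 * _); rewrite ltr_pdivlMr// => H se.
apply: le_lt_trans se; apply: ler_wpM2l => //.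
have := ler_normB (g t ord0 i) (g t ord0 i - q); rewrite subKr /M; lra.
Qed.

Lemma has_derivative_dot d (f g : R -> 'rV[R]_d) (e : 'rV[R]_d) :
  has_derivative f g -> sderiv (fun t => dot e (f t)) (fun t => dot e (g t)).
Proof.
by move=> h; apply: sderiv_sum => i; apply/sderivZ/has_derivative_coord.
Qed.

Lemma sderiv_dot d (f g : R -> 'rV[R]_d) : has_derivative f g ->
  sderiv (fun t => dot (f t) (f t)) (fun t => 2 * dot (f t) (g t)).
Proof.
move=> h; have hi i := has_derivative_coord i h.
apply: sderiv_ext (sderiv_sum _ (fun i => sderivM (hi i) (hi i))) _ _ => //.
move=> t _; rewrite /dot big_distrr; apply: eq_bigr => i _ /=.
by rewrite [g t _ _ * _]mulrC mulr_natl mulr2n.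
Qed.

(** Cut [0, T] into n + 1 equal steps: the quadratic errors add up to C T^2 / (n + 1), which tends
    to 0. This replaces the sign of a derivative for functions that need not be differentiable. *)
Lemma nonincr_of_step f (C T r : R) : 0 <= C -> 0 < r ->
  (forall t h : R, 0 <= t -> 0 <= h -> h <= r -> t + h <= T ->
    f (t + h) <= f t + C * h ^+ 2) ->
  0 <= T -> f T <= f 0.
Proof.
move=> C0 r0 st T0.
have main n : T / n.+1%:R <= r -> f T <= f 0 + C * T ^+ 2 / n.+1%:R.
  pose h := T / n.+1%:R => hr.
  have h0 : 0 <= h by rewrite divr_ge0.
  have ih k : (k <= n.+1)%N -> f (k%:R * h) <= f 0 + k%:R * (C * h ^+ 2).
    elim: k => [|k ih] kn; first by rewrite !mul0r addr0.
    have := st (k%:R * h) h.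
    have kT : k.+1%:R * h <= T.
      by rewrite /h mulrCA ler_piMr// ler_pdivrMr ?mul1r ?ler_nat.
    have e : k%:R * h + h = k.+1%:R * h by rewrite -natr1 mulrDl mul1r.
    rewrite mulr_ge0// e => /(_ isT h0 hr kT) H; apply: (le_trans H).
    by rewrite -natr1 mulrDl mul1r addrA lerD2r ih// ltnW.
  have := ih n.+1 (leqnn _); rewrite /h mulrCA divff ?mulr1 ?pnatr_eq0//.
  congr (_ <= _); congr (_ + _).
  have : n.+1%:R != 0 :> R by rewrite pnatr_eq0.
  by set q := n.+1%:R => q0; field.
apply/ler_addgt0Pr => e e0.
(* n + 1 exceeds both C T^2 / e, for the error, and T / r, for the step length. *)
pose n := Num.truncn (C * T ^+ 2 / e + T / r).
have nS : C * T ^+ 2 / e + T / r < n.+1%:R by exact: truncnS_gt.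
have a0 : 0 <= C * T ^+ 2 / e by rewrite divr_ge0 ?mulr_ge0 ?sqr_ge0// ltW.
have b0 : 0 <= T / r by rewrite divr_ge0// ltW.
apply: (le_trans (main n _)).
  by rewrite ler_pdivrMr// mulrC -ler_pdivrMr//; lra.
rewrite lerD2l ler_pdivrMr// [leRHS]mulrC -ler_pdivrMr//; lra.
Qed.

End half_line.

(** * The communication rate on the closed half-line *)

Section rate.
Context {R : realType} (L : R) (psi : R -> R).
Hypothesis rate : communication_rate L psi.

Lemma rate_lip_ge0 : 0 <= L.
Proof.
have [_ _ lip _] := rate.
have := lip 1 2 ltr01 (ltr0n _ 2).
have -> : `|1 - 2| = 1 :> R by rewrite ltr0_norm; lra.
by rewrite mulr1; apply: le_trans.
Qed.

(** The properties of [psi] are assumed on the open half-line; points close to 0 carry them to the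
    value at 0 by continuity. *)
Let near0 (e s : R) : 0 < e -> 0 < s ->
  exists2 r, 0 < r < s & `|psi 0 - psi r| < e.
Proof.
move=> e0 s0; have [_ _ _ /cvgrPdist_lt/(_ e e0)[r /= r0 H]] := rate.
have m0 : 0 < Num.min r s by rewrite lt_min r0.
have m1 : Num.min r s <= r by rewrite ge_min lexx.
have m2 : Num.min r s <= s by rewrite ge_min lexx orbT.
exists (Num.min r s / 2); first by apply/andP; split; lra.
apply: H; last by lra.
by rewrite /ball_/= sub0r normrN gtr0_norm; lra.
Qed.

Lemma rate_nincr (r s : R) : 0 <= r -> r <= s -> psi s <= psi r.
Proof.
have [_ mono _ _] := rate.
rewrite le_eqVlt => /predU1P[<-|]; last exact: mono.
rewrite le_eqVlt => /predU1P[<-//|s0]; apply/ler_addgt0Pr => e e0.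
have [q /andP[q0 qs]] := near0 e0 s0.
rewrite ltr_norml => /andP[h1 h2]; have := mono _ _ q0 (ltW qs); lra.
Qed.

Lemma rate_gt0 (s : R) : 0 <= s -> 0 < psi s.
Proof.
move=> s0; have [H _ _ _] := rate.
apply: lt_le_trans (rate_nincr s0 (_ : s <= s + 1)); last by rewrite lerDl.
by have /andP[] := H (s + 1) (ltr_wpDl s0 ltr01).
Qed.

Lemma rate_le1 (s : R) : 0 <= s -> psi s <= 1.
Proof.
have [H _ _ _] := rate.
rewrite le_eqVlt => /predU1P[<-|/H/andP[]//]; apply/ler_addgt0Pr => e e0.
have [q /andP[q0 qs]] := near0 e0 ltr01.
rewrite ltr_norml => /andP[h1 h2]; have /andP[_] := H q q0; lra.
Qed.

Lemma rate_lip (r s : R) : 0 <= r -> 0 <= s -> `|psi r - psi s| <= L * `|r - s|.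
Proof.
have [_ _ lip _] := rate; have L0 := rate_lip_ge0.
have lip0 (u : R) : 0 < u -> `|psi 0 - psi u| <= L * `|0 - u|.
  move=> u0; apply/ler_addgt0Pr => e e0; have [q /andP[q0 qu] H] := near0 e0 u0.
  rewrite sub0r normrN (gtr0_norm u0).
  have := lip q u q0 u0; rewrite (@ltr0_norm _ (q - u)); last by lra.
  have := ler_distD (psi q) (psi 0) (psi u).
  have : L * - (q - u) <= L * u by rewrite ler_wpM2l; lra.
  lra.
rewrite le_eqVlt => /predU1P[<-|r0]; rewrite le_eqVlt => /predU1P[<-|s0].
- by rewrite !subrr normr0 mulr0.
- exact: lip0.
- by rewrite distrC [`|r - 0|]distrC; exact: lip0.
- exact: lip.
Qed.

End rate.

(** The sum of p - q and the left side is the difference of the barycentres (1 - a) p + a r and (1 -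
    b) q + b r, which share the point r. If b <= a it equals (1 - a) (p - q) + (a - b) (r - q), at
    most (1 - b) B; the other case is symmetric. Below, p, q and r are components along a vector e
    of two velocities and of a third one that both interact with. *)
Lemma alignment_barycentric {R : realType} (a b c B p q r : R) :
  c <= a <= 1 -> c <= b <= 1 -> 0 <= B ->
  p - q <= B -> r - q <= B -> p - r <= B ->
  - (a * (p - r) - b * (q - r)) <= (1 - c) * B - (p - q).
Proof.
move=> /andP[ca a1] /andP[cb b1] B0 pq rq pr.
have [ab|/ltW ba] := leP b a.
  have h1 : (a - b) * (r - q) <= (a - b) * B by rewrite ler_wpM2l// subr_ge0.
  have h2 : (1 - a) * (p - q) <= (1 - a) * B by rewrite ler_wpM2l// subr_ge0.
  have h3 : (1 - b) * B <= (1 - c) * B by rewrite ler_wpM2r// lerB.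
  lra.
have h1 : (b - a) * (p - r) <= (b - a) * B by rewrite ler_wpM2l// subr_ge0.
have h2 : (1 - b) * (p - q) <= (1 - b) * B by rewrite ler_wpM2l// subr_ge0.
have h3 : (1 - a) * B <= (1 - c) * B by rewrite ler_wpM2r// lerB.
lra.
Qed.

(** * Flocking of a family of trajectories *)

Section family_diameter.
Context {R : realType} {d : nat} {I : Type} (i0 : I).
Implicit Type z : I -> 'rV[R]_d.

Definition family_diam z : R := sup [set r | exists a b, r = enorm (z a - z b)].

Lemma family_diam_ub z M : (forall a b, enorm (z a - z b) <= M) ->
  forall a b, enorm (z a - z b) <= family_diam z.
Proof.
move=> zM a b; apply: ub_le_sup; last by exists a, b.
by exists M => _ [? [? ->]].
Qed.

Lemma family_diam_le z M : (forall a b, enorm (z a - z b) <= M) ->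
  family_diam z <= M.
Proof.
move=> zM; apply: ge_sup; first by exists (enorm (z i0 - z i0)), i0, i0.
by move=> _ [? [? ->]].
Qed.

Lemma family_diam_ge0 z M : (forall a b, enorm (z a - z b) <= M) ->
  0 <= family_diam z.
Proof. by move=> /family_diam_ub/(_ i0 i0); apply: le_trans; exact: enorm_ge0. Qed.

End family_diameter.

Section flocking.
Context {R : realType} (L : R) (psi : R -> R).
Hypothesis rate : communication_rate L psi.
Context {d : nat} {I : Type} (i0 : I) (K : R) (x v m : I -> R -> 'rV[R]_d).
Hypothesis K0 : 0 < K.
Hypothesis dx : forall a, has_derivative (x a) (v a).
Hypothesis dv : forall a, has_derivative (v a) (m a).
(* This single estimate is what the particles and the mean-field trajectories
   share; flocking is deduced from it for both at once. *)
Hypothesis align : forall (t : R) a b (DX DV : R), 0 < t ->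
  (forall a b, enorm (x a t - x b t) <= DX) ->
  (forall a b, enorm (v a t - v b t) <= DV) ->
  forall e, dot e (m a t - m b t) <=
    K * (enorm e * ((1 - psi DX) * DV) - dot e (v a t - v b t)).
Hypothesis loc_bound : forall T : R, exists M : R, forall t a b, 0 <= t <= T ->
  enorm (x a t - x b t) <= M /\ enorm (v a t - v b t) <= M.
Variables (DX0 DV0 Dinf : R) (Gam : R -> R).
Hypothesis DX00 : 0 <= DX0.
Hypothesis iniX : forall a b, enorm (x a 0 - x b 0) <= DX0.
Hypothesis iniV : forall a b, enorm (v a 0 - v b 0) <= DV0.
(** [Gam] stands for a primitive of [psi]. As [psi] is nonincreasing, the primitive is concave, and
    its supergradient inequality takes the place of a derivative. *)
Hypothesis Gam_ndecr : forall a b : R, DX0 <= a -> a <= b -> Gam a <= Gam b.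
Hypothesis Gam_concave : forall a b : R, DX0 <= a -> a <= b ->
  Gam b - Gam a <= psi a * (b - a).
Hypothesis DinfP : DV0 < K * (Gam Dinf - Gam DX0).
Hypothesis Dinf_ge : DX0 <= Dinf.

Let DV t := family_diam (v ^~ t).
(** The position diameter is floored at [DX0], since the properties of [Gam] are available only from
    there on. *)
Let P t := Num.max DX0 (family_diam (x ^~ t)).

Let dotB_sderiv (z dz : I -> R -> 'rV[R]_d) a b e :
  (forall a, has_derivative (z a) (dz a)) ->
  sderiv (fun t => dot e (z a t - z b t)) (fun t => dot e (dz a t - dz b t)).
Proof.
move=> h; apply: sderiv_ext (sderivB (has_derivative_dot e (h a))
  (has_derivative_dot e (h b))) _ _ => [t|t _]; by rewrite dotBr.
Qed.

(* A diameter is a supremum over pairs and need not be differentiable, so it is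
   followed through time steps of length h, with errors O(h^2). *)
Section window.
Variables (T M : R).
Hypothesis MP : forall t a b, 0 <= t <= T ->
  enorm (x a t - x b t) <= M /\ enorm (v a t - v b t) <= M.

Let MX t a b : 0 <= t <= T -> enorm (x a t - x b t) <= M.
Proof. by move=> h; have [] := MP a b h. Qed.

Let MV t a b : 0 <= t <= T -> enorm (v a t - v b t) <= M.
Proof. by move=> h; have [] := MP a b h. Qed.

Let P_ub t a b : 0 <= t <= T -> enorm (x a t - x b t) <= P t.
Proof.
move=> h; rewrite le_max (family_diam_ub (M := M)) ?orbT// => a' b'; exact: MX.
Qed.

Let DV_ub t a b : 0 <= t <= T -> enorm (v a t - v b t) <= DV t.
Proof. by move=> h; apply: (family_diam_ub (M := M)) => a' b'; exact: MV. Qed.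

Let DV_le t : 0 <= t <= T -> DV t <= M.
Proof. by move=> h; apply: (family_diam_le i0) => a b; exact: MV. Qed.

Let DV_ge0 t : 0 <= t <= T -> 0 <= DV t.
Proof. by move=> h; apply: (family_diam_ge0 i0 (M := M)) => a b; exact: MV. Qed.

Let P_ge t : DX0 <= P t. Proof. by rewrite le_max lexx. Qed.

Let P_ge0 t : 0 <= P t. Proof. exact: le_trans (P_ge t). Qed.

Let psi01 t : 0 < psi (P t) <= 1.
Proof. by rewrite (rate_gt0 rate) ?(rate_le1 rate). Qed.

Let M0 t : 0 <= t <= T -> 0 <= M.
Proof. by move=> h; exact: le_trans (DV_ge0 h) (DV_le h). Qed.

Let dV_le t a b e : 0 < t <= T ->
  dot e (m a t - m b t) <= 2 * K * M * enorm e.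
Proof.
move=> /andP[t0 tT]; have tt : 0 <= t <= T by rewrite ltW.
have := align a b t0 (fun a b => P_ub a b tt) (fun a b => DV_ub a b tt) e.
have h1 : - dot e (v a t - v b t) <= enorm e * M.
  rewrite -dotNl (le_trans (dot_le _ _))// enormN ler_wpM2l ?enorm_ge0//.
  exact: MV.
have /andP[p0 p1] := psi01 t.
have h2 : enorm e * ((1 - psi (P t)) * DV t) <= enorm e * M.
  rewrite ler_wpM2l ?enorm_ge0// (le_trans _ (DV_le tt))// ler_piMl ?DV_ge0//.
  lra.
move=> H; apply: (le_trans H).
rewrite -mulrA [leRHS](_ : _ = K * (enorm e * M + enorm e * M)); last by ring.
by rewrite ler_pM2l// lerD.
Qed.

Let dotV_lip t s a b e : 0 <= t -> t <= s -> s <= T ->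
  dot e (v a s - v b s) <= dot e (v a t - v b t) + 2 * K * M * enorm e * (s - t).
Proof.
move=> t0; rewrite le_eqVlt => /predU1P[<-|ts] sT.
  by rewrite subrr mulr0 addr0.
have [c /andP[tc cs] e1] := sderiv_MVT (dotB_sderiv a b e dv) t0 ts.
rewrite -lerBlDl e1 ler_wpM2r ?subr_ge0 ?(ltW ts)// dV_le//.
by apply/andP; split; lra.
Qed.

Let DV_lip t s : 0 <= t -> t <= s -> s <= T -> DV s <= DV t + 2 * K * M * (s - t).
Proof.
move=> t0 ts sT; apply: (family_diam_le i0) => a b.
have tt : 0 <= t <= T by rewrite t0 (le_trans ts).
apply: enorm_le_dual => [|e].
  rewrite addr_ge0 ?DV_ge0// !mulr_ge0 ?(ltW K0) ?(M0 tt)// subr_ge0//.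
rewrite (le_trans (dotV_lip a b e t0 ts sT))// [leRHS]mulrDr lerD//.
  by rewrite (le_trans (dot_le _ _))// ler_wpM2l ?enorm_ge0// DV_ub.
by rewrite le_eqVlt; apply/orP; left; apply/eqP; ring.
Qed.

Let P_step t h : 0 <= t -> 0 <= h -> t + h <= T ->
  P (t + h) <= P t + (h * DV t + 2 * K * M * h ^+ 2).
Proof.
move=> t0 h0 thT.
have tt : 0 <= t <= T by rewrite t0 (le_trans _ thT)// lerDl.
have c0 : 0 <= h * DV t + 2 * K * M * h ^+ 2.
  by rewrite addr_ge0 ?mulr_ge0 ?DV_ge0// ?sqr_ge0 ?(ltW K0) ?(M0 tt)//.
rewrite ge_max (le_trans (P_ge t)) ?lerDl//=.
apply: (family_diam_le i0) => a b; apply: enorm_le_dual => [|e].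
  by rewrite addr_ge0.
have h1 : dot e (x a t - x b t) <= enorm e * P t.
  by rewrite (le_trans (dot_le _ _))// ler_wpM2l ?enorm_ge0// P_ub.
move: h0; rewrite le_eqVlt => /predU1P[<-|h0].
  by rewrite !addr0 mul0r expr0n/= mulr0 !addr0.
have tth : t < t + h by rewrite ltrDl.
have [c /andP[tc cth] e1] := sderiv_MVT (dotB_sderiv a b e dx) t0 tth.
have cc : 0 <= c <= T by apply/andP; split; lra.
have h2 : dot e (v a c - v b c) <= enorm e * (DV t + 2 * K * M * h).
  rewrite (le_trans (dot_le _ _))// ler_wpM2l ?enorm_ge0//.
  rewrite (le_trans (DV_ub a b cc))//.
  have [cc1 cc2] := andP cc.
  rewrite (le_trans (DV_lip t0 (ltW tc) cc2))// lerD2l ler_wpM2l//.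
    by rewrite !mulr_ge0 ?(ltW K0) ?(M0 tt).
  lra.
move: e1; rewrite [t + h]addrC addrK => e1.
have -> : dot e (x a (h + t) - x b (h + t)) =
    dot e (x a t - x b t) + dot e (v a c - v b c) * h by lra.
rewrite mulrDr lerD//.
rewrite (le_trans (y := enorm e * (DV t + 2 * K * M * h) * h)) ?ler_wpM2r ?(ltW h0)//.
by rewrite le_eqVlt; apply/orP; left; apply/eqP; ring.
Qed.

(** Passing from an intermediate time c back to t costs 2 K M for the velocity difference itself, 2
    K M for the velocity diameter, and L M^2 for the change of [psi (P t)], since P varies at most
    at speed M. *)
Let C1 := K * (4 * K * M + L * M ^+ 2).

(** Along a fixed e the mean value theorem gives a time c at which [align] applies; all terms are
    then moved back to t at cost O(h). The restriction h <= 1/K makes 1 - h K nonnegative, so the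
    velocity difference at t enters with a sign that allows bounding it by the diameter. *)
Let DV_step t h : 0 <= t -> 0 <= h -> h <= K^-1 -> t + h <= T ->
  DV (t + h) <= (1 - h * K * psi (P t)) * DV t + C1 * h ^+ 2.
Proof.
move=> t0 h0 hK thT.
have tt : 0 <= t <= T by rewrite t0 (le_trans _ thT)// lerDl.
have hK1 : h * K <= 1 by rewrite -ler_pdivlMr// mul1r.
have /andP[p0 p1] := psi01 t.
have L0 := rate_lip_ge0 rate.
have M0' := M0 tt.
have DV0' := DV_ge0 tt.
have DVM := DV_le tt.
have C10 : 0 <= C1.
  by rewrite !(mulr_ge0, addr_ge0) ?(ltW K0)// sqr_ge0.
apply: (family_diam_le i0) => a b; apply: enorm_le_dual => [|e].
  apply: addr_ge0; apply: mulr_ge0 => //; last exact: sqr_ge0.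
  by rewrite subr_ge0 mulr_ile1 ?(ltW p0) ?mulr_ge0 ?(ltW K0).
have h1 : dot e (v a t - v b t) <= enorm e * DV t.
  by rewrite (le_trans (dot_le _ _))// ler_wpM2l ?enorm_ge0// DV_ub.
have e0 := enorm_ge0 e.
move: h0; rewrite le_eqVlt => /predU1P[<-|h0].
  by rewrite addr0 !mul0r subr0 mul1r expr0n/= mulr0 addr0.
have tth : t < t + h by rewrite ltrDl.
have [c /andP[tc cth] e1] := sderiv_MVT (dotB_sderiv a b e dv) t0 tth.
have c0 : 0 < c by lra.
have cT : c <= T by lra.
have cc : 0 <= c <= T by rewrite ltW.
have ch : c - t <= h by lra.
have al := align a b c0 (fun a b => P_ub a b cc) (fun a b => DV_ub a b cc) e.
have h2 : - dot e (v a c - v b c) <=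
    - dot e (v a t - v b t) + 2 * K * M * enorm e * h.
  have := dotV_lip a b (- e) t0 (ltW tc) cT; rewrite !dotNl enormN => H.
  apply: (le_trans H); rewrite lerD2l ler_wpM2l// !mulr_ge0// ltW//.
have h3 : DV c <= DV t + 2 * K * M * h.
  apply: (le_trans (DV_lip t0 (ltW tc) cT)); rewrite lerD2l ler_wpM2l//.
  by rewrite !mulr_ge0// ltW.
have h4 : P c <= P t + M * h.
  rewrite ge_max (le_trans (P_ge t)) ?lerDl ?mulr_ge0 ?(ltW h0)//=.
  apply: (family_diam_le i0) => a' b'; apply: enorm_le_dual => [|e'].
    by rewrite addr_ge0// mulr_ge0// ltW.
  have [c' /andP[tc' c'c] e1'] := sderiv_MVT (dotB_sderiv a' b' e' dx) t0 tc.
  have c'c' : 0 <= c' <= T by apply/andP; split; lra.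
  have k1 : dot e' (x a' t - x b' t) <= enorm e' * P t.
    by rewrite (le_trans (dot_le _ _))// ler_wpM2l ?enorm_ge0// P_ub.
  have k2 : dot e' (v a' c' - v b' c') * (c - t) <= enorm e' * M * h.
    rewrite (le_trans (y := enorm e' * M * (c - t)))//.
      rewrite ler_wpM2r ?subr_ge0 ?(ltW tc)//.
      by rewrite (le_trans (dot_le _ _))// ler_wpM2l ?enorm_ge0// MV.
    by rewrite ler_wpM2l// mulr_ge0// enorm_ge0.
  rewrite mulrDr mulrA; lra.
have h5 : psi (P t) - L * M * h <= psi (P c).
  have := rate_nincr rate (P_ge0 c) h4.
  have Mh : 0 <= M * h by rewrite mulr_ge0// ltW.
  have := rate_lip rate (P_ge0 t) (addr_ge0 (P_ge0 t) Mh).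
  rewrite opprD addNKr normrN (ger0_norm Mh) ler_norml => /andP[_]; lra.
have /andP[q0 q1] := psi01 c.
have DVc0 := DV_ge0 cc.
have h6 : (1 - psi (P c)) * DV c <=
    (1 - psi (P t)) * DV t + (2 * K * M + L * M ^+ 2) * h.
  have k1 : (1 - psi (P c)) * DV c <= (1 - psi (P t) + L * M * h) * DV c.
    by rewrite ler_wpM2r//; lra.
  have k2 : (1 - psi (P t)) * DV c <= (1 - psi (P t)) * (DV t + 2 * K * M * h).
    by rewrite ler_wpM2l//; lra.
  have k3 : L * M * h * DV c <= L * M * h * M.
    by rewrite ler_wpM2l ?DV_le// !mulr_ge0// ltW.
  have k4 : psi (P t) * (2 * K * M * h) >= 0.
    by rewrite !mulr_ge0// ltW.
  rewrite expr2; lra.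
have h7 : dot e (m a c - m b c) <= K * (enorm e * ((1 - psi (P t)) * DV t +
     (2 * K * M + L * M ^+ 2) * h) - dot e (v a t - v b t) + 2 * K * M * enorm e * h).
  apply: (le_trans al); rewrite ler_pM2l//.
  have : enorm e * ((1 - psi (P c)) * DV c) <= enorm e *
    ((1 - psi (P t)) * DV t + (2 * K * M + L * M ^+ 2) * h) by rewrite ler_wpM2l.
  lra.
move: e1; rewrite [t + h]addrC addrK => e1.
have -> : dot e (v a (h + t) - v b (h + t)) =
    dot e (v a t - v b t) + h * dot e (m a c - m b c) by lra.
have h8 := ler_wpM2l (ltW h0) h7.
have h9 : (1 - h * K) * dot e (v a t - v b t) <= (1 - h * K) * (enorm e * DV t).
  by rewrite ler_wpM2l// subr_ge0.
rewrite /C1; move: h8 h9; set D' := dot e (m a c - m b c); set D := dot e _; set ee := enorm e.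
move=> h8 h9.
apply: (le_trans (y := (1 - h * K) * (ee * DV t) + h * K * D + h * D')); first by lra.
rewrite [leRHS](_ : _ = (1 - h * K) * (ee * DV t) + h * K * D +
  h * (K * (ee * ((1 - psi (P t)) * DV t + (2 * K * M + L * M ^+ 2) * h) -
                 D + 2 * K * M * ee * h))); last by ring.
by rewrite lerD2l.
Qed.

(** In one step the loss h K psi(P) DV of the velocity diameter cancels the first-order gain of K
    Gam(P), leaving O(h^2). *)
Lemma flocking_lyapunov : 0 <= T -> DV T + K * Gam (P T) <= DV 0 + K * Gam (P 0).
Proof.
move=> T0.
have TT : 0 <= T <= T by rewrite T0 lexx.
have L0 := rate_lip_ge0 rate; have M0' := M0 TT.
apply: (@nonincr_of_step _ (fun t => DV t + K * Gam (P t))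
  (C1 + K * (2 * K * M)) T K^-1); rewrite ?invr_gt0//.
  by rewrite !(mulr_ge0, addr_ge0) ?(ltW K0)// sqr_ge0.
move=> t h t0 h0 hK thT.
have tt : 0 <= t <= T by rewrite t0 (le_trans _ thT)// lerDl.
have h1 := DV_step t0 h0 hK thT.
have h2 := P_step t0 h0 thT.
have /andP[p0 p1] := psi01 t.
have c0 : 0 <= h * DV t + 2 * K * M * h ^+ 2.
  by rewrite addr_ge0 ?mulr_ge0 ?DV_ge0// ?sqr_ge0 ?(ltW K0).
have h3 := Gam_ndecr (P_ge (t + h)) h2.
have h4 : Gam (P t + (h * DV t + 2 * K * M * h ^+ 2)) - Gam (P t) <=
    psi (P t) * (h * DV t + 2 * K * M * h ^+ 2).
  apply: (le_trans (Gam_concave (P_ge t) _)); first by rewrite lerDl.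
  by rewrite addrC addKr.
have h5 : psi (P t) * (2 * K * M * h ^+ 2) <= 2 * K * M * h ^+ 2.
  by rewrite ler_piMl// !mulr_ge0// ?sqr_ge0 ?(ltW K0).
have h6 : K * Gam (P (t + h)) <=
    K * (Gam (P t) + psi (P t) * (h * DV t) + 2 * K * M * h ^+ 2).
  by rewrite ler_pM2l//; lra.
lra.
Qed.

(** While P stays below [Dinf] each step contracts by 1 - lam h <= exp (- lam h), which the
    exponential weight compensates exactly; on the window this weight is at most exp (lam T), so the
    error stays quadratic. *)
Lemma flocking_decay : 0 <= T -> (forall t, 0 <= t <= T -> P t <= Dinf) ->
  DV T * expR (K * psi Dinf * T) <= DV 0.
Proof.
move=> T0 PD; set lam := K * psi Dinf.
have TT : 0 <= T <= T by rewrite T0 lexx.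
have L0 := rate_lip_ge0 rate; have M0' := M0 TT.
have lam0 : 0 < lam by rewrite mulr_gt0// (rate_gt0 rate)// (le_trans DX00).
have C10 : 0 <= C1.
  by rewrite !(mulr_ge0, addr_ge0) ?(ltW K0)// sqr_ge0.
have := @nonincr_of_step _ (fun t => DV t * expR (lam * t))
  (C1 * expR (lam * T)) T K^-1.
rewrite mulr0 expR0 mulr1; apply => //.
- by rewrite mulr_ge0 ?expR_ge0.
- by rewrite invr_gt0.
move=> t h t0 h0 hK thT.
have tt : 0 <= t <= T by rewrite t0 (le_trans _ thT)// lerDl.
have h1 := DV_step t0 h0 hK thT.
have h2 : psi Dinf <= psi (P t) by apply: (rate_nincr rate); rewrite ?PD.
have h3 : (1 - h * K * psi (P t)) * DV t <= (1 - lam * h) * DV t.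
  rewrite ler_wpM2r ?DV_ge0// lerB//.
    have : 0 <= h * K * (psi (P t) - psi Dinf).
      by rewrite !mulr_ge0 ?(ltW K0)// subr_ge0.
    by rewrite /lam; lra.
have h4 : 1 - lam * h <= expR (- (lam * h)) 
    by have := expR_ge1Dx (- (lam * h)).
have h5 : DV (t + h) <= expR (- (lam * h)) * DV t + C1 * h ^+ 2.
  apply: (le_trans h1); rewrite lerD2r (le_trans h3)// ler_wpM2r ?DV_ge0//.
have h6 : expR (lam * (t + h)) <= expR (lam * T) by rewrite ler_expR ler_pM2l.
apply: (le_trans (ler_wpM2r (expR_ge0 _) h5)); rewrite mulrDl lerD//.
  rewrite mulrDr expRD expRN le_eqVlt; apply/orP; left; apply/eqP.
  by field; rewrite gt_eqF// expR_gt0.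
by rewrite mulrAC ler_wpM2r ?sqr_ge0// ler_wpM2l.
Qed.

End window.

Lemma flocking (t : R) : 0 <= t -> forall a b,
  enorm (x a t - x b t) <= Dinf /\
  enorm (v a t - v b t) <= DV0 * expR (- (K * psi Dinf) * t).
Proof.
have PD (s : R) : 0 <= s -> P s <= Dinf.
  move=> s0; have [M MP] := loc_bound s.
  have h := flocking_lyapunov MP s0.
  have s00 : 0 <= (0 : R) <= s by rewrite lexx.
  have ss : 0 <= s <= s by rewrite s0 lexx.
  have MV s' : 0 <= s' <= s -> forall a b, enorm (v a s' - v b s') <= M.
    by move=> hs a b; have [] := MP s' a b hs.
  have P00 : P 0 = DX0.
    apply/eqP; rewrite eq_le le_max lexx andbT ge_max lexx/=.
    exact: (family_diam_le i0).
  have V00 : DV 0 <= DV0 by exact: (family_diam_le i0).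
  have Vs : 0 <= DV s by exact: (family_diam_ge0 i0 (MV _ ss)).
  (* Beyond [Dinf], monotonicity of [Gam] would make K Gam(P s) exceed DV0 + K Gam(DX0), which
     bounds the functional at time 0. *)
  rewrite leNgt; apply/negP => Dlt.
  have := Gam_ndecr Dinf_ge (ltW Dlt); rewrite -(ler_pM2l K0).
  by move: h; rewrite P00; move: DinfP; lra.
move=> t0 a b; have [M MP] := loc_bound t.
have tt : 0 <= t <= t by rewrite t0 lexx.
have V00 : DV 0 <= DV0 by exact: (family_diam_le i0).
split.
  rewrite (le_trans _ (PD t t0))// le_max (family_diam_ub (M := M)) ?orbT// => a' b'.
  by have [] := MP t a' b' tt.
rewrite (le_trans (y := DV t))//.
  by apply: (family_diam_ub (M := M)) => a' b'; have [] := MP t a' b' tt.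
rewrite mulNr expRN ler_pdivlMr ?expR_gt0//.
apply: le_trans V00; apply: (flocking_decay MP t0) => s /andP[s0 _].
exact: PD.
Qed.

End flocking.

(** * Borel sets and supports *)

Section borel.
Context {R : realType} {d : nat}.

(** Open cubes with rational centres and radii 1 / (n + 1): a countable base, indexed by a countable
    type so that open sets are countable unions of cubes. *)
Definition rat_box (qn : {ffun 'I_d -> rat} * nat) : set 'rV[R]_d :=
  [set x | forall i, `|x ord0 i - ratr (qn.1 i)| < qn.2.+1%:R^-1].

Lemma rat_box_nbhs (U : set 'rV[R]_d) x : nbhs x U ->
  exists2 qn, rat_box qn x & rat_box qn `<=` U.
Proof.
move=> /nbhs_ballP[e /= e0 eU].
(* The triangle inequality through the centre uses the radius twice, hence 2 / (n + 1) < e. *)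
pose n := Num.truncn (2 / e).
have nS : 2 / e < n.+1%:R by exact: truncnS_gt.
have n0 : (0 : R) < n.+1%:R^-1 by rewrite invr_gt0.
have ne : n.+1%:R^-1 * 2 < e.
  by rewrite mulrC ltr_pdivrMr// mulrC -ltr_pdivrMr.
have /fin_all_exists[q qP] i : exists q : rat, `|x ord0 i - ratr q| < n.+1%:R^-1.
  have lu : x ord0 i - n.+1%:R^-1 < x ord0 i + n.+1%:R^-1.
    by rewrite ltrD2l (lt_trans _ n0)// oppr_lt0.
  have [q] := @rat_in_itvoo R _ _ lu.
  rewrite in_itv/= => /andP[h1 h2]; exists q.
  by rewrite distrC ltr_distl h1.
exists ([ffun i => q i], n); first by move=> i /=; rewrite ffunE.
move=> y hy; apply: eU; split => // i j; rewrite !ord1.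
have := hy j; rewrite /= ffunE => h.
rewrite -ball_normE /ball_/=.
apply: (le_lt_trans (ler_distD (ratr (q j)) _ _)); apply: lt_trans ne.
by rewrite mulr_natr mulr2n ltrD// distrC; exact: h.
Qed.

Lemma measurable_coord i : measurable_fun setT (fun x : 'rV[R]_d => x ord0 i).
Proof.
apply: (measurability _ (RGenOpens.measurableE R)).
move=> _ [_ [a [b ->] <-]]; rewrite setTI; apply: sub_sigma_algebra.
by apply: open_comp => [x _|]; [exact: coord_continuous|exact: interval_open].
Qed.

Lemma measurable_box_preimage (dO : measure_display) (Om : measurableType dO)
    (f : Om -> 'rV[R]_d) qn :
  (forall i, measurable_fun setT (fun w => f w ord0 i)) ->
  measurable (f @^-1` rat_box qn).
Proof.
move=> mf; rewrite (_ : _ @^-1` _ = \bigcap_(i in [set: 'I_d])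
    ((fun w => f w ord0 i) @^-1`
      `](ratr (qn.1 i) - qn.2.+1%:R^-1), (ratr (qn.1 i) + qn.2.+1%:R^-1)[)).
  apply: fin_bigcap_measurable => // i _; rewrite -[X in measurable X]setTI.
  by apply: mf => //; exact: measurable_itv.
apply/seteqP; split => x /=; rewrite /rat_box/=.
  move=> hx i _ /=; rewrite in_itv/=.
  by rewrite -ltr_distl; exact: hx.
move=> hx i; have := hx i I; rewrite /= in_itv/=.
by rewrite -ltr_distl.
Qed.

Lemma measurable_rat_box qn : measurable (rat_box qn).
Proof.
have mf i : measurable_fun setT (fun x : 'rV[R]_d => x ord0 i).
  exact: measurable_coord.
exact: (measurable_box_preimage qn mf).
Qed.

Definition rat_box2 (q : ({ffun 'I_d -> rat} * nat) * ({ffun 'I_d -> rat} * nat)) :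
  set (phase R d) := rat_box q.1 `*` rat_box q.2.

Lemma measurable_rat_box2 q : measurable (rat_box2 q).
Proof. by apply: measurableX; exact: measurable_rat_box. Qed.

Lemma rat_box2_nbhs (U : set (phase R d)) z : nbhs z U ->
  exists2 q, rat_box2 q z & rat_box2 q `<=` U.
Proof.
move=> [[A B] /= [/rat_box_nbhs[q qz qA] /rat_box_nbhs[q' q'z q'B]] ABU].
exists (q, q') => // w [w1 w2]; apply: ABU; split; [exact: qA|exact: q'B].
Qed.

Lemma open_bigcup_basis (T : topologicalType) (J : countType) (B : J -> set T)
    (U : set T) :
  (forall x V, nbhs x V -> exists2 j, B j x & B j `<=` V) -> open U ->
  U = \bigcup_(j in [set j | B j `<=` U]) B j.
Proof.
move=> hB oU; apply/seteqP; split => [x Ux|x [j /= jU jx]]; last exact: jU.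
have [j jx jU] := hB x U (open_nbhs_nbhs (conj oU Ux)).
by exists j.
Qed.

Lemma countable_bigcup_measurable (dO : measure_display) (Om : measurableType dO)
    (J : countType) (D : set J) (B : J -> set Om) :
  (forall j, D j -> measurable (B j)) -> measurable (\bigcup_(j in D) B j).
Proof.
move=> mB; rewrite bigcup_mkcond; apply: countable_bigcupT_measurable => // j.
by case: ifPn => // /set_mem; exact: mB.
Qed.

(** The phase space carries the product sigma-algebra, generated by rectangles; the countable base
    of product boxes places the open sets of the product topology in it. *)
Lemma open_measurable_phase (U : set (phase R d)) : open U -> measurable U.
Proof.
move=> oU; rewrite (open_bigcup_basis (fun x V => @rat_box2_nbhs V x) oU).
by apply: countable_bigcup_measurable => q _; exact: measurable_rat_box2.
Qed.

Lemma open_measurable_rV (U : set 'rV[R]_d) : open U -> measurable U.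
Proof. exact: sub_sigma_algebra. Qed.

Lemma measurable_fun_rV (dO : measure_display) (Om : measurableType dO)
    (f : Om -> 'rV[R]_d) :
  (forall i, measurable_fun setT (fun w => f w ord0 i)) -> measurable_fun setT f.
Proof.
move=> mf; apply: (measurability (@open 'rV[R]_d)) => //.
move=> _ [U oU <-]; rewrite setTI.
rewrite (open_bigcup_basis (fun x V => @rat_box_nbhs V x) oU) preimage_bigcup.
by apply: countable_bigcup_measurable => q _; exact: measurable_box_preimage.
Qed.

Lemma continuous_measurable_phase (f : phase R d -> R) :
  continuous f -> measurable_fun setT f.
Proof.
move=> /continuousP cf; apply: (measurability _ (RGenOpens.measurableE R)).
move=> _ [_ [a [b ->] <-]]; rewrite setTI; apply: open_measurable_phase.
exact/cf/interval_open.
Qed.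

Lemma continuous_measurable_rV (f : 'rV[R]_d -> R) :
  continuous f -> measurable_fun setT f.
Proof.
move=> /continuousP cf; apply: (measurability _ (RGenOpens.measurableE R)).
move=> _ [_ [a [b ->] <-]]; rewrite setTI; apply: open_measurable_rV.
exact/cf/interval_open.
Qed.

(** A point outside the support has a null open neighbourhood, hence lies in a null box; there are
    countably many boxes. *)
Lemma ae_msupport (mu : probability (phase R d) R) :
  {ae mu, forall z, msupport mu z}.
Proof.
pose F k := if @unpickle (({ffun 'I_d -> rat} * nat) * ({ffun 'I_d -> rat} * nat))%type k
  is Some q then if mu (rat_box2 q) == 0 then rat_box2 q else set0 else set0.
have nF : mu.-negligible (\bigcup_k F k).
  apply: negligible_bigcup => k; rewrite /F; case: unpickle => [q|].
    case: eqP => [q0|_]; last exact: negligible_set0.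
    by exists (rat_box2 q); split => //; exact: measurable_rat_box2.
  exact: negligible_set0.
apply: negligibleS nF => z /= /existsNP[U /not_implyP[oU /not_implyP[Uz /negP]]].
rewrite -leNgt => U0.
have [q qz qU] := rat_box2_nbhs (open_nbhs_nbhs (conj oU Uz)).
have q0 : mu (rat_box2 q) = 0.
  apply/eqP; rewrite eq_le measure_ge0 andbT (le_trans _ U0)//.
  apply: le_measure => //; rewrite inE; last exact: open_measurable_phase.
  exact: measurable_rat_box2.
by exists (pickle q) => //; rewrite /F pickleK q0 eqxx.
Qed.

End borel.

Lemma lip_continuous (R : realType) (V : normedModType R) (f : V -> R) (C : R) :
  (forall x y, `|f x - f y| <= C * `|x - y|) -> continuous f.
Proof.
move=> fC x; apply/cvgrPdist_lt => e e0.
have C0 : 0 < `|C| + 1 by rewrite ltr_wpDl.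
apply/nbhs_ballP; exists (e / (`|C| + 1)) => /=; first by rewrite divr_gt0.
move=> y; rewrite -ball_normE /ball_/= ltr_pdivlMr// => xy.
apply: le_lt_trans xy; apply: (le_trans (fC x y)).
by rewrite mulrC ler_wpM2l//; have := ler_norm C; lra.
Qed.

Section law_support.
Context {R : realType} {d : nat}.

Lemma has_law_ae (dO d2 : measure_display) (Om : measurableType dO)
    (T : measurableType d2) (P : probability Om R) (Z : Om -> T)
    (mu : probability T R) (Q : T -> Prop) :
  measurable_fun setT Z -> has_law P Z mu ->
  {ae mu, forall z, Q z} -> {ae P, forall w, Q (Z w)}.
Proof.
move=> mZ lZ [N [mN N0 QN]]; exists (Z @^-1` N); split.
- by rewrite -[X in measurable X]setTI; exact: mZ.
- by rewrite -N0 -lZ.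
- by move=> w /= nQ; apply: QN.
Qed.

Lemma ae_has_law (dO d2 : measure_display) (Om : measurableType dO)
    (T : measurableType d2) (P : probability Om R) (Z : Om -> T)
    (mu : probability T R) (A : set T) :
  measurable A -> measurable_fun setT Z -> has_law P Z mu ->
  {ae P, forall w, A (Z w)} -> {ae mu, forall z, A z}.
Proof.
move=> mA mZ lZ [N [mN N0 QN]]; exists (~` A); split => //.
- exact: measurableC.
- rewrite -lZ; last exact: measurableC.
  apply/eqP; rewrite /pushforward eq_le measure_ge0 andbT -N0.
  apply: le_measure; rewrite ?inE//.
  by rewrite -[X in measurable X]setTI; apply: mZ => //; exact: measurableC.
Qed.

Variable mu : probability (phase R d) R.

Lemma bounded_msupport : compact (msupport mu) ->
  exists M : R, forall z, msupport mu z -> enorm z.1 <= M /\ enorm z.2 <= M.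
Proof.
move=> /compact_bounded[M [_ MP]].
have h z : msupport mu z -> `|z| <= M + 1 by apply: MP; rewrite ltrDl.
exists (Num.sqrt d%:R * (M + 1)) => z /h hz.
by split; apply: (le_trans (enorm_le_mx _)); apply: ler_wpM2l => //;
  apply: le_trans hz; rewrite [leRHS]/Num.norm/= le_max lexx ?orbT.
Qed.

(** The projection of the compact support is compact, hence closed. A point outside it has the open
    complement as neighbourhood, and this complement is null for the marginal. *)
Lemma msupport_fst x : compact (msupport mu) ->
  msupport (pushforward mu fst) x -> exists2 z, msupport mu z & x = z.1.
Proof.
move=> cS sx; apply: contrapT => nx.
have cK : compact (fst @` msupport mu).
  by apply: continuous_compact => //; apply: continuous_subspaceT => z; exact: cvg_fst.
have oU : open (~` (fst @` msupport mu)).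
  by apply: closed_openC; apply: compact_closed cK; exact: norm_hausdorff.
have := sx _ oU; rewrite /pushforward => H.
have : (0 < mu (fst @^-1` (~` (fst @` msupport mu))))%E.
  by apply: H => -[z sz e]; apply: nx; exists z.
have [N [mN N0 SN]] := ae_msupport mu.
rewrite ltNge => /negP; apply; rewrite -N0; apply: le_measure; rewrite ?inE//.
  apply: open_measurable_phase; apply: open_comp => // z _; exact: cvg_fst.
by move=> z /= nz; apply: SN => sz; apply: nz; exists z.
Qed.

Lemma msupport_snd x : compact (msupport mu) ->
  msupport (pushforward mu snd) x -> exists2 z, msupport mu z & x = z.2.
Proof.
move=> cS sx; apply: contrapT => nx.
have cK : compact (snd @` msupport mu).
  by apply: continuous_compact => //; apply: continuous_subspaceT => z; exact: cvg_snd.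
have oU : open (~` (snd @` msupport mu)).
  by apply: closed_openC; apply: compact_closed cK; exact: norm_hausdorff.
have := sx _ oU; rewrite /pushforward => H.
have : (0 < mu (snd @^-1` (~` (snd @` msupport mu))))%E.
  by apply: H => -[z sz e]; apply: nx; exists z.
have [N [mN N0 SN]] := ae_msupport mu.
rewrite ltNge => /negP; apply; rewrite -N0; apply: le_measure; rewrite ?inE//.
  apply: open_measurable_phase; apply: open_comp => // z _; exact: cvg_snd.
by move=> z /= nz; apply: SN => sz; apply: nz; exists z.
Qed.

(** A supremum dominates its elements only for a bounded set; the bound comes from the compact
    support through [msupport_fst]. *)
Lemma diameterX_ub z z' : compact (msupport mu) -> msupport mu z -> msupport mu z' ->
  enorm (z.1 - z'.1) <= diameterX mu.
Proof.
move=> cS sz sz'; apply: ub_le_sup.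
  have [M MP] := bounded_msupport cS; exists (M + M) => _ [x [y [sx sy ->]]].
  have [u su ->] := msupport_fst cS sx; have [w sw ->] := msupport_fst cS sy.
  by apply: (le_trans (enormB _ _)); apply: lerD; [have [] := MP u su|have [] := MP w sw].
exists z.1, z'.1; split => // U oU Uz.
  apply: sz => //; apply: open_comp => // x _; exact: cvg_fst.
apply: sz' => //; apply: open_comp => // x _; exact: cvg_fst.
Qed.

Lemma diameterV_ub z z' : compact (msupport mu) -> msupport mu z -> msupport mu z' ->
  enorm (z.2 - z'.2) <= diameterV mu.
Proof.
move=> cS sz sz'; apply: ub_le_sup.
  have [M MP] := bounded_msupport cS; exists (M + M) => _ [x [y [sx sy ->]]].
  have [u su ->] := msupport_snd cS sx; have [w sw ->] := msupport_snd cS sy.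
  by apply: (le_trans (enormB _ _)); apply: lerD; [have [] := MP u su|have [] := MP w sw].
exists z.2, z'.2; split => // U oU Uz.
  apply: sz => //; apply: open_comp => // x _; exact: cvg_snd.
apply: sz' => //; apply: open_comp => // x _; exact: cvg_snd.
Qed.

End law_support.

(** * The primitive of the communication rate *)

Section potential.
Context {R : realType} (L : R) (psi : R -> R).
Hypothesis rate : communication_rate L psi.

(** Values of [psi] at negative reals are unconstrained; composing with the absolute value gives a
    function continuous on the whole line that agrees with [psi] on the half-line. *)
Lemma continuous_rate_norm : continuous (fun s : R => psi `|s|).
Proof.
apply: (@lip_continuous _ R^o _ L) => x y; apply: (le_trans (rate_lip rate _ _)) => //.
by rewrite ler_wpM2l ?(rate_lip_ge0 rate)// ler_dist_dist.
Qed.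

Lemma measurable_rate (D : set R) : measurable D -> D `<=` [set s | 0 <= s] ->
  measurable_fun D (fun s => (psi s)%:E).
Proof.
move=> mD D0; apply/measurable_EFinP.
apply: (eq_measurable_fun (fun s : R => psi `|s|)).
  by move=> s /set_mem/D0 /= s0; rewrite ger0_norm.
by apply: measurable_funTS; apply: continuous_measurable_fun; exact: continuous_rate_norm.
Qed.

Variable D : R.
Hypothesis D0 : 0 <= D.
Local Notation leb := lebesgue_measure.

(** For D >= 0 the integral is finite since [psi] is at most 1 there, so [fine] loses nothing. *)
Definition potential (r : R) : R := fine (\int[leb]_(s in `[D, r]) (psi s)%:E).

Let sub0 (a : itv_bound R) (r : R) (b : bool) : D <= r ->
  [set` Interval (BSide b r) a] `<=` [set s | 0 <= s].
Proof.
move=> Dr s /=; rewrite itv_boundlr => /andP[+ _].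
by case: b; rewrite bnd_simp => h; apply: (le_trans D0); apply: (le_trans Dr) => //; exact: ltW.
Qed.

Let mpsi (r : R) (b : bool) (a : itv_bound R) : D <= r ->
  measurable_fun [set` Interval (BSide b r) a] (EFin \o psi).
Proof. by move=> Dr; apply: measurable_rate; [exact: measurable_itv|exact: sub0]. Qed.

Let psi_ge0 (r : R) (b : bool) (a : itv_bound R) : D <= r ->
  forall s, [set` Interval (BSide b r) a] s -> (0 <= (psi s)%:E)%E.
Proof.
by move=> Dr s /(sub0 Dr)/= s0; rewrite lee_fin ltW// (rate_gt0 rate).
Qed.

Let int_le (r s : R) (b : bool) (c : R) : D <= r -> r <= s ->
  (forall u, r <= u -> psi u <= c) -> 0 <= c ->
  (\int[leb]_(u in [set` Interval (BSide b r) (BRight s)]) (EFin \o psi) u <=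
    (c * (s - r))%:E)%E.
Proof.
move=> Dr rs uc c0.
have mI : measurable [set` Interval (BSide b r) (BRight s)] by exact: measurable_itv.
apply: (@le_trans _ _ (\int[leb]_(u in [set` Interval (BSide b r) (BRight s)]) cst c%:E u)%E).
  apply: ge0_le_integral => //.
  - exact: psi_ge0.
  - exact: mpsi.
  - move=> u /=; rewrite itv_boundlr => /andP[+ _]; rewrite lee_fin => ru.
    by apply: uc; case: b ru {mI}; rewrite bnd_simp// => /ltW.
rewrite integral_cst//= EFinM lee_wpmul2l ?lee_fin//.
case: b {mI}; rewrite lebesgue_measure_itv/= -EFinB; case: ifPn => // _;
  by rewrite lee_fin subr_ge0.
Qed.

Let fin_int (r s : R) (b : bool) : D <= r ->
  (\int[leb]_(u in [set` Interval (BSide b r) (BRight s)]) (EFin \o psi) u)%E \is a fin_num.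
Proof.
move=> Dr; rewrite ge0_fin_numE; last first.
  by apply: integral_ge0 => u hu; exact: (psi_ge0 Dr hu).
have [rs|sr] := leP r s.
  apply: (le_lt_trans (@int_le r s b 1 Dr rs _ ler01)); last exact: ltry.
  by move=> u ru; apply: (rate_le1 rate); apply: (le_trans D0); exact: le_trans ru.
rewrite set_itv_ge ?integral_set0 ?ltry//.
by case: b; rewrite bnd_simp -?ltNge -?leNgt//; exact: ltW.
Qed.

Let potentialE r : (potential r)%:E = (\int[leb]_(s in `[D, r]) (EFin \o psi) s)%E.
Proof. by rewrite fineK//; exact: fin_int. Qed.

Let potentialD a b : D <= a -> a <= b ->
  ((potential b)%:E = (potential a)%:E + \int[leb]_(s in `]a, b]) (EFin \o psi) s)%E.
Proof.
move=> Da ab; rewrite !potentialE.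
have e : `[D, b]%classic = `[D, a] `|` `]a, b].
  by rewrite -itv_bndbnd_setU// bnd_simp.
rewrite e ge0_integral_setU//.
- by rewrite -e; exact: mpsi.
- by rewrite -e; exact: psi_ge0.
- apply/disj_setPS => s [] /=; rewrite !in_itv/= => /andP[_ sa] /andP[as_ _].
  by move: (le_lt_trans sa as_); rewrite ltxx.
Qed.

Lemma potential_ndecr a b : D <= a -> a <= b -> potential a <= potential b.
Proof.
move=> Da ab; rewrite -lee_fin (potentialD Da ab) leeDl//.
by apply: integral_ge0 => s hs; exact: (psi_ge0 Da hs).
Qed.

Lemma potential_concave a b : D <= a -> a <= b ->
  potential b - potential a <= psi a * (b - a).
Proof.
move=> Da ab; rewrite lerBlDl -lee_fin (potentialD Da ab) EFinD leeD2l//.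
apply: int_le => //.
  by move=> u au; apply: (rate_nincr rate) => //; exact: le_trans Da.
by rewrite ltW// (rate_gt0 rate)//; exact: le_trans Da.
Qed.

Lemma potential_self : potential D = 0.
Proof.
apply/EFin_inj; rewrite potentialE set_itv1 integral_set1//.
Qed.

(** If no radius worked, all partial integrals would be at most DV / K, and by monotone convergence
    so would the full one. It would then be finite, and the quotient in the condition on K would be
    at least K. *)
Lemma potential_reach (K DV : R) : 0 < K -> 0 <= DV ->
  (DV%:E / \int[leb]_(s in `[D, +oo[) (psi s)%:E < K%:E)%E ->
  exists2 r, D <= r & DV < K * (potential r - potential D).
Proof.
move=> K0 DV0 hK; rewrite potential_self; apply: contrapT => /forall2NP nr.
have le r : D <= r -> ((potential r)%:E <= (DV / K)%:E)%E.
  move=> Dr; have [//|/negP] := nr r; rewrite -leNgt subr0 lee_fin => h.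
  by rewrite ler_pdivlMr// mulrC.
set I := (\int[leb]_(s in `[D, +oo[) (psi s)%:E)%E in hK.
have IE : `[D, +oo[%classic = \bigcup_n `[D, D + n%:R]%classic.
  apply/seteqP; split => [s|s [n _]] /=; rewrite !in_itv/=; last by case/andP => ->.
  rewrite andbT => Ds; exists (Num.truncn (s - D)).+1 => //=.
  by rewrite in_itv/= Ds/= -lerBlDl ltW// truncnS_gt.
have cv : (\int[leb]_(s in `[D, (D + n%:R)%R]) (EFin \o psi) s @[n --> \oo] --> I)%E.
  rewrite /I IE; apply: ge0_nondecreasing_set_cvg_integral => //.
  - move=> m n mn; apply/subsetPset => s /=; rewrite !in_itv/= => /andP[->/= h].
    by apply: (le_trans h); rewrite lerD2l ler_nat.
  - by move=> n; exact: mpsi.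
  - by move=> n s hs; exact: (psi_ge0 (lexx D) hs).
have Ile : (I <= (DV / K)%:E)%E.
  rewrite -(cvg_lim _ cv)//; apply: lime_le; first by apply/cvg_ex; exists I.
  by apply: nearW => n; rewrite -potentialE; apply: le; rewrite lerDl.
have dd : D + 1 - D = 1 by ring.
have D1 : D <= D + 1 by rewrite lerDl.
(* Positivity is needed to divide by the integral; on [D, D + 1] the rate is at least psi(D + 1). *)
have I0 : (0 < I)%E.
  apply: (@lt_le_trans _ _ (\int[leb]_(s in `[D, (D + 1)%R]) cst (psi (D + 1)%R)%:E s)%E).
    rewrite integral_cst ?measurable_itv//= lebesgue_measure_itv/= lte_fin ltrDl ltr01 -EFinB dd mule1.
    by rewrite lte_fin (rate_gt0 rate)// addr_ge0.
  apply: (@le_trans _ _ (\int[leb]_(s in `[D, (D + 1)%R]) (EFin \o psi) s)%E).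
    apply: ge0_le_integral => //.
    - by move=> s _; rewrite lee_fin ltW// (rate_gt0 rate)// addr_ge0.
    - exact: mpsi.
    - move=> s /=; rewrite in_itv/= => /andP[Ds sD]; rewrite lee_fin.
      by apply: (rate_nincr rate) => //; exact: le_trans Ds.
  rewrite /I; apply: ge0_subset_integral => //.
  - exact: mpsi.
  - by move=> s hs; exact: (psi_ge0 (lexx D) hs).
  - by move=> s /=; rewrite !in_itv/= => /andP[->].
(* The two infinite values contradict the bounds just proved, so the integral is a real number. *)
move: hK Ile I0; case: I cv => [i| |] cv //; rewrite lte_fin => hK Ile i0.
move: hK; rewrite inver gt_eqF// -EFinM lte_fin ltr_pdivrMr// => hK.
by move: Ile; rewrite lee_fin ler_pdivlMr// mulrC leNgt hK.
Qed.

End potential.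

(** * Real-valued integrals over a probability space *)

Section Rintegral_extra.
Context {R : realType} {dT : measure_display} {T : measurableType dT}.
Variable mu : probability T R.

Lemma rintegrableD (f g : T -> R) : mu.-integrable setT (EFin \o f) ->
  mu.-integrable setT (EFin \o g) ->
  mu.-integrable setT (EFin \o (fun x => f x + g x)).
Proof.
move=> fi gi; rewrite (_ : EFin \o _ = (EFin \o f) \+ (EFin \o g)) //.
exact: integrableD.
Qed.

Lemma rintegrableZ (a : R) (f : T -> R) : mu.-integrable setT (EFin \o f) ->
  mu.-integrable setT (EFin \o (fun x => a * f x)).
Proof.
move=> fi; rewrite (_ : EFin \o _ = fun x => (a%:E * (EFin \o f) x)%E) //.
exact: integrableZl.
Qed.

Lemma rintegrableB (f g : T -> R) : mu.-integrable setT (EFin \o f) ->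
  mu.-integrable setT (EFin \o g) ->
  mu.-integrable setT (EFin \o (fun x => f x - g x)).
Proof.
move=> fi gi; rewrite (_ : (fun x => _) = fun x => f x + -1 * g x).
  by apply: rintegrableD => //; exact: rintegrableZ.
by apply/funext => x; rewrite mulN1r.
Qed.

Lemma rintegrable_sum (I : Type) (s : seq I) (f : I -> T -> R) :
  (forall i, mu.-integrable setT (EFin \o f i)) ->
  mu.-integrable setT (EFin \o (fun x => \sum_(i <- s) f i x)).
Proof.
move=> fi; elim: s => [|i s ih].
  rewrite (_ : EFin \o _ = EFin \o cst 0); first exact: finite_measure_integrable_cst.
  by apply/funext => x; rewrite /= big_nil.
rewrite (_ : EFin \o _ = EFin \o (fun x => f i x + \sum_(i <- s) f i x)).
  exact: rintegrableD.
by apply/funext => x; rewrite /= big_cons.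
Qed.

Lemma ae_exists (Q : T -> Prop) : {ae mu, forall x, Q x} -> exists x, Q x.
Proof.
move=> [N [mN N0 hN]]; apply: contrapT => /forallNP h.
have /eqP := @probability_setT _ _ _ mu.
rewrite (_ : setT = N); first by rewrite N0 eq_sym onee_eq0.
by apply/seteqP; split => // w _; apply: hN; exact: h.
Qed.

(** The comparison f <= (f - c)^+ + c holds at every point, and the positive part vanishes almost
    everywhere. *)
Lemma Rintegral_le_ae (f : T -> R) (c : R) : mu.-integrable setT (EFin \o f) ->
  {ae mu, forall x, f x <= c} -> \int[mu]_x f x <= c.
Proof.
move=> fi fc.
have ci : mu.-integrable setT (EFin \o cst c) by exact: finite_measure_integrable_cst.
have mf : measurable_fun setT f by move/integrableP : fi => [/measurable_EFinP].
have gi : mu.-integrable setT (EFin \o (fun x => f x - c)).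
  exact: (rintegrableB fi ci).
have pi := integrable_funrpos measurableT gi.
have p0 : \int[mu]_x ((fun x => f x - c)^\+%R x) = 0.
  rewrite /Rintegral (ae_eq_integral (cst 0%E)) ?integral0//.
    by move/integrableP : pi => [].
  apply: filterS fc => x fxc _ /=; congr EFin.
  by rewrite /funrpos; apply/max_idPr; rewrite subr_le0.
have h : \int[mu]_x f x <= \int[mu]_x ((fun x => f x - c)^\+%R x + cst c x).
  apply: le_Rintegral => //.
    exact: (rintegrableD pi ci).
  by move=> x _; rewrite -lerBlDr /funrpos le_max lexx.
apply: (le_trans h); rewrite RintegralD// p0 add0r Rintegral_cst//.
by rewrite [X in fine X](@probability_setT _ _ _ mu) mulr1.
Qed.

Lemma Rintegral_sum (I : Type) (s : seq I) (f : I -> T -> R) :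
  (forall i, mu.-integrable setT (EFin \o f i)) ->
  \int[mu]_x (\sum_(i <- s) f i x) = \sum_(i <- s) \int[mu]_x f i x.
Proof.
move=> fi; elim: s => [|i s ih].
  rewrite big_nil (_ : (fun x => _) = cst 0) ?Rintegral_cst ?mul0r//.
  by apply/funext => x; rewrite big_nil.
rewrite big_cons -ih -RintegralD//; last exact: rintegrable_sum.
by apply: eq_Rintegral => x _; rewrite big_cons.
Qed.

End Rintegral_extra.

Lemma diameterX_ge0 (R : realType) (d : nat) (mu : probability (phase R d) R) :
  compact (msupport mu) -> 0 <= diameterX mu.
Proof.
move=> cS; have [z sz] := ae_exists (ae_msupport mu).
exact: le_trans (enorm_ge0 _) (diameterX_ub cS sz sz).
Qed.

Lemma diameterV_ge0 (R : realType) (d : nat) (mu : probability (phase R d) R) :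
  compact (msupport mu) -> 0 <= diameterV mu.
Proof.
move=> cS; have [z sz] := ae_exists (ae_msupport mu).
exact: le_trans (enorm_ge0 _) (diameterV_ub cS sz sz).
Qed.

(** * The mean-field flow *)

Section interaction_kernel.
Context {R : realType} (L : R) (psi : R -> R) {d : nat}.
Hypothesis rate : communication_rate L psi.

Lemma measurable_rate_enorm :
  measurable_fun setT (fun x : 'rV[R]_d => psi (enorm x)).
Proof.
apply: continuous_measurable_rV; apply: (@lip_continuous _ _ _ (L * Num.sqrt d%:R)).
move=> x y; apply: (le_trans (rate_lip rate (enorm_ge0 x) (enorm_ge0 y))).
rewrite -mulrA ler_wpM2l ?(rate_lip_ge0 rate)//.
by rewrite (le_trans (enorm_dist x y))// enorm_le_mx.
Qed.

Lemma measurable_enorm : measurable_fun setT (@enorm R d).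
Proof.
apply: continuous_measurable_rV; apply: (@lip_continuous _ _ _ (Num.sqrt d%:R)).
by move=> x y; rewrite (le_trans (enorm_dist x y))// enorm_le_mx.
Qed.

Lemma measurable_interaction i :
  measurable_fun setT (fun u : phase R d => interaction psi u ord0 i).
Proof.
rewrite (_ : (fun u => _) = fun u : phase R d => psi (enorm u.1) * u.2 ord0 i).
  apply: measurable_funM.
    by apply: (measurableT_comp measurable_rate_enorm); exact: measurable_fst.
  by apply: (measurableT_comp (measurable_coord i)); exact: measurable_snd.
by apply/funext => u; rewrite /interaction mxE.
Qed.

Section measurable_vector.
Context {dO : measure_display} {Om : measurableType dO}.
Implicit Types f g : Om -> 'rV[R]_d.

Lemma measurable_coordT f i : measurable_fun setT f ->
  measurable_fun setT (fun w => f w ord0 i).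
Proof. by move=> mf; apply: (measurableT_comp (measurable_coord i)). Qed.

Lemma measurable_rVD f g : measurable_fun setT f -> measurable_fun setT g ->
  measurable_fun setT (fun w => f w + g w).
Proof.
move=> mf mg; apply: measurable_fun_rV => i.
rewrite (_ : (fun w => _) = fun w => f w ord0 i + g w ord0 i).
  by apply: measurable_funD; exact: measurable_coordT.
by apply/funext => w; rewrite mxE.
Qed.

Lemma measurable_rVZ (a : R) f : measurable_fun setT f ->
  measurable_fun setT (fun w => a *: f w).
Proof.
move=> mf; apply: measurable_fun_rV => i.
rewrite (_ : (fun w => _) = fun w => a * f w ord0 i).
  by apply: measurable_funM => //; exact: measurable_coordT.
by apply/funext => w; rewrite mxE.
Qed.

Lemma measurable_rVB f g : measurable_fun setT f -> measurable_fun setT g ->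
  measurable_fun setT (fun w => f w - g w).
Proof.
move=> mf mg; apply: measurable_rVD => //.
rewrite (_ : (fun w => _) = fun w => -1 *: g w); first exact: measurable_rVZ.
by apply/funext => w; rewrite scaleN1r.
Qed.

Lemma measurable_rV_sum (I : Type) (s : seq I) (f : I -> Om -> 'rV[R]_d) :
  (forall i, measurable_fun setT (f i)) ->
  measurable_fun setT (fun w => \sum_(i <- s) f i w).
Proof.
move=> mf; elim: s => [|i s ih].
  by rewrite (_ : (fun w => _) = cst 0)//; apply/funext => w; rewrite big_nil.
rewrite (_ : (fun w => _) = fun w => f i w + \sum_(i <- s) f i w).
  exact: measurable_rVD.
by apply/funext => w; rewrite big_cons.
Qed.

Lemma measurable_enormT f : measurable_fun setT f ->
  measurable_fun setT (fun w => enorm (f w)).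
Proof. by move=> mf; exact: (measurableT_comp measurable_enorm). Qed.

End measurable_vector.

Lemma measurable_phaseB {dO : measure_display} {Om : measurableType dO}
    (f g : Om -> phase R d) : measurable_fun setT f -> measurable_fun setT g ->
  measurable_fun setT (fun w => f w - g w).
Proof.
move=> mf mg; rewrite (_ : (fun w => _) =
  (fun w => ((f w).1 - (g w).1, (f w).2 - (g w).2))) //.
apply: measurable_fun_pair; apply: measurable_rVB.
- exact: (measurableT_comp measurable_fst).
- exact: (measurableT_comp measurable_fst).
- exact: (measurableT_comp measurable_snd).
- exact: (measurableT_comp measurable_snd).
Qed.

Variable mu : probability (phase R d) R.
Hypothesis mu1 : mu.-integrable setT (fun w : phase R d => (enorm w.2)%:E).

Lemma interaction_coord_le (u : phase R d) i : `|interaction psi u ord0 i| <= enorm u.2.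
Proof.
rewrite mxE normrM ger0_norm ?(ltW (rate_gt0 rate (enorm_ge0 _)))//.
rewrite (le_trans _ (normr_coord_le u.2 i))// ler_piMl//.
by rewrite (rate_le1 rate) ?enorm_ge0.
Qed.

Lemma integrable_interaction z i :
  mu.-integrable setT (EFin \o (fun w => interaction psi (z - w) ord0 i)).
Proof.
have zi : mu.-integrable setT (EFin \o cst (enorm z.2)).
  exact: finite_measure_integrable_cst.
apply: (le_integrable measurableT _ _ (integrableD measurableT zi mu1)).
  apply/measurable_EFinP.
  apply: (measurableT_comp (measurable_interaction i)).
  by apply: measurable_phaseB => //; exact: measurable_id.
move=> w _ /=; rewrite lee_fin (le_trans (interaction_coord_le _ _))//=.
by rewrite (le_trans (enormB _ _))// ler_norm.
Qed.

Lemma integrable_dot_interaction z e :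
  mu.-integrable setT (EFin \o (fun w => dot e (interaction psi (z - w)))).
Proof.
by apply: rintegrable_sum => i; apply: rintegrableZ; exact: integrable_interaction.
Qed.

Lemma dot_interaction_conv z e : dot e (interaction_conv psi mu z) =
  \int[mu]_w dot e (interaction psi (z - w)).
Proof.
rewrite /dot Rintegral_sum; last first.
  by move=> i; apply: rintegrableZ; exact: integrable_interaction.
apply: eq_bigr => i _; rewrite mxE RintegralZl//.
exact: integrable_interaction.
Qed.

Lemma dot_interaction (z w : phase R d) e : dot e (interaction psi (z - w)) =
  psi (enorm (z.1 - w.1)) * dot e (z.2 - w.2).
Proof. by rewrite dotZr. Qed.

(** Testing against e turns the vector-valued convolution into a scalar integral, for which an
    almost sure bound of the integrand suffices. *)
Lemma interaction_conv_diff_le z z' e c :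
  {ae mu, forall w, - (psi (enorm (z.1 - w.1)) * dot e (z.2 - w.2) -
    psi (enorm (z'.1 - w.1)) * dot e (z'.2 - w.2)) <= c} ->
  - dot e (interaction_conv psi mu z - interaction_conv psi mu z') <= c.
Proof.
move=> h; rewrite dotBr !dot_interaction_conv -RintegralB//;
  [|exact: integrable_dot_interaction..].
have di z0 := integrable_dot_interaction z0 e.
rewrite -mulN1r -RintegralZl//; last exact: rintegrableB.
apply: Rintegral_le_ae; first by apply: rintegrableZ; exact: rintegrableB.
by apply: filterS h => w; rewrite mulN1r !dot_interaction.
Qed.

(** For each w its velocity is the common point r of [alignment_barycentric], and the inequality is
    integrated against [mu]. For the particles [cs_align] does the same with the average over k. *)
Lemma interaction_conv_align z z' e (K DX DV : R) : 0 < K -> 0 <= DV ->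
  enorm (z.2 - z'.2) <= DV ->
  {ae mu, forall w, [/\ enorm (z.1 - w.1) <= DX, enorm (z'.1 - w.1) <= DX,
    enorm (z.2 - w.2) <= DV & enorm (z'.2 - w.2) <= DV]} ->
  dot e (- K *: interaction_conv psi mu z - - K *: interaction_conv psi mu z') <=
    K * (enorm e * ((1 - psi DX) * DV) - dot e (z.2 - z'.2)).
Proof.
move=> K0 DV0 zz' h; rewrite -scalerBr dotZr mulNr -mulrN ler_pM2l//.
apply: interaction_conv_diff_le; apply: filterS h => w [h1 h2 h3 h4].
have le x D : enorm x <= D -> dot e x <= enorm e * D.
  by move=> xD; rewrite (le_trans (dot_le _ _))// ler_wpM2l ?enorm_ge0.
have p1 := le _ _ zz'; have p2 := le _ _ h3.
have p3 : dot e (w.2 - z'.2) <= enorm e * DV by apply: le; rewrite enormC.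
have := @alignment_barycentric R (psi (enorm (z.1 - w.1))) (psi (enorm (z'.1 - w.1)))
  (psi DX) (enorm e * DV) (dot e z.2) (dot e z'.2) (dot e w.2).
rewrite -!dotBr (mulrCA (enorm e)); apply => //.
- by rewrite (rate_nincr rate) ?enorm_ge0//= (rate_le1 rate) ?enorm_ge0.
- by rewrite (rate_nincr rate) ?enorm_ge0//= (rate_le1 rate) ?enorm_ge0.
- by rewrite mulr_ge0 ?enorm_ge0.
Qed.

End interaction_kernel.

(** The McShane extension, the infimum over a of g a + C |z - p a|. A function known only on the
    image of p, whatever set this image is, becomes a continuous and hence measurable function on
    the whole space. *)
Lemma mcshane (R : realType) (V : normedModType R) (I : Type) (p : I -> V)
    (g : I -> R) (C : R) : 0 <= C ->
  (forall a b, `|g a - g b| <= C * `|p a - p b|) ->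
  exists2 G : V -> R, continuous G & forall a, G (p a) = g a.
Proof.
move=> C0 gC.
(* Over an empty index type the infimum below would not be meaningful. *)
have [[i0 _]|I0] := pselect (exists i : I, True); last first.
  exists (cst 0); first exact: cst_continuous.
  by move=> a; exfalso; apply: I0; exists a.
pose E z := [set r | exists a, r = g a + C * `|z - p a|].
pose G z := inf (E z).
have lbE z : has_lbound (E z).
  exists (g i0 - C * `|z - p i0|) => _ [a ->].
  have := gC i0 a; rewrite ler_norml => /andP[_ h1].
  have h2 : C * `|p i0 - p a| <= C * (`|z - p i0| + `|z - p a|).
    rewrite ler_wpM2l// (le_trans (ler_distD z _ _))// (distrC (p i0)) lerD//.
  lra.
have neE z : E z !=set0 by exists (g i0 + C * `|z - p i0|), i0.
have Gle z a : G z <= g a + C * `|z - p a|.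
  by apply: ge_inf => //; exists a.
have half z z' : G z <= G z' + C * `|z - z'|.
  rewrite -lerBlDr; apply: lb_le_inf => // _ [a ->].
  rewrite lerBlDr (le_trans (Gle z a))// -addrA lerD2l -mulrDr ler_wpM2l//.
  by rewrite [leRHS]addrC ler_distD.
exists G.
  apply: (@lip_continuous _ _ _ C) => x y; rewrite ler_norml; apply/andP; split.
    by have := half y x; rewrite distrC; lra.
  by have := half x y; lra.
move=> a; apply/eqP; rewrite eq_le; apply/andP; split.
  by have := Gle (p a) a; rewrite subrr normr0 mulr0 addr0.
apply: lb_le_inf => // _ [b ->].
by have := gC a b; rewrite ler_norml => /andP[_]; lra.
Qed.

Section has_derivative_algebra.
Context {R : realType} {d : nat}.
Implicit Types f g : R -> 'rV[R]_d.

Lemma has_derivative_ext f g df dg : has_derivative f df ->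
  f =1 g -> df =1 dg -> has_derivative g dg.
Proof. by move=> h /funext <- /funext <-. Qed.

Lemma has_derivativeD f g df dg : has_derivative f df -> has_derivative g dg ->
  has_derivative (fun t => f t + g t) (fun t => df t + dg t).
Proof.
move=> hf hg t t0.
have F : Filter (within [set s : R | 0 <= s] t^') by exact: within_filter.
have -> : (fun s => (s - t)^-1 *: (f s + g s - (f t + g t))) =
    (fun s => (s - t)^-1 *: (f s - f t)) \+ (fun s => (s - t)^-1 *: (g s - g t)).
  by apply/funext => s /=; rewrite -scalerDr opprD addrACA.
by apply: cvgD; [exact: hf|exact: hg].
Qed.

Lemma has_derivativeZ (a : R) f df : has_derivative f df ->
  has_derivative (fun t => a *: f t) (fun t => a *: df t).
Proof.
move=> hf t t0.
have F : Filter (within [set s : R | 0 <= s] t^') by exact: within_filter.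
have -> : (fun s => (s - t)^-1 *: (a *: f s - a *: f t)) =
    (fun s => a *: ((s - t)^-1 *: (f s - f t))).
  by apply/funext => s /=; rewrite -scalerBr !scalerA mulrC.
by apply: cvgZ; [exact: cvg_cst|exact: hf].
Qed.

Lemma has_derivativeB f g df dg : has_derivative f df -> has_derivative g dg ->
  has_derivative (fun t => f t - g t) (fun t => df t - dg t).
Proof.
move=> hf hg; have hg' := @has_derivativeZ (-1) _ _ hg.
by apply: has_derivative_ext (has_derivativeD hf hg') _ _ => t; rewrite scaleN1r.
Qed.

Lemma has_derivative_cst (x : 'rV[R]_d) : has_derivative (fun=> x) (fun=> 0).
Proof.
by move=> t t0; under eq_fun do rewrite subrr scaler0; exact: cvg_cst.
Qed.

Lemma has_derivative_sum (I : Type) (s : seq I) (f df : I -> R -> 'rV[R]_d) :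
  (forall i, has_derivative (f i) (df i)) ->
  has_derivative (fun t => \sum_(i <- s) f i t) (fun t => \sum_(i <- s) df i t).
Proof.
move=> h; elim: s => [|i s ih].
  by apply: has_derivative_ext (has_derivative_cst 0) _ _ => t; rewrite big_nil.
by apply: has_derivative_ext (has_derivativeD (@h i) ih) _ _ => t; rewrite big_cons.
Qed.

End has_derivative_algebra.

Section mean_field_solutions.
Context {R : realType} (L : R) (psi : R -> R) {d : nat}.
Hypothesis rate : communication_rate L psi.
Context (K : R) (rho0 : probability (phase R d) R)
  (rho : R -> probability (phase R d) R).
Hypothesis K0 : 0 < K.
Hypothesis compS : compact (msupport rho0).
Hypothesis moments : forall T : R, exists M : R, forall t, 0 <= t <= T ->
  (\int[rho t]_z (enorm z.2)%:E <= M%:E)%E.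
Context {dO : measure_display} {Om : measurableType dO} {P : probability Om R}
  {X V : R -> {RV P >-> 'rV[R]_d}}.
Hypothesis law0 : has_law P (fun w => (X 0 w, V 0 w)) rho0.
Hypothesis lawt : forall t, 0 <= t -> has_law P (fun w => (X t w, V t w)) (rho t).
Hypothesis ode : {ae P, forall w, mean_field_ode K psi rho (X ^~ w) (V ^~ w)}.

(* Working with all solutions started in the support, instead of almost all
   samples, makes every estimate below hold simultaneously at all times. *)
Definition mf_sol := {s : (R -> 'rV[R]_d) * (R -> 'rV[R]_d) |
  mean_field_ode K psi rho s.1 s.2 /\ msupport rho0 (s.1 0, s.2 0)}.
Implicit Types a b : mf_sol.

Let xs a := (sval a).1.
Let vs a := (sval a).2.

Let dx a : has_derivative (xs a) (vs a).
Proof. by have [[h _] _] := svalP a. Qed.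

Let dv a : has_derivative (vs a)
  (fun t => - K *: interaction_conv psi (rho t) (xs a t, vs a t)).
Proof. by have [[_ h] _] := svalP a. Qed.

Let mXV t : measurable_fun setT (fun w => (X t w, V t w)).
Proof. by apply: measurable_fun_pair; exact: measurable_funPT. Qed.

Lemma ae_mf_sol : {ae P, forall w, exists a, (sval a) = (X ^~ w, V ^~ w)}.
Proof.
have s0 := has_law_ae (mXV 0) law0 (ae_msupport rho0).
apply: filterS2 ode s0 => w o s.
by exists (exist _ (X ^~ w, V ^~ w) (conj o s)).
Qed.

Lemma mf_sol_inhabited : inhabited mf_sol.
Proof.
by have [w [a _]] := ae_exists ae_mf_sol.
Qed.

(** [rho t] is the law of a process almost all of whose paths are solutions started in the support,
    so a property common to all solutions holds almost everywhere for [rho t]. *)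
Lemma ae_rho_sol t (A : set (phase R d)) : 0 <= t -> measurable A ->
  (forall a, A (xs a t, vs a t)) -> {ae rho t, forall w, A w}.
Proof.
move=> t0 mA hA; apply: (ae_has_law mA (mXV t) (lawt t0)).
by apply: filterS ae_mf_sol => w [a ea]; have := hA a; rewrite /xs /vs ea.
Qed.

Lemma integrable_rho_velocity t : 0 <= t ->
  (rho t).-integrable setT (fun w : phase R d => (enorm w.2)%:E).
Proof.
move=> t0; have [M MP] := moments t; apply/integrableP; split.
  apply/measurable_EFinP; apply: measurable_enormT; exact: measurable_snd.
under eq_integral do rewrite gee0_abs ?lee_fin ?enorm_ge0//.
by apply: le_lt_trans (MP t _) (ltry _); rewrite t0 lexx.
Qed.

Let mclose (x0 v0 : 'rV[R]_d) (DX DV : R) :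
  measurable [set w : phase R d | enorm (x0 - w.1) <= DX /\ enorm (v0 - w.2) <= DV].
Proof.
have m1 : measurable_fun setT (fun w : phase R d => enorm (x0 - w.1)).
  apply: measurable_enormT; apply: measurable_rVB => //; exact: measurable_fst.
have m2 : measurable_fun setT (fun w : phase R d => enorm (v0 - w.2)).
  apply: measurable_enormT; apply: measurable_rVB => //; exact: measurable_snd.
rewrite (_ : [set w | _] = ((fun w : phase R d => enorm (x0 - w.1)) @^-1` `]-oo, DX]) `&`
   ((fun w : phase R d => enorm (v0 - w.2)) @^-1` `]-oo, DV])).
  apply: measurableI; rewrite -[X in measurable X]setTI.
    by apply: m1 => //; exact: measurable_itv.
  by apply: m2 => //; exact: measurable_itv.
by apply/seteqP; split => w /=; rewrite !in_itv.
Qed.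

Lemma ae_rho_close t a (DX DV : R) : 0 <= t ->
  (forall b, enorm (xs a t - xs b t) <= DX) ->
  (forall b, enorm (vs a t - vs b t) <= DV) ->
  {ae rho t, forall w, enorm (xs a t - w.1) <= DX /\ enorm (vs a t - w.2) <= DV}.
Proof.
move=> t0 hx hv.
apply: (ae_rho_sol t0 (mclose (xs a t) (vs a t) DX DV)) => b.
by split; [exact: hx|exact: hv].
Qed.

Lemma mf_align (t : R) a b (DX DV : R) : 0 < t ->
  (forall a b, enorm (xs a t - xs b t) <= DX) ->
  (forall a b, enorm (vs a t - vs b t) <= DV) ->
  forall e, dot e (- K *: interaction_conv psi (rho t) (xs a t, vs a t) -
                   - K *: interaction_conv psi (rho t) (xs b t, vs b t)) <=
    K * (enorm e * ((1 - psi DX) * DV) - dot e (vs a t - vs b t)).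
Proof.
move=> /ltW t0 hx hv e; apply: (interaction_conv_align rate) => //.
- exact: integrable_rho_velocity.
- by rewrite (le_trans _ (hv a a))// enorm_ge0.
- exact: hv.
- apply: filterS2 (ae_rho_close t0 (hx a) (hv a)) (ae_rho_close t0 (hx b) (hv b)).
  by move=> w [? ?] [? ?].
Qed.

(** In the integrand - psi |v|^2 is nonpositive and what remains is at most |v| |w|, so the first
    velocity moment of [rho t] controls the growth of the speed. *)
Let speed_bound (t M : R) a : 0 <= t ->
  (\int[rho t]_z (enorm z.2)%:E <= M%:E)%E ->
  dot (vs a t) (- K *: interaction_conv psi (rho t) (xs a t, vs a t)) <=
  K * (enorm (vs a t) * M).
Proof.
move=> t0 hM; rewrite dotZr mulNr -mulrN ler_pM2l//.
have i1 := integrable_rho_velocity t0.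
rewrite (dot_interaction_conv rate)// -mulN1r -RintegralZl//; last first.
  exact: (integrable_dot_interaction rate).
have hM' : \int[rho t]_z (enorm z.2) <= M.
  rewrite /Rintegral -lee_fin fineK//; exact: integrable_fin_num.
apply: (@le_trans _ _ (enorm (vs a t) * \int[rho t]_z (enorm z.2))); last first.
  by rewrite ler_wpM2l ?enorm_ge0.
rewrite -RintegralZl//; apply: le_Rintegral => //.
- by apply: rintegrableZ; exact: (integrable_dot_interaction rate).
- exact: rintegrableZ.
move=> w _; rewrite dot_interaction /= mulN1r -mulrN dotBr opprB.
have p0 := rate_gt0 rate (enorm_ge0 (xs a t - w.1)).
have p1 := rate_le1 rate (enorm_ge0 (xs a t - w.1)).
have h1 := dot_le (vs a t) w.2; have h2 := dotxx_ge0 (vs a t).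
have h3 : 0 <= enorm (vs a t) * enorm w.2 by rewrite mulr_ge0 ?enorm_ge0.
apply: (@le_trans _ _ (psi (enorm (xs a t - w.1)) * (enorm (vs a t) * enorm w.2))).
  by rewrite ler_pM2l//; lra.
by rewrite ler_piMl.
Qed.

Let le_1Dsqr (x : 'rV[R]_d) : enorm x <= 1 + dot x x.
Proof. by rewrite -enorm_sqr; have := sqr_ge0 (enorm x - 1); have := enorm_ge0 x; nra. Qed.

Let mf_speed_bound (T : R) : exists2 A : R, 0 <= A &
  forall t a, 0 <= t <= T -> 1 + dot (vs a t) (vs a t) <= A.
Proof.
have [B hB] := bounded_msupport compS.
have [M' hM'] := moments T; pose M := `|M'|.
have M0 : 0 <= M by exact: normr_ge0.
have hM t : 0 <= t <= T -> (\int[rho t]_z (enorm z.2)%:E <= M%:E)%E.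
  by move=> h; rewrite (le_trans (hM' t h))// lee_fin ler_norm.
have KM : 0 <= K * M by rewrite mulr_ge0 ?(ltW K0).
have B0 : 0 <= 1 + B ^+ 2 by rewrite addr_ge0// sqr_ge0.
exists ((1 + B ^+ 2) * expR (K * M * T)) => [|t a /andP[t0 tT]].
  by rewrite mulr_ge0 ?expR_ge0.
have h := sderivD (sderiv_cst 1) (sderiv_dot (@dv a)).
have g : 1 + dot (vs a t) (vs a t) <=
    (1 + dot (vs a 0) (vs a 0)) * expR (K * M * t).
  apply: (gronwall h _ t0) => s /andP[s0 st].
  have sT : 0 <= s <= T by rewrite (ltW s0) (le_trans (ltW st)).
  have := speed_bound a (ltW s0) (hM s sT).
  rewrite -enorm_sqr add0r => h1.
  have h2 : 0 <= K * M * (enorm (vs a s) - 1) ^+ 2 by rewrite mulr_ge0 ?sqr_ge0.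
  move: h1 h2; set y := dot _ _; set q := enorm _; lra.
have v0 : 1 + dot (vs a 0) (vs a 0) <= 1 + B ^+ 2.
  have [_ ma] := svalP a; have [_ hv] := hB _ ma.
  rewrite lerD2l -enorm_sqr ler_pXn2r ?nnegrE ?enorm_ge0//.
  exact: le_trans (enorm_ge0 _) hv.
apply: (le_trans g); apply: ler_pM => //.
- by rewrite addr_ge0// dotxx_ge0.
- by rewrite ler_expR ler_wpM2l.
Qed.

(** The diameter of an infinite family is finite only under bounds common to all its members.
    Gronwall is applied to 1 + |v|^2 and 1 + |x|^2, with constants that come from the support and
    from the moments alone. *)
Lemma mf_loc_bound (T : R) : exists M : R, forall t a b, 0 <= t <= T ->
  enorm (xs a t - xs b t) <= M /\ enorm (vs a t - vs b t) <= M.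
Proof.
have [B hB] := bounded_msupport compS.
have [A A0 hA] := mf_speed_bound T.
have B0 : 0 <= 1 + B ^+ 2 by rewrite addr_ge0// sqr_ge0.
pose C := (1 + B ^+ 2) * expR ((1 + A) * T).
have C0 : 0 <= C by rewrite mulr_ge0 ?expR_ge0.
have hx t a : 0 <= t <= T -> 1 + dot (xs a t) (xs a t) <= C.
  move=> /andP[t0 tT].
  have h := sderivD (sderiv_cst 1) (sderiv_dot (@dx a)).
  have g : 1 + dot (xs a t) (xs a t) <=
      (1 + dot (xs a 0) (xs a 0)) * expR ((1 + A) * t).
    apply: (gronwall h _ t0) => s /andP[s0 st].
    have sT : 0 <= s <= T by rewrite (ltW s0) (le_trans (ltW st)).
    have := hA s a sT; have := dot_le (xs a s) (vs a s).
    rewrite -!enorm_sqr add0r.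
    have := sqr_ge0 (enorm (xs a s) - enorm (vs a s)).
    have := mulr_ge0 A0 (sqr_ge0 (enorm (xs a s))).
    move: (dot _ _) (enorm (xs a s)) (enorm (vs a s)) => y q r; lra.
  have v0 : 1 + dot (xs a 0) (xs a 0) <= 1 + B ^+ 2.
    have [_ ma] := svalP a; have [hv _] := hB _ ma.
    rewrite lerD2l -enorm_sqr ler_pXn2r ?nnegrE ?enorm_ge0//.
    exact: le_trans (enorm_ge0 _) hv.
  apply: (le_trans g); apply: ler_pM => //.
  - by rewrite addr_ge0// dotxx_ge0.
    - by rewrite ler_expR ler_wpM2l// addr_ge0.
exists (C + C + (A + A)) => t a b tT.
have := enormB (xs a t) (xs b t); have := enormB (vs a t) (vs b t).
have := le_1Dsqr (xs a t); have := le_1Dsqr (xs b t).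
have := le_1Dsqr (vs a t); have := le_1Dsqr (vs b t).
have := hx t a tT; have := hx t b tT; have := hA t a tT; have := hA t b tT.
by move: A0 C0; move=> *; split; lra.
Qed.

Let DX := diameterX rho0.
Let DV := diameterV rho0.
Variable Dinf : R.
Hypothesis Dinf_ge : DX <= Dinf.
Hypothesis DinfP : DV < K * (potential psi DX Dinf - potential psi DX DX).

Let DX0 : 0 <= DX := diameterX_ge0 compS.
Let DV0 : 0 <= DV := diameterV_ge0 compS.

Lemma mf_flocking (t : R) a b : 0 <= t ->
  enorm (xs a t - xs b t) <= Dinf /\
  enorm (vs a t - vs b t) <= DV * expR (- (K * psi Dinf) * t).
Proof.
move=> t0; have [i0] := mf_sol_inhabited; have D0 := DX0.
apply: (@flocking R L psi rate d mf_sol i0 K xs vs _ K0 dx dv mf_align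
  mf_loc_bound DX DV Dinf (potential psi DX)) => //.
- move=> c e; have [_ mc] := svalP c; have [_ me] := svalP e.
  exact: (diameterX_ub compS mc me).
- move=> c e; have [_ mc] := svalP c; have [_ me] := svalP e.
  exact: (diameterV_ub compS mc me).
- exact: (potential_ndecr rate D0).
- exact: (potential_concave rate D0).
Qed.

Lemma mf_flocking_rho (t : R) a : 0 <= t ->
  {ae rho t, forall w, enorm (xs a t - w.1) <= Dinf /\
    enorm (vs a t - w.2) <= DV * expR (- (K * psi Dinf) * t)}.
Proof.
by move=> t0; apply: ae_rho_close => // b; have [] := mf_flocking a b t0.
Qed.

Let DV_decay (t : R) : 0 <= t -> DV * expR (- (K * psi Dinf) * t) <= DV.
Proof.
move=> t0; rewrite ler_piMr ?DV0// -expR0 ler_expR mulNr oppr_le0.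
rewrite !mulr_ge0 ?(ltW K0)// ltW// (rate_gt0 rate)//.
exact: le_trans DX0 Dinf_ge.
Qed.

(** With p, q the rates at the two positions, the integrands differ by (p - q) dot ev (va - w) + q
    |ev|^2. The second term is dissipative; the first is at most L |ex| |ev| DV, because flocking
    bounds |va - w| almost surely. *)
Lemma mf_dist_gronwall (t : R) a b : 0 <= t ->
  dot (xs a t - xs b t) (xs a t - xs b t) +
  dot (vs a t - vs b t) (vs a t - vs b t) <=
  (dot (xs a 0 - xs b 0) (xs a 0 - xs b 0) +
   dot (vs a 0 - vs b 0) (vs a 0 - vs b 0)) * expR ((1 + K * L * DV) * t).
Proof.
move=> t0.
have h := sderivD (sderiv_dot (has_derivativeB (@dx a) (@dx b)))
                  (sderiv_dot (has_derivativeB (@dv a) (@dv b))).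
apply: (gronwall h _ t0) => s /andP[/ltW s0 _].
have L0 := rate_lip_ge0 rate.
set ex := xs a s - xs b s; set ev := vs a s - vs b s.
have h1 : dot ev (- K *: interaction_conv psi (rho s) (xs a s, vs a s) -
    - K *: interaction_conv psi (rho s) (xs b s, vs b s)) <=
    K * (L * enorm ex * (enorm ev * DV)).
  rewrite -scalerBr dotZr mulNr -mulrN ler_pM2l//.
  apply: (interaction_conv_diff_le rate); first exact: integrable_rho_velocity.
  apply: filterS (mf_flocking_rho a s0) => w [_ hw] /=.
  have {}hw := le_trans hw (DV_decay s0).
  set p := psi (enorm (xs a s - w.1)); set q := psi (enorm (xs b s - w.1)).
  have q0 : 0 <= q by rewrite ltW// (rate_gt0 rate) ?enorm_ge0.
  have pq : `|p - q| <= L * enorm ex.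
    apply: (le_trans (rate_lip rate _ _)); rewrite ?enorm_ge0// ler_wpM2l//.
    apply: (le_trans (enorm_dist _ _)); rewrite opprB addrA subrK//.
  have eE : dot ev (vs b s - w.2) = dot ev (vs a s - w.2) - dot ev ev.
    by rewrite -dotBr; congr dot; rewrite /ev opprB [RHS]addrC addrA subrK.
  have k1 : `|(p - q) * dot ev (vs a s - w.2)| <= L * enorm ex * (enorm ev * DV).
    rewrite normrM ler_pM// (le_trans (normr_dot_le _ _))//.
    by rewrite ler_wpM2l ?enorm_ge0.
  have k2 : 0 <= q * dot ev ev by rewrite mulr_ge0// dotxx_ge0.
  rewrite eE; move: k1; rewrite ler_norml => /andP[k1 _].
  by move: k1 k2; lra.
have h2 := dot_le ex ev.
have h3 := sqr_ge0 (enorm ex - enorm ev).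
have h4 : 0 <= K * L * DV * (enorm ex - enorm ev) ^+ 2.
  by rewrite mulr_ge0 ?sqr_ge0// !mulr_ge0 ?(ltW K0) ?DV0.
rewrite -!enorm_sqr; move: h1 h2 h3 h4.
by move: (dot _ _) (dot _ _) (enorm _) (enorm _) => *; lra.
Qed.

(** By [mf_dist_gronwall] the state at time t is a Lipschitz function of the initial state, on the
    set of initial states of solutions; [mcshane] extends it coordinate by coordinate. *)
Lemma mf_flow_map (t : R) : 0 <= t -> exists2 F : phase R d -> phase R d,
  measurable_fun setT F & forall a, F (xs a 0, vs a 0) = (xs a t, vs a t).
Proof.
move=> t0; pose p a : phase R d := (xs a 0, vs a 0).
pose E := expR ((1 + K * L * DV) * t).
(* E is the Gronwall factor; positions and velocities each contribute d times the square of the sup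
   norm. *)
pose C := Num.sqrt (2 * d%:R * E).
have E0 : 0 <= E by exact: expR_ge0.
have C0 : 0 <= C by exact: sqrtr_ge0.
have bnd a b (y : R) :
    y ^+ 2 <= dot (xs a t - xs b t) (xs a t - xs b t) +
      dot (vs a t - vs b t) (vs a t - vs b t) ->
    `|y| <= C * `|p a - p b|.
  move=> hy; rewrite -(ler_pXn2r (ltn0Sn 1)) ?nnegrE ?mulr_ge0//.
  rewrite real_normK ?num_real// (le_trans hy)//.
  rewrite (le_trans (mf_dist_gronwall a b t0))// -/E.
  rewrite exprMn sqr_sqrtr ?mulr_ge0// -!enorm_sqr.
  have sq (x : 'rV[R]_d) : `|x| <= `|p a - p b| ->
      enorm x ^+ 2 <= d%:R * `|p a - p b| ^+ 2.
    move=> xp; apply: (@le_trans _ _ ((Num.sqrt d%:R * `|x|) ^+ 2)).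
      by rewrite ler_pXn2r ?nnegrE ?enorm_ge0 ?mulr_ge0 ?sqrtr_ge0// enorm_le_mx.
    rewrite exprMn sqr_sqrtr// ler_wpM2l// ler_pXn2r ?nnegrE//.
  have h1 := sq (xs a 0 - xs b 0).
  have h2 := sq (vs a 0 - vs b 0).
  have {}h1 : enorm (xs a 0 - xs b 0) ^+ 2 <= d%:R * `|p a - p b| ^+ 2.
    by apply: h1; rewrite [leRHS]/Num.norm/= le_max lexx.
  have {}h2 : enorm (vs a 0 - vs b 0) ^+ 2 <= d%:R * `|p a - p b| ^+ 2.
    by apply: h2; rewrite [leRHS]/Num.norm/= le_max lexx orbT.
  have := ler_wpM2r E0 (lerD h1 h2); move: (_ ^+ 2) (_ ^+ 2) (_ ^+ 2) => *; lra.
have sqc (x : 'rV[R]_d) i : x ord0 i ^+ 2 <= dot x x.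
  rewrite -enorm_sqr -[leLHS]real_normK ?num_real//.
  by rewrite ler_pXn2r ?nnegrE ?enorm_ge0// normr_coord_le.
have /choice[G hG] : forall i : 'I_d, exists G : phase R d -> R,
    continuous G /\ forall a, G (p a) = xs a t ord0 i.
  move=> i; have [|G cG hG] := @mcshane R _ _ p (fun a => xs a t ord0 i) C C0.
    move=> a b; apply: bnd.
    have := sqc (xs a t - xs b t) i; rewrite !mxE => h; rewrite (le_trans h)// lerDl.
    exact: dotxx_ge0.
  by exists G.
have /choice[H hH] : forall i : 'I_d, exists G : phase R d -> R,
    continuous G /\ forall a, G (p a) = vs a t ord0 i.
  move=> i; have [|G' cG hG'] := @mcshane R _ _ p (fun a => vs a t ord0 i) C C0.
    move=> a b; apply: bnd.
    have := sqc (vs a t - vs b t) i; rewrite !mxE => h; rewrite (le_trans h)// lerDr.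
    exact: dotxx_ge0.
  by exists G'.
exists (fun z => (\row_i G i z, \row_i H i z)).
  apply: measurable_fun_pair; apply: measurable_fun_rV => i.
    rewrite (_ : (fun w => _) = G i); last by apply/funext => w; rewrite mxE.
    by apply: continuous_measurable_phase; have [] := hG i.
  rewrite (_ : (fun w => _) = H i); last by apply/funext => w; rewrite mxE.
  by apply: continuous_measurable_phase; have [] := hH i.
move=> a; congr pair; apply/rowP => i; rewrite mxE.
  by have [_] := hG i; apply.
by have [_] := hH i; apply.
Qed.

End mean_field_solutions.

Section bounded_integrals.
Context {R : realType} {dT : measure_display} {T : measurableType dT}.
Variable mu : probability T R.

Lemma bounded_integrable (f : T -> R) (B : R) : measurable_fun setT f ->
  (forall x, `|f x| <= B) -> mu.-integrable setT (EFin \o f).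
Proof.
move=> mf fB; apply: measurable_bounded_integrable => //.
  by rewrite [ltLHS](@probability_setT _ _ _ mu) ltry.
exists B; split; first exact: num_real.
by move=> M BM x _ /=; rewrite (le_trans (fB x))// ltW.
Qed.

End bounded_integrals.

(** * Independence and tensor powers *)

Section tuple_boxes.
Context {dT : measure_display} {T : measurableType dT} (n : nat).

Definition tuple_box (A : 'I_n -> set T) : set (n.-tuple T) :=
  [set t | forall i, A i (tnth t i)].

Lemma measurable_tuple_box A : (forall i, measurable (A i)) ->
  measurable (tuple_box A).
Proof.
move=> mA; rewrite (_ : tuple_box A = \bigcap_(i in [set: 'I_n])
    ((@tnth n T ^~ i) @^-1` A i)).
  apply: fin_bigcap_measurable => // i _; rewrite -[X in measurable X]setTI.
  by apply: measurable_tnth => //; exact: mA.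
by apply/seteqP; split => [t h i _|t h i]; exact: h.
Qed.

End tuple_boxes.

(** Boxes are the intersection-stable generator on which [has_law_tuple] compares two measures. *)
Lemma measurable_tuple_boxE (dT : measure_display) (T : measurableType dT) (n : nat) :
  @measurable _ (n.-tuple T) =
  <<s [set tuple_box A | A in [set A : 'I_n -> set T | forall i, measurable (A i)]] >>.
Proof.
apply/seteqP; split.
  apply: smallest_sub; first exact: smallest_sigma_algebra.
  case: n => [|n]; first by rewrite big_ord0.
  rewrite -bigcup_mkord_ord; apply: bigcup_sub => i _ _ [B mB <-].
  apply: sub_sigma_algebra.
  (* A cylinder over one coordinate is a box whose other factors are the full space. *)
  exists (fun k => if k == inord i then B else setT); first by move=> k /=; case: ifP.
  apply/seteqP; split => t /=.
    by move=> h; split => //; have := h (inord i); rewrite eqxx.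
  by move=> [_ tB] k; case: eqP => [->|].
apply: smallest_sub; first exact: sigma_algebra_measurable.
by move=> _ [A mA <-]; exact: measurable_tuple_box.
Qed.

Section independence.
Context {R : realType} {dO dT : measure_display} {Om : measurableType dO}
  {T : measurableType dT}.
Variables (P : probability Om R) (mu : probability T R) (J : nat)
  (Z : 'I_J -> Om -> T).
Hypothesis mZ : forall j, measurable_fun setT (Z j).
Hypothesis indZ : mutually_independent P Z.
Hypothesis lawZ : forall j, has_law P (Z j) mu.

Let mpre j A : measurable A -> measurable (Z j @^-1` A).
Proof. by move=> mA; rewrite -[X in measurable X]setTI; exact: mZ. Qed.

Lemma independent_setT (A : 'I_J -> set T) : (forall j, measurable (A j)) ->
  P (\bigcap_j (Z j @^-1` A j)) = (\prod_j mu (A j))%E.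
Proof.
move=> mA; have := indZ [set: 'I_J]%SET mA.
rewrite (_ : [set` [set: 'I_J]%SET] = setT); last first.
  by apply/seteqP; split => // i _ /=; rewrite finset.in_setT.
move=> ->; rewrite (eq_bigl xpredT) => [|i]; last by rewrite finset.in_setT.
by apply: eq_bigr => j _; exact: lawZ.
Qed.

(** The indices j and l may coincide, so each coordinate is constrained by an intersection.
    Comparing the product formula for A with the one for the full space identifies the remaining
    factor without computing it. *)
Let rect (k j l : 'I_J) (A B C : set T) : measurable A -> measurable B ->
  measurable C -> k != j -> k != l ->
  P (Z k @^-1` A `&` (Z j @^-1` B `&` Z l @^-1` C)) =
  (mu A * P (Z j @^-1` B `&` Z l @^-1` C))%E.
Proof.
move=> mA mB mC kj kl.
pose D (A' : set T) i := (if i == k then A' else setT) `&`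
  ((if i == j then B else setT) `&` (if i == l then C else setT)).
have mD A' i : measurable A' -> measurable (D A' i).
  by move=> mA'; rewrite /D; apply: measurableI; [case: ifP|
     apply: measurableI; case: ifP].
have capD A' : \bigcap_i (Z i @^-1` D A' i) =
    Z k @^-1` A' `&` (Z j @^-1` B `&` Z l @^-1` C).
  apply/seteqP; split => w.
    move=> h; split; first by have [] := h k I; rewrite eqxx.
    split; first by have [_ []] := h j I; rewrite eqxx.
    by have [_ [_]] := h l I; rewrite eqxx.
  move=> [h1 [h2 h3]] i _; split; first by case: eqP => // ->.
  by split; case: eqP => // ->.
have Dk A' : D A' k = A'.
  by rewrite /D eqxx (negbTE kj) (negbTE kl) !setIT.
have e A' : measurable A' ->
    P (Z k @^-1` A' `&` (Z j @^-1` B `&` Z l @^-1` C)) =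
    (mu A' * \prod_(i | i != k) mu (D setT i))%E.
  move=> mA'; rewrite -capD independent_setT => [|i]; last exact: mD.
  rewrite (bigD1 k)//= Dk; congr (_ * _)%E.
  by apply: eq_bigr => i ik; rewrite /D (negbTE ik).
rewrite e//; have := e setT measurableT; rewrite preimage_setT setTI => ->.
by rewrite [X in (_ = _ * (X * _))%E](@probability_setT _ _ _ mu) mul1e.
Qed.

(** As functions of C both sides are finite measures, which agree on rectangles by [rect]. *)
Lemma independent_pair (k j l : 'I_J) (A : set T) (C : set (T * T)) :
  measurable A -> measurable C -> k != j -> k != l ->
  P (Z k @^-1` A `&` ((fun w => (Z j w, Z l w)) @^-1` C)) =
  (mu A * P ((fun w => (Z j w, Z l w)) @^-1` C))%E.
Proof.
move=> mA mC kj kl.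
have mW : measurable_fun setT (fun w => (Z j w, Z l w)).
  by apply: measurable_fun_pair.
pose W : {mfun Om >-> (T * T)%type} :=
  HB.pack (fun w => (Z j w, Z l w)) (isMeasurableFun.Build _ _ _ _ _ mW).
have mZA : measurable (Z k @^-1` A) by exact: mpre.
have r0 : 0 <= fine (mu A) by rewrite fine_ge0.
have muA : (fine (mu A))%:E = mu A by rewrite fineK// fin_num_measure.
pose m1' : {measure set (T * T) -> \bar R} := pushforward (mrestr P mZA) W.
pose m2' : {measure set (T * T) -> \bar R} :=
  pushforward (mscale (NngNum r0) P) W.
pose m1 := m1' mW; pose m2 := m2' mW.
have m1E B : m1 B = P (Z k @^-1` A `&` (W @^-1` B)).
  by rewrite -[LHS]/(mrestr P mZA (W @^-1` B)) /mrestr setIC.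
have m2E B : m2 B = (mu A * P (W @^-1` B))%E.
  by rewrite -[LHS]/((fine (mu A))%:E * P (W @^-1` B))%E muA.
rewrite -m1E -m2E; move: C mC.
pose G : set (set (T * T)) := [set B `*` C | B in measurable & C in measurable].
apply: (@measure_unique _ _ _ G (fun=> setT)).
- exact: measurable_prod_measurableType.
- move=> _ _ [B mB [C mC <-]] [B' mB' [C' mC' <-]].
  exists (B `&` B'); first exact: measurableI.
  exists (C `&` C'); first exact: measurableI.
  by rewrite setXI.
- by move=> _; exists setT => //; exists setT => //; rewrite setXTT.
- by rewrite bigcup_const.
- by move=> _ [B mB [C mC <-]]; rewrite m1E m2E; apply: rect.
- move=> _; rewrite m1E preimage_setT setIT.
  exact: le_lt_trans (probability_le1 P mZA) (ltry 1).
Qed.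

(** The variable with index k is independent of the pair with indices j and l, which may be equal.
    Integrating over it first gives 0, as the kernel is centred in its second argument. *)
Lemma expectation_centered_eq0 (f : T * T -> R) (B : R) (k j l : 'I_J) :
  measurable_fun setT f -> (forall z, `|f z| <= B) ->
  (forall z, \int[mu]_w f (z, w) = 0) -> k != j -> k != l ->
  \int[P]_w (f (Z j w, Z k w) * f (Z j w, Z l w)) = 0.
Proof.
move=> mf fB f0 kj kl.
have mW : measurable_fun setT (fun w => (Z j w, Z l w)).
  by apply: measurable_fun_pair.
pose W : {mfun Om >-> (T * T)%type} :=
  HB.pack (fun w => (Z j w, Z l w)) (isMeasurableFun.Build _ _ _ _ _ mW).
have mV : measurable_fun setT (fun w => (Z k w, (Z j w, Z l w))).
  exact: measurable_fun_pair.
pose V : {mfun Om >-> (T * (T * T))%type} :=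
  HB.pack (fun w => (Z k w, (Z j w, Z l w))) (isMeasurableFun.Build _ _ _ _ _ mV).
pose nu : probability (T * T)%type R := distribution P W.
pose h (p : T * (T * T)) : R := f (p.2.1, p.1) * f (p.2.1, p.2.2).
have mh : measurable_fun setT h.
  apply: measurable_funM; apply: (measurableT_comp mf).
    apply: measurable_fun_pair; last exact: measurable_fst.
    by apply: (measurableT_comp measurable_fst); exact: measurable_snd.
  apply: measurable_fun_pair.
    by apply: (measurableT_comp measurable_fst); exact: measurable_snd.
  by apply: (measurableT_comp measurable_snd); exact: measurable_snd.
have hB p : `|h p| <= B * B by rewrite normrM ler_pM.
have law : forall X, measurable X -> (mu \x nu)%E X = distribution P V X.
  move=> X mX; apply: product_measure_unique => // A C mA mC.
  by rewrite /distribution/= /pushforward/=; exact: independent_pair.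
have eI : (\int[P]_w (f (Z j w, Z k w) * f (Z j w, Z l w))%:E =
    \int[mu \x nu]_p (h p)%:E)%E.
  transitivity (\int[distribution P V]_p (h p)%:E)%E.
    rewrite integral_distribution//; first exact/measurable_EFinP.
    apply: (@bounded_integrable _ _ _ P (h \o V) (B * B)) => [|w]; last exact: hB.
    exact: measurableT_comp.
  by apply: eq_measure_integral => X mX _; first [exact: law|symmetry; exact: law].
rewrite /Rintegral eI.
have ih : (mu \x nu)%E.-integrable setT (EFin \o h).
  exact: bounded_integrable mh hB.
rewrite -(integral21_prod_meas1 ih) [X in fine X](_ : _ = 0)//.
apply: integral0_eq => p _; rewrite /fubini_G/=.
have fi : mu.-integrable setT (EFin \o (fun x => f (p.1, x))).
  apply: (@bounded_integrable _ _ _ mu _ B) => [|x]; last exact: fB.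
  by apply: (measurableT_comp mf); exact: measurable_pair1.
transitivity ((\int[mu]_x (f (p.1, x))%:E) * (f (p.1, p.2))%:E)%E.
  by under eq_integral do rewrite /h/= EFinM; rewrite integralZr.
have := f0 p.1; rewrite /Rintegral => e.
by rewrite -[X in (X * _)%E]fineK ?e ?mul0e//; exact: integrable_fin_num.
Qed.

(** Of two distinct indices k and l at least one differs from j; integrating that one first kills
    the product. The term k = j stays among the squares. *)
Lemma second_moment_sum (f : T * T -> R) (B : R) (j : 'I_J) :
  measurable_fun setT f -> (forall z, `|f z| <= B) ->
  (forall z, \int[mu]_w f (z, w) = 0) ->
  \int[P]_w ((\sum_k f (Z j w, Z k w)) ^+ 2) =
  \sum_k \int[P]_w (f (Z j w, Z k w) ^+ 2).
Proof.
move=> mf fB f0.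
pose g k l w := f (Z j w, Z k w) * f (Z j w, Z l w).
have gB k l w : `|g k l w| <= B * B by rewrite normrM ler_pM.
have gi k l : P.-integrable setT (EFin \o g k l).
  apply: (@bounded_integrable _ _ _ P _ (B * B)) => //.
  by apply: measurable_funM; apply: (measurableT_comp mf); exact: measurable_fun_pair.
have -> : (fun w => (\sum_k f (Z j w, Z k w)) ^+ 2) =
    (fun w => \sum_k \sum_l g k l w).
  apply/funext => w; rewrite expr2 big_distrl/=; apply: eq_bigr => k _.
  by rewrite big_distrr.
rewrite Rintegral_sum => [|k]; last exact: rintegrable_sum.
apply: eq_bigr => k _; rewrite Rintegral_sum//.
rewrite (bigD1 k)//= [X in _ + X]big1 ?addr0//.
move=> l lk; have [e|kj] := eqVneq k j; last first.
  by apply: (expectation_centered_eq0 mf fB f0) => //; rewrite eq_sym.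
rewrite (_ : (fun w => _) = fun w => f (Z j w, Z l w) * f (Z j w, Z k w)).
  by apply: (expectation_centered_eq0 mf fB f0) => //; rewrite -e.
by apply/funext => w; rewrite /g mulrC.
Qed.

Lemma tensor_power_box (n : nat) (A : 'I_n -> set T) :
  (forall i, measurable (A i)) ->
  tensor_power mu n (tuple_box A) = (\prod_i mu (A i))%E.
Proof.
elim: n A => [|n ih] A mA.
  rewrite big_ord0 /= (_ : tuple_box A = setT) ?diracT//.
  by apply/seteqP; split => // t _ [].
rewrite big_ord_recl -ih => [|i]; last exact: mA.
rewrite -product_measure1E//=; last by apply: measurable_tuple_box => i; exact: mA.
rewrite /distribution/= /pushforward/=; congr (_ _).
apply/seteqP; split => -[x t] /=.
  move=> h; split; first exact: (h ord0).
  by move=> i; have := h (lift ord0 i); rewrite /cons_pair tnthS.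
move=> [h0 h] i; case: (unliftP ord0 i) => [i' ->|->] //.
by rewrite /cons_pair tnthS; exact: h.
Qed.

Lemma has_law_tuple :
  has_law P (fun w => [tuple Z j w | j < J]) (tensor_power mu J).
Proof.
have mW : measurable_fun setT (fun w => [tuple Z j w | j < J]).
  apply/measurable_fun_tnthP => i.
  by rewrite (_ : _ \o _ = Z i)//; apply/funext => w /=; rewrite tnth_mktuple.
pose W : {mfun Om >-> (J.-tuple T)} :=
  HB.pack (fun w => [tuple Z j w | j < J]) (isMeasurableFun.Build _ _ _ _ _ mW).
pose m1 : {measure set (J.-tuple T) -> \bar R} := distribution P W.
apply: (@measure_unique _ _ _ _ (fun=> setT) (@measurable_tuple_boxE _ T J)
  _ _ _ m1).
- move=> _ _ [A mA <-] [B mB <-]; exists (fun i => A i `&` B i).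
    by move=> i; apply: measurableI.
  by apply/seteqP; split => t /=; [move=> h; split => i; have [] := h i|
     move=> [h1 h2] i; split].
- by move=> _; exists (fun=> setT) => //; apply/seteqP; split.
- by rewrite bigcup_const.
- move=> _ [A mA <-]; transitivity (\prod_i mu (A i))%E; last first.
    by symmetry; exact: tensor_power_box.
  rewrite -independent_setT//.
  rewrite /m1/= /distribution/pushforward/=; congr (P _).
  apply/seteqP; split => w /= h i.
    by move=> _; have := h i; rewrite tnth_mktuple.
  by rewrite tnth_mktuple; exact: h.
- by move=> _; rewrite [ltLHS](@probability_setT _ _ _ P) ltry.
Qed.

End independence.

(** Young's inequality with weight c, from the square of c x - y. *)
Lemma two_dot_le (R : realType) (d : nat) (x y : 'rV[R]_d) (c : R) : 0 < c ->
  2 * dot x y <= c * dot x x + c^-1 * dot y y.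
Proof.
move=> c0; have := dotxx_ge0 (c *: x - y).
rewrite dotBl !dotBr !dotZl !dotZr (dotC y x) => h.
rewrite -(ler_pM2l c0) mulrDr [c * (c^-1 * _)]mulVKf ?gt_eqF//; lra.
Qed.

(** * Deviation from the mean-field particles *)

Section recentering.
Context {R : realType} {d J : nat}.
Hypothesis J0 : (1 <= J)%N.
Implicit Types f g : 'I_J -> 'rV[R]_d.

Lemma natJ_neq0 : J%:R != 0 :> R.
Proof. by rewrite pnatr_eq0 -lt0n. Qed.

Lemma sum_cst (c : R) : \sum_(k < J) c = J%:R * c.
Proof. by rewrite sumr_const card_ord mulr_natl. Qed.

Lemma recenterE f j : recenter f j = J%:R^-1 *: \sum_k (f j - f k).
Proof.
rewrite sumrB scalerBr (_ : \sum_(k < J) f j = J%:R *: f j); last first.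
  by rewrite sumr_const card_ord scaler_nat.
by rewrite scalerA mulVf ?natJ_neq0// scale1r.
Qed.

Lemma sum_recenter f : \sum_j recenter f j = 0.
Proof.
rewrite /recenter sumrB sumr_const card_ord -[X in _ - X]scaler_nat scalerA.
by rewrite divff ?natJ_neq0// scale1r subrr.
Qed.

Lemma enorm_recenter f j c : (forall k, enorm (f j - f k) <= c) ->
  enorm (recenter f j) <= c.
Proof.
move=> h; rewrite recenterE enormZ ger0_norm ?invr_ge0//.
apply: (@le_trans _ _ (J%:R^-1 * \sum_(k < J) c)).
  rewrite ler_wpM2l ?invr_ge0// (le_trans (enorm_sum _ _ _))//.
  by apply: ler_sum => k _; exact: h.
by rewrite sum_cst mulKf ?natJ_neq0.
Qed.

(** Exchanging the indices negates the sum: conservation of momentum under symmetric interaction. *)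
Lemma sum_antisym (p : 'I_J -> 'I_J -> R) f : (forall j k, p j k = p k j) ->
  \sum_j \sum_k p j k *: (f j - f k) = 0.
Proof.
move=> ps; set S := \sum_j _.
have e : S = - S.
  rewrite {1}/S exchange_big/= /S -sumrN; apply: eq_bigr => j _.
  by rewrite -sumrN; apply: eq_bigr => k _; rewrite ps -scalerN opprB.
have : 2 *: S = 0 by rewrite scaler_nat mulr2n {1}e addNr.
by move/eqP; rewrite scaler_eq0 pnatr_eq0/= => /eqP.
Qed.

End recentering.

(** * Energy estimates at a fixed time *)

Section energy.
Context {R : realType} {d J : nat}.
Hypothesis J0 : (1 <= J)%N.
Variables (K L c del : R) (y w u er : 'I_J -> 'rV[R]_d) (p q : 'I_J -> 'I_J -> R).
Hypothesis K0 : 0 < K.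
Hypothesis L0 : 0 <= L.
Hypothesis c0 : 0 < c.
Hypothesis del0 : 0 <= del.
Hypothesis psym : forall j k, p j k = p k j.
Hypothesis pc : forall j k, c <= p j k <= 1.
Hypothesis pq : forall j k, `|p j k - q j k| <= L * enorm (y j - y k).
Hypothesis udel : forall j k, enorm (u j - u k) <= del.

(** With p, q the rates of the two systems, the difference of their interaction terms splits as p
    (w_j - w_k) + (p - q) (u_j - u_k); the last sum is the recentred sampling error [er]. *)
Definition deviation_rate j : 'rV[R]_d :=
  - (K / J%:R) *: (\sum_k p j k *: (w j - w k))
  - (K / J%:R) *: (\sum_k (p j k - q j k) *: (u j - u k))
  + (K / J%:R) *: (\sum_k (er j - er k)).

Let lam := K * c.
Let lam0 : 0 < lam. Proof. exact: mulr_gt0. Qed.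
Let a j := dot (y j) (y j).
Let b j := dot (w j) (w j).
Let F j := dot (er j) (er j).

Let drift j k := - ((p j k - q j k) * dot (w j) (u j - u k)) + dot (w j) (er j - er k).

Let dot_rate j : dot (w j) (deviation_rate j) =
  J%:R^-1 * \sum_k (K * - (p j k * dot (w j) (w j - w k)) + K * drift j k).
Proof.
rewrite dotDr dotBr !dotZr !dot_sumr big_split/= mulrDr -!mulr_sumr.
rewrite /drift big_split/= !sumrN.
under [in LHS]eq_bigr do rewrite dotZr.
under [X in _ - _ * X]eq_bigr do rewrite dotZr.
by field; exact: natJ_neq0.
Qed.

(** Young with weight lam / (2 K) spends lam / 4 of the damping on the sampling errors. *)
Let drift_le j k : K * drift j k <=
  K * L * del * (a j / 2 + a k / 2 + b j) + lam / 4 * b j + 2 * K ^+ 2 / lam * (F j + F k).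
Proof.
have h1 : - ((p j k - q j k) * dot (w j) (u j - u k)) <=
    L * del * (a j / 2 + a k / 2 + b j).
  apply: (le_trans (ler_norm _)); rewrite normrN normrM.
  apply: (@le_trans _ _ (L * enorm (y j - y k) * (enorm (w j) * del))).
    apply: ler_pM => //; apply: (le_trans (normr_dot_le _ _)).
    by rewrite ler_wpM2l ?enorm_ge0.
  rewrite [leLHS](_ : _ = L * del * (enorm (y j - y k) * enorm (w j))); last by ring.
  apply: ler_wpM2l; first exact: mulr_ge0.
  apply: (@le_trans _ _ ((enorm (y j) + enorm (y k)) * enorm (w j))).
    by rewrite ler_wpM2r ?enorm_ge0// enormB.
  rewrite /a /b -!enorm_sqr.
  have := sqr_ge0 (enorm (y j) - enorm (w j)).
  have := sqr_ge0 (enorm (y k) - enorm (w j)).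
  by move: (enorm (y j)) (enorm (y k)) (enorm (w j)) => *; lra.
have h2 : K * dot (w j) (er j - er k) <= lam / 4 * b j + 2 * K ^+ 2 / lam * (F j + F k).
  have c1 : 0 < lam / (2 * K) by rewrite divr_gt0// mulr_gt0.
  have := two_dot_le (w j) (er j - er k) c1; rewrite -/(b j) => h.
  have h3 : dot (er j - er k) (er j - er k) <= 2 * (F j + F k).
    have := dotxx_ge0 (er j + er k).
    rewrite !dotDl !dotDr !dotNl !dotNr /F (dotC (er k) (er j)); lra.
  have h4 : K * dot (w j) (er j - er k) <= K / 2 * (lam / (2 * K) * b j +
     (lam / (2 * K))^-1 * (2 * (F j + F k))).
    rewrite [leLHS](_ : _ = K / 2 * (2 * dot (w j) (er j - er k))); last by field.
    rewrite ler_wpM2l ?divr_ge0 ?(ltW K0)// (le_trans h)// lerD2l ler_wpM2l//.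
    by rewrite invr_ge0 ltW.
  apply: (le_trans h4); rewrite le_eqVlt; apply/orP; left; apply/eqP.
  by field; rewrite !gt_eqF.
rewrite /drift mulrDr -addrA lerD//; rewrite -!mulrA ler_pM2l// !mulrA.
exact: h1.
Qed.

(** The cross terms p <w_j, w_k> do not sum to zero, since p depends on k; Young bounds them by lam
    / 4 of the own energy plus the mean energy. With the lam / 4 of [drift_le], the damping left is
    2 (lam - lam / 2) = lam. *)
Lemma energy_individual j :
  2 * dot (w j) (deviation_rate j) <=
  - lam * b j + 2 * K ^+ 2 / lam * (J%:R^-1 * \sum_k b k) +
  K * L * del * (a j + J%:R^-1 * \sum_k a k + 2 * b j) +
  4 * K ^+ 2 / lam * (F j + J%:R^-1 * \sum_k F k).
Proof.
have key k : K * - (p j k * dot (w j) (w j - w k)) + K * drift j k <=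
    (- lam / 2 * b j + K * L * del * (a j / 2 + b j) + 2 * K ^+ 2 / lam * F j) +
    (K ^+ 2 / lam * b k + K * L * del / 2 * a k + 2 * K ^+ 2 / lam * F k).
  have /andP[p1 p2] := pc j k.
  have p0 : 0 <= p j k by rewrite (le_trans (ltW c0)).
  have h1 : lam * b j <= K * (p j k * b j).
    by rewrite /lam -mulrA ler_pM2l// ler_wpM2r// dotxx_ge0.
  have h2 : K * (p j k * dot (w j) (w k)) <= lam / 4 * b j + K ^+ 2 / lam * b k.
    have c1 : 0 < lam / (2 * K) by rewrite divr_gt0// mulr_gt0.
    have h := two_dot_le (w j) (w k) c1.
    have h' : 2 * (p j k * dot (w j) (w k)) <=
        lam / (2 * K) * b j + (lam / (2 * K))^-1 * b k.
      have [dn|dp] := leP (dot (w j) (w k)) 0.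
        apply: (@le_trans _ _ 0); first by rewrite pmulr_rle0// mulr_ge0_le0.
        by rewrite addr_ge0// mulr_ge0 ?dotxx_ge0 ?invr_ge0// ltW.
      apply: le_trans h; rewrite ler_pM2l// ler_piMl// ltW//.
    have := ler_wpM2l (ltW K0) h'.
    rewrite [X in _ <= X -> _](_ : _ = 2 * (lam / 4 * b j + K ^+ 2 / lam * b k)); first by lra.
    by field; rewrite !gt_eqF.
  have := drift_le j k; rewrite dotBr -/(b j); move: h1 h2.
  move: (dot (w j) (w k)) (drift j k) (2 * K ^+ 2 / lam) (K ^+ 2 / lam) => *; lra.
rewrite dot_rate.
have h : \sum_k (K * - (p j k * dot (w j) (w j - w k)) + K * drift j k) <=
    \sum_k ((- lam / 2 * b j + K * L * del * (a j / 2 + b j) + 2 * K ^+ 2 / lam * F j) +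
    (K ^+ 2 / lam * b k + K * L * del / 2 * a k + 2 * K ^+ 2 / lam * F k)).
  by apply: ler_sum => k _; exact: key.
move: h; rewrite [leRHS]big_split/= sum_cst [X in _ <= _ + X -> _]big_split/=.
rewrite [X in _ <= _ + (X + _) -> _]big_split/= -!mulr_sumr => h.
have J1 : 0 <= J%:R^-1 :> R by rewrite invr_ge0.
have := ler_wpM2l J1 h; set S := J%:R^-1 * _ => {}h.
rewrite -(ler_pM2l (ltr0n R 2)) in h; apply: (le_trans h).
rewrite le_eqVlt; apply/orP; left; apply/eqP.
by field; rewrite natJ_neq0// gt_eqF.
Qed.

Hypothesis w_sum0 : \sum_j w j = 0.

(** Symmetrising in j and k doubles the right side into the sum of p |w_j - w_k|^2. There p >= c,
    and since the w_j sum to zero the remaining double sum is 2 J times the energy. *)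
Let alignment_dissipation :
  c * (J%:R * \sum_j b j) <= \sum_j \sum_k p j k * dot (w j) (w j - w k).
Proof.
set S := (X in _ <= X).
have e : S + S = \sum_j \sum_k p j k * dot (w j - w k) (w j - w k).
  rewrite {2}/S exchange_big/= /S -big_split; apply: eq_bigr => j _.
  rewrite -big_split; apply: eq_bigr => k _ /=; rewrite (psym k j).
  by rewrite dotBl !dotBr (dotC (w k) (w j)); ring.
have h : \sum_j \sum_k c * dot (w j - w k) (w j - w k) <= S + S.
  rewrite e; apply: ler_sum => j _; apply: ler_sum => k _.
  by have /andP[p1 _] := pc j k; rewrite ler_wpM2r// dotxx_ge0.
have e2 : \sum_j \sum_k c * dot (w j - w k) (w j - w k) =
    c * (J%:R * \sum_j b j) + c * (J%:R * \sum_j b j).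
  rewrite (_ : \sum_j \sum_k _ = \sum_j \sum_k (c * b j + c * b k +
    - (2 * c) * dot (w j) (w k))); last first.
    apply: eq_bigr => j _; apply: eq_bigr => k _.
    by rewrite dotBl !dotBr (dotC (w k) (w j)) /b; ring.
  under eq_bigr => j _.
    rewrite big_split/= big_split/= sum_cst -!mulr_sumr -dot_sumr w_sum0 dot0r mulr0 addr0.
    over.
  rewrite big_split/= sum_cst -mulr_sumr; congr (_ + _); last by ring.
  by rewrite -mulr_sumr; ring.
by rewrite e2 in h; lra.
Qed.

(** Here the cross terms cost nothing and only [drift_le] reduces the damping, to 2 (lam - lam / 4).
    The surplus over [energy_individual] leaves room for a faster growing weight. *)
Lemma energy_total :
  \sum_j (2 * dot (w j) (deviation_rate j)) <=
  - (3 / 2) * lam * \sum_j b j + 2 * (K * L * del) * (\sum_j a j + \sum_j b j) +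
  8 * K ^+ 2 / lam * \sum_j F j.
Proof.
have J1 : 0 <= J%:R^-1 :> R by rewrite invr_ge0.
pose S1 := \sum_j \sum_k p j k * dot (w j) (w j - w k).
pose S2 := \sum_j \sum_k K * drift j k.
have e : \sum_j (2 * dot (w j) (deviation_rate j)) = 2 * (J%:R^-1 * (- K * S1 + S2)).
  rewrite -mulr_sumr; congr (_ * _); under eq_bigr do rewrite dot_rate big_split/=.
  rewrite -mulr_sumr big_split/=; congr (_ * (_ + _)).
  rewrite /S1 mulr_sumr; apply: eq_bigr => j _; rewrite mulr_sumr.
  by apply: eq_bigr => k _; rewrite mulrN mulNr.
have h1 : lam * (J%:R * \sum_j b j) <= K * S1.
  by rewrite /lam -mulrA ler_pM2l//; exact: alignment_dissipation.
have h2 : S2 <= J%:R * (K * L * del * (\sum_j a j + \sum_j b j) + lam / 4 * \sum_j b j +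
    4 * K ^+ 2 / lam * \sum_j F j).
  apply: (@le_trans _ _ (\sum_j \sum_k ((K * L * del / 2 * a j +
      K * L * del * b j + lam / 4 * b j + 2 * K ^+ 2 / lam * F j) +
      (K * L * del / 2 * a k + 2 * K ^+ 2 / lam * F k)))).
    apply: ler_sum => j _; apply: ler_sum => k _; apply: (le_trans (drift_le j k)).
    by rewrite le_eqVlt; apply/orP; left; apply/eqP; field; rewrite gt_eqF.
  under eq_bigr => j _.
    rewrite big_split/= sum_cst; over.
  rewrite big_split/= sum_cst -mulr_sumr !big_split/= -!mulr_sumr.
  by rewrite le_eqVlt; apply/orP; left; apply/eqP; field; rewrite gt_eqF.
rewrite e.
have h3 : - K * S1 + S2 <= J%:R * (- lam * \sum_j b j +
    (K * L * del * (\sum_j a j + \sum_j b j) + lam / 4 * \sum_j b j +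
    4 * K ^+ 2 / lam * \sum_j F j)) by lra.
have := ler_wpM2l J1 h3; rewrite mulKf ?natJ_neq0// => h4.
rewrite -(ler_pM2l (ltr0n R 2)) in h4; apply: (le_trans h4).
by rewrite le_eqVlt; apply/orP; left; apply/eqP; field; rewrite gt_eqF.
Qed.

End energy.

(** * Flocking of the interacting particles *)

Section particle_flocking.
Context {R : realType} (L : R) (psi : R -> R).
Hypothesis rate : communication_rate L psi.
Context {d J : nat}.
Hypothesis J0 : (1 <= J)%N.
Context (K : R) (x0 v0 : 'I_J -> 'rV[R]_d) (x v : 'I_J -> R -> 'rV[R]_d).
Hypothesis K0 : 0 < K.
Hypothesis cs : cucker_smale K psi x0 v0 x v.
Variables (DX DV Dinf : R).
Hypothesis DX0 : 0 <= DX.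
Hypothesis iniX : forall j k, enorm (x0 j - x0 k) <= DX.
Hypothesis iniV : forall j k, enorm (v0 j - v0 k) <= DV.
Hypothesis Dinf_ge : DX <= Dinf.
Hypothesis DinfP : DV < K * (potential psi DX Dinf - potential psi DX DX).

Definition cs_rate j t : 'rV[R]_d := - (K / J%:R) *:
  \sum_(k < J) psi (enorm (x j t - x k t)) *: (v j t - v k t).

Lemma cs_align (t : R) a b (EX EV : R) : 0 < t ->
  (forall a b, enorm (x a t - x b t) <= EX) ->
  (forall a b, enorm (v a t - v b t) <= EV) ->
  forall e, dot e (cs_rate a t - cs_rate b t) <=
    K * (enorm e * ((1 - psi EX) * EV) - dot e (v a t - v b t)).
Proof.
move=> _ hx hv e; have J0' := natJ_neq0 (R := R) J0.
have EV0 : 0 <= EV by rewrite (le_trans _ (hv a a))// enorm_ge0.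
rewrite /cs_rate -scalerBr dotZr [X in _ * X <= _]dotBr !dot_sumr -sumrB.
rewrite mulNr -mulrN -sumrN -mulrA ler_pM2l//.
apply: (@le_trans _ _ (J%:R^-1 * \sum_(k < J)
    (enorm e * ((1 - psi EX) * EV) - dot e (v a t - v b t)))).
  rewrite ler_wpM2l ?invr_ge0//; apply: ler_sum => k _; rewrite !dotZr.
  have le z D : enorm z <= D -> dot e z <= enorm e * D.
    by move=> zD; rewrite (le_trans (dot_le _ _))// ler_wpM2l ?enorm_ge0.
  have := @alignment_barycentric R (psi (enorm (x a t - x k t)))
    (psi (enorm (x b t - x k t))) (psi EX) (enorm e * EV)
    (dot e (v a t)) (dot e (v b t)) (dot e (v k t)).
  rewrite -!dotBr (mulrCA (enorm e)); apply.
  - by rewrite (rate_nincr rate) ?enorm_ge0//= (rate_le1 rate) ?enorm_ge0.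
  - by rewrite (rate_nincr rate) ?enorm_ge0//= (rate_le1 rate) ?enorm_ge0.
  - by rewrite mulr_ge0 ?enorm_ge0.
  - exact: le.
  - exact: le.
  - exact: le.
by rewrite sum_cst mulKf.
Qed.

Lemma sderiv_bounded (f df : R -> R) (T : R) : sderiv f df ->
  exists M : R, forall t, 0 <= t <= T -> `|f t| <= M.
Proof.
move=> [_ cf]; have [T0|T0] := leP 0 T; last first.
  by exists 0 => t /andP[t0 tT]; move: (le_lt_trans (le_trans t0 tT) T0); rewrite ltxx.
have cT : {within `[0, T], continuous f}.
  by apply: continuous_subspaceW cf => s /=; rewrite in_itv/= => /andP[].
have [c _ hc] := EVT_max T0 cT; have [c' _ hc'] := EVT_min T0 cT.
exists (`|f c| + `|f c'|) => t tT.
have tI : t \in `[0, T] by rewrite in_itv.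
have := hc t tI; have := hc' t tI; rewrite ler_norml => h1 h2.
have := ler_norm (f c); have := ler_norm (- f c'); rewrite normrN.
have := normr_ge0 (f c); have := normr_ge0 (f c').
by move=> *; apply/andP; split; lra.
Qed.

Lemma has_derivative_enorm_bounded (f g : R -> 'rV[R]_d) (T : R) :
  has_derivative f g -> exists M : R, forall t, 0 <= t <= T -> enorm (f t) <= M.
Proof.
move=> h.
have hi i := has_derivative_coord i h.
have := sderiv_bounded T (sderiv_sum (index_enum 'I_d) (fun i => sderivM (hi i) (hi i))).
move=> [M hM]; exists (1 + M) => t tT; have := hM t tT.
rewrite -/(dot (f t) (f t)) ger0_norm ?dotxx_ge0// -enorm_sqr.
by have := sqr_ge0 (enorm (f t) - 1); have := enorm_ge0 (f t); nra.
Qed.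

Lemma cs_loc_bound (T : R) : exists M : R, forall t a b, 0 <= t <= T ->
  enorm (x a t - x b t) <= M /\ enorm (v a t - v b t) <= M.
Proof.
have dx a : has_derivative (x a) (v a) by have [] := cs a.
have dv a : has_derivative (v a) (cs_rate a) by have [] := cs a.
have /choice[M hM] : forall p : 'I_J * 'I_J, exists M : R, forall t, 0 <= t <= T ->
    enorm (x p.1 t - x p.2 t) <= M /\ enorm (v p.1 t - v p.2 t) <= M.
  move=> [a b] /=.
  have [M1 h1] := has_derivative_enorm_bounded T (has_derivativeB (@dx a) (@dx b)).
  have [M2 h2] := has_derivative_enorm_bounded T (has_derivativeB (@dv a) (@dv b)).
  exists (Num.max M1 M2) => t tT; rewrite !le_max.
  by rewrite (h1 t tT) (h2 t tT) orbT.
exists (\sum_p `|M p|) => t a b tT; have [h1 h2] := hM (a, b) t tT.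
have le : M (a, b) <= \sum_p `|M p|.
  by rewrite (bigD1 (a, b))//= ler_wpDr ?ler_norm// sumr_ge0.
by split; apply: le_trans le.
Qed.

Lemma cs_flocking (t : R) a b : 0 <= t ->
  enorm (x a t - x b t) <= Dinf /\
  enorm (v a t - v b t) <= DV * expR (- (K * psi Dinf) * t).
Proof.
move=> t0; have dx c : has_derivative (x c) (v c) by have [] := cs c.
have dv c : has_derivative (v c) (cs_rate c) by have [] := cs c.
apply: (@flocking R L psi rate d 'I_J a K x v cs_rate K0 dx dv cs_align
  cs_loc_bound DX DV Dinf (potential psi DX)) => //.
- by move=> c e; have [-> _ _ _] := cs c; have [-> _ _ _] := cs e.
- by move=> c e; have [_ -> _ _] := cs c; have [_ -> _ _] := cs e.
- exact: (potential_ndecr rate DX0).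
- exact: (potential_concave rate DX0).
Qed.

End particle_flocking.

(** The Lyapunov estimate reduced to real numbers: a, b are the position and velocity energies of
    one particle, A, B the means, F, Fm the squared errors, e2, e4 the weights, and d2, d4 the
    weighted perturbation coefficients. The damping rates lam and 3/2 lam outweigh the growth rates
    lam / 4 and lam / 2 of the weights; e2 <= s e4 turns the coupling to B into a term with factor
    s. *)
Lemma lyapunov_scalar (R : realType)
    (a b A B F Fm s e2 e4 lam kl M2 d2 d4 yw YW wr WR : R) :
  0 <= a -> 0 <= b -> 0 <= A -> 0 <= B -> 0 <= F -> 0 <= Fm -> 0 < s ->
  1 <= e2 -> e2 <= e4 -> e2 <= s * e4 -> 0 < lam -> 0 <= kl -> 0 <= M2 ->
  0 <= d2 -> d2 <= kl * s -> 0 <= d4 -> d4 <= kl * s ->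
  yw <= s * a + s * e2 * b -> YW <= s * A + s * e4 * B ->
  wr <= e2 * (- lam * b + 2 * M2 * B) + d2 * (a + A + 2 * b) + 4 * M2 * e2 * (F + Fm) ->
  WR <= e4 * (- (3 / 2) * lam * B) + 2 * d4 * (A + B) + 8 * M2 * e4 * Fm ->
  (yw + (lam / 4 * e2 * b + wr)) + (YW + (lam / 2 * e4 * B + WR)) <=
  s * (1 + 2 * M2 + 3 * kl) * ((a + e2 * b) + (A + e4 * B)) +
  12 * M2 * e4 * (F + Fm).
Proof.
move=> a0 b0 A0 B0 F0 Fm0 s0 e21 e24 e2s lam0 kl0 M20 d20 d2k d40 d4k h1 h2 h3 h4.
have e20 : 0 <= e2 by rewrite (le_trans _ e21).
have e40 : 0 <= e4 by rewrite (le_trans _ e24).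
have s0' := ltW s0.
have k0 : 0 <= kl * s by rewrite mulr_ge0.
have t1 : d2 * (a + A + 2 * b) <= kl * s * (a + A + 2 * (e2 * b)).
  apply: ler_pM => //; first by rewrite !addr_ge0 ?mulr_ge0.
  by rewrite lerD2l ler_wpM2l// ler_peMl.
have t2 : d4 * (A + B) <= kl * s * (A + e4 * B).
  apply: ler_pM => //; first by rewrite addr_ge0.
  by rewrite lerD2l ler_peMl// (le_trans e21).
have t3 : e2 * (M2 * B) <= s * e4 * (M2 * B) by rewrite ler_wpM2r// mulr_ge0.
have t4 : e2 * (M2 * (F + Fm)) <= e4 * (M2 * (F + Fm)).
  by rewrite ler_wpM2r// mulr_ge0// addr_ge0.
have u1 : 0 <= lam * (e2 * b) by rewrite !mulr_ge0// ltW.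
have u2 : 0 <= lam * (e4 * B) by rewrite !mulr_ge0// ltW.
have u3 : 0 <= M2 * s * a by rewrite !mulr_ge0.
have u4 : 0 <= M2 * s * (e2 * b) by rewrite !mulr_ge0.
have u5 : 0 <= M2 * s * A by rewrite !mulr_ge0.
have u6 : 0 <= kl * s * a by rewrite !mulr_ge0.
have u7 : 0 <= kl * s * (e2 * b) by rewrite !mulr_ge0.
have u8 : 0 <= kl * s * (e4 * B) by rewrite !mulr_ge0.
have u9 : 0 <= M2 * e4 * F by rewrite !mulr_ge0.
lra.
Qed.

Section deviation.
Context {R : realType} (L : R) (psi : R -> R).
Hypothesis rate : communication_rate L psi.
Context {d J : nat}.
Hypothesis J0 : (1 <= J)%N.
Context (K : R) (x0 v0 : 'I_J -> 'rV[R]_d) (X V Y U : 'I_J -> R -> 'rV[R]_d)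
  (mU : 'I_J -> R -> 'rV[R]_d).
Hypothesis K0 : 0 < K.
Hypothesis cs : cucker_smale K psi x0 v0 X V.
Hypothesis dY : forall j, has_derivative (Y j) (U j).
Hypothesis dU : forall j, has_derivative (U j) (fun t => - K *: mU j t).
Hypothesis iniY : forall j, Y j 0 = x0 j.
Hypothesis iniU : forall j, U j 0 = v0 j.
Variables (D Dinf : R).
Hypothesis D0 : 0 <= D.
Hypothesis Dinf0 : 0 <= Dinf.
Let lam := K * psi Dinf.
Hypothesis flockX : forall t j k, 0 <= t -> enorm (X j t - X k t) <= Dinf /\
  enorm (V j t - V k t) <= D * expR (- lam * t).
Hypothesis flockY : forall t j k, 0 <= t -> enorm (Y j t - Y k t) <= Dinf /\
  enorm (U j t - U k t) <= D * expR (- lam * t).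

Definition devX j t := recenter (X ^~ t) j - recenter (Y ^~ t) j.
Definition devV j t := recenter (V ^~ t) j - recenter (U ^~ t) j.
Definition sampling_error j t := mU j t -
  J%:R^-1 *: \sum_k psi (enorm (Y j t - Y k t)) *: (U j t - U k t).

Let p t j k := psi (enorm (X j t - X k t)).
Let q t j k := psi (enorm (Y j t - Y k t)).
Let rateV j t := deviation_rate K (devV ^~ t) (U ^~ t) (sampling_error ^~ t) (p t) (q t) j.

Lemma devX_devV j : has_derivative (devX j) (devV j).
Proof.
have dX i : has_derivative (X i) (V i) by have [] := cs i.
have rc (f g : 'I_J -> R -> 'rV[R]_d) : (forall i, has_derivative (f i) (g i)) ->
    has_derivative (fun t => recenter (f ^~ t) j) (fun t => recenter (g ^~ t) j).
  move=> h; apply: has_derivativeB; first exact: h.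
  by apply: has_derivativeZ; exact: has_derivative_sum.
by apply: has_derivativeB; apply: rc; [exact: dX|exact: dY].
Qed.

(** Both interaction sums have zero mean by [sum_antisym], so recentring changes only the sampling
    errors, each of which becomes its difference to their mean. *)
Lemma devV_rate j : has_derivative (devV j) (rateV j).
Proof.
have dV i : has_derivative (V i) (fun t => - (K / J%:R) *:
  \sum_(k < J) p t i k *: (V i t - V k t)) by have [] := cs i.
have rc (f g : 'I_J -> R -> 'rV[R]_d) : (forall i, has_derivative (f i) (g i)) ->
    has_derivative (fun t => recenter (f ^~ t) j) (fun t => recenter (g ^~ t) j).
  move=> h; apply: has_derivativeB; first exact: h.
  by apply: has_derivativeZ; exact: has_derivative_sum.
apply: has_derivative_ext (has_derivativeB (rc _ _ (fun i => @dV i))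
  (rc _ _ (fun i => @dU i))) _ _ => //= t.
pose pU i := \sum_k q t i k *: (U i t - U k t).
pose pV i := \sum_k p t i k *: (V i t - V k t).
have sV : \sum_i pV i = 0.
  by apply: sum_antisym => i k; rewrite /p enormC.
have sU : \sum_i pU i = 0.
  by apply: sum_antisym => i k; rewrite /q enormC.
have J1 := natJ_neq0 (R := R) J0.
have mUE i : mU i t = sampling_error i t + J%:R^-1 *: pU i.
  by rewrite /sampling_error subrK.
rewrite /recenter -/(pV j) -scaler_sumr -/pV sV !scaler0 subr0.
have -> : \sum_i - K *: mU i t = - K *: \sum_i sampling_error i t.
  rewrite -scaler_sumr; congr (_ *: _); under eq_bigr do rewrite mUE.
  by rewrite big_split/= -scaler_sumr sU scaler0 addr0.
rewrite mUE /rateV /deviation_rate.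
have -> : \sum_k p t j k *: (devV j t - devV k t) =
    pV j - \sum_k p t j k *: (U j t - U k t).
  rewrite /pV -sumrB; apply: eq_bigr => k _; rewrite -scalerBr; congr (_ *: _).
  rewrite /devV /recenter.
  move: (J%:R^-1 *: \sum_i V i t) (J%:R^-1 *: \sum_i U i t) => aV aU.
  by apply/rowP => i; rewrite !mxE; ring.
have -> : \sum_k (p t j k - q t j k) *: (U j t - U k t) =
    \sum_k p t j k *: (U j t - U k t) - pU j.
  by rewrite /pU -sumrB; apply: eq_bigr => k _; rewrite scalerBl.
have -> : \sum_k (sampling_error j t - sampling_error k t) =
    J%:R *: sampling_error j t - \sum_k sampling_error k t.
  by rewrite sumrB sumr_const card_ord scaler_nat.
move: (pV j) (pU j) (sampling_error j t) (\sum_k sampling_error k t)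
  (\sum_k p t j k *: (U j t - U k t)) => a b e f g.
by apply/rowP => i; rewrite !mxE; field.
Qed.

Lemma sum_devV t : \sum_j devV j t = 0.
Proof. by rewrite /devV sumrB !sum_recenter// subrr. Qed.

Lemma dev0 j : devX j 0 = 0 /\ devV j 0 = 0.
Proof.
rewrite /devX /devV.
have -> : (X ^~ 0) = (Y ^~ 0).
  by apply/funext => i; have [-> _ _ _] := cs i; rewrite iniY.
have -> : (V ^~ 0) = (U ^~ 0).
  by apply/funext => i; have [_ -> _ _] := cs i; rewrite iniU.
by rewrite !subrr.
Qed.

Hypothesis mU_bound : forall t j, 0 <= t -> enorm (mU j t) <= D.

Let lam0 : 0 < lam. Proof. by rewrite mulr_gt0// (rate_gt0 rate). Qed.
Let J1 : 0 <= J%:R^-1 :> R. Proof. by rewrite invr_ge0. Qed.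
Let L0 := rate_lip_ge0 rate.

Let a j t := dot (devX j t) (devX j t).
Let b j t := dot (devV j t) (devV j t).
Let F j t := dot (sampling_error j t) (sampling_error j t).
(** The unit of decay: the weights are s^-2 and s^-4, the velocity diameter bound is D s^8. These
    powers make 1 / s = s e2 for Young's inequality on positions and velocities, e2 <= s e4 for the
    coupling, and e4 s^8 <= s for the perturbation. *)
Let s t := expR (- lam / 8 * t).
Let e2 t := expR (lam / 4 * t).
Let e4 t := expR (lam / 2 * t).

Let p_bounds t j k : 0 <= t -> psi Dinf <= p t j k <= 1.
Proof.
move=> t0; have [h _] := flockX j k t0.
by rewrite /p (rate_nincr rate) ?enorm_ge0//= (rate_le1 rate) ?enorm_ge0.
Qed.

Let q_bounds t j k : 0 <= q t j k <= 1.
Proof. by rewrite /q ltW ?(rate_gt0 rate) ?(rate_le1 rate) ?enorm_ge0. Qed.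

Let pq_lip t j k : `|p t j k - q t j k| <= L * enorm (devX j t - devX k t).
Proof.
apply: (le_trans (rate_lip rate (enorm_ge0 _) (enorm_ge0 _))).
rewrite ler_wpM2l// (le_trans (enorm_dist _ _))// le_eqVlt; apply/orP; left.
apply/eqP; congr enorm; rewrite /devX /recenter.
move: (J%:R^-1 *: \sum_i X i t) (J%:R^-1 *: \sum_i Y i t) => aX aY.
by apply/rowP => i; rewrite !mxE; ring.
Qed.

(* An individual velocity is damped only up to the mean velocity energy; the
   ratio e2 / e4 = s^2 of the two weights makes this contribution integrable. *)
Definition lyapunov j t := (a j t + e2 t * b j t) +
  J%:R^-1 * (\sum_k a k t + e4 t * \sum_k b k t).

Definition lyapunov_rate j t :=
  (2 * dot (devX j t) (devV j t) +
   (lam / 4 * e2 t * b j t + e2 t * (2 * dot (devV j t) (rateV j t)))) +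
  J%:R^-1 * (\sum_k 2 * dot (devX k t) (devV k t) +
   (lam / 2 * e4 t * \sum_k b k t + e4 t * \sum_k (2 * dot (devV k t) (rateV k t)))).

Lemma lyapunov_sderiv j : sderiv (lyapunov j) (lyapunov_rate j).
Proof.
have da k := sderiv_dot (@devX_devV k).
have db k := sderiv_dot (@devV_rate k).
apply: sderivD.
  by apply: sderivD; [exact: da|exact: (sderivM (sderiv_expRM _) (db j))].
apply: sderivZ; apply: sderivD; first exact: sderiv_sum.
exact: (sderivM (sderiv_expRM _) (sderiv_sum _ db)).
Qed.

Lemma lyapunov_ge j t : 0 <= t -> a j t + b j t <= lyapunov j t.
Proof.
move=> t0.
have h1 : b j t <= e2 t * b j t.
  rewrite ler_peMl ?dotxx_ge0// -expR0 ler_expR mulr_ge0// divr_ge0// ltW//.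
rewrite -[leLHS]addr0; apply: lerD; first by rewrite lerD2l.
rewrite mulr_ge0// addr_ge0//; first by apply: sumr_ge0 => k _; exact: dotxx_ge0.
by rewrite mulr_ge0 ?expR_ge0//; apply: sumr_ge0 => k _; exact: dotxx_ge0.
Qed.

(** The 1 comes from the position-velocity products, K^2 / lam from the coupling to the mean energy,
    and K L D from the difference of the rates; the factor 3 counts its contributions to the mean
    position energy. *)
Definition growth_const := 1 + 2 * (K ^+ 2 / lam) + 3 * (K * L * D).

Lemma growth_const_ge0 : 0 <= growth_const.
Proof.
rewrite !addr_ge0 ?mulr_ge0 ?sqr_ge0 ?(ltW K0) ?invr_ge0 ?(ltW lam0)//.
Qed.

Let s_gt0 t : 0 < s t. Proof. exact: expR_gt0. Qed.

Let e2E t : e2 t = (s t ^+ 2)^-1.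
Proof. by rewrite /s /e2 -expRM_natl -expRN; congr expR; field. Qed.

Let e4E t : e4 t = (s t ^+ 4)^-1.
Proof. by rewrite /s /e4 -expRM_natl -expRN; congr expR; field. Qed.

Let decayE t : expR (- lam * t) = s t ^+ 8.
Proof. by rewrite /s -expRM_natl; congr expR; field. Qed.

Let s_le1 t : 0 <= t -> s t <= 1.
Proof.
move=> t0; rewrite -expR0 ler_expR; have := mulr_ge0 (ltW lam0) t0; lra.
Qed.

Lemma lyapunov_rate_le j t : 0 <= t -> lyapunov_rate j t <=
  s t * growth_const * lyapunov j t +
  12 * (K ^+ 2 / lam) * e4 t * (F j t + J%:R^-1 * \sum_k F k t).
Proof.
move=> t0; have s0 := s_gt0 t; have s1 := s_le1 t0.
have sn n : 0 < s t ^+ n by rewrite exprn_gt0.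
have sn1 n : s t ^+ n <= 1 by rewrite exprn_ile1// ltW.
pose del := D * s t ^+ 8.
have del0 : 0 <= del by rewrite mulr_ge0// ltW.
have KL0 : 0 <= K * L by rewrite mulr_ge0// ltW.
have udel i k : enorm (U i t - U k t) <= del.
  by have [_] := flockY i k t0; rewrite decayE.
have c0 : 0 < psi Dinf by rewrite (rate_gt0 rate).
have psym i k : p t i k = p t k i by rewrite /p enormC.
have pb i k := p_bounds i k t0.
have hI := @energy_individual R d J J0 K L (psi Dinf) del (devX ^~ t) (devV ^~ t)
  (U ^~ t) (sampling_error ^~ t) (p t) (q t) K0 L0 c0 del0 pb (pq_lip t) udel j.
have hT := @energy_total R d J J0 K L (psi Dinf) del (devX ^~ t) (devV ^~ t)
  (U ^~ t) (sampling_error ^~ t) (p t) (q t) K0 L0 c0 del0 psym pb (pq_lip t)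
  udel (sum_devV t).
move: hI hT; rewrite -/lam -/(rateV j t) => hI hT.
have yw i c : 0 < c -> 2 * dot (devX i t) (devV i t) <= c * a i t + c^-1 * b i t.
  exact: two_dot_le.
have b0 k : 0 <= b k t by exact: dotxx_ge0.
have a0 k : 0 <= a k t by exact: dotxx_ge0.
have F0 k : 0 <= F k t by exact: dotxx_ge0.
have sn0 : s t != 0 by rewrite gt_eqF.
have lamn0 : lam != 0 by rewrite gt_eqF.
have e20 : 0 <= e2 t by exact: expR_ge0.
have e40 : 0 <= e4 t by exact: expR_ge0.
have se4 : s t * e4 t = (s t ^+ 3)^-1 by rewrite e4E; field.
have ss : (s t)^-1 <= s t * e4 t.
  by rewrite se4 lef_pV2 ?posrE// exprS ler_piMr// ltW.
pose A := J%:R^-1 * \sum_k a k t; pose B := J%:R^-1 * \sum_k b k t.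
pose Fm := J%:R^-1 * \sum_k F k t.
pose YW := J%:R^-1 * \sum_k 2 * dot (devX k t) (devV k t).
pose WR := J%:R^-1 * \sum_k (2 * dot (devV k t) (rateV k t)).
have -> : lyapunov_rate j t =
    (2 * dot (devX j t) (devV j t) + (lam / 4 * e2 t * b j t +
      e2 t * (2 * dot (devV j t) (rateV j t)))) +
    (YW + (lam / 2 * e4 t * B + e4 t * WR)).
  by rewrite /lyapunov_rate /YW /WR /B; ring.
have -> : lyapunov j t = (a j t + e2 t * b j t) + (A + e4 t * B).
  by rewrite /lyapunov /A /B; ring.
apply: (@lyapunov_scalar R (a j t) (b j t) A B (F j t) Fm (s t) (e2 t) (e4 t) lam
  (K * L * D) (K ^+ 2 / lam) (e2 t * (K * L * del)) (e4 t * (K * L * del))) => //.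
- by rewrite mulr_ge0// sumr_ge0.
- by rewrite mulr_ge0// sumr_ge0.
- by rewrite mulr_ge0// sumr_ge0.
- by rewrite e2E invf_ge1.
- rewrite e2E e4E lef_pV2 ?posrE// (_ : s t ^+ 4 = s t ^+ 2 * s t ^+ 2) -?exprD//.
  by rewrite exprD ler_piMr// ltW.
- by rewrite se4 e2E lef_pV2 ?posrE// [s t ^+ 3]exprS ler_piMl// ltW.
- by rewrite mulr_ge0.
- by rewrite divr_ge0 ?sqr_ge0// ltW.
- by apply: mulr_ge0 => //; exact: mulr_ge0.
- rewrite (_ : _ * _ = K * L * D * s t ^+ 6); last by rewrite e2E /del; field.
  by apply: ler_wpM2l; [exact: mulr_ge0|rewrite exprS ler_piMr// ltW].
- by apply: mulr_ge0 => //; exact: mulr_ge0.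
- rewrite (_ : _ * _ = K * L * D * s t ^+ 4); last by rewrite e4E /del; field.
  by apply: ler_wpM2l; [exact: mulr_ge0|rewrite exprS ler_piMr// ltW].
- apply: (le_trans (yw j (s t) s0)); rewrite lerD2l ler_wpM2r//.
  by rewrite e2E le_eqVlt; apply/orP; left; apply/eqP; field.
- rewrite (_ : _ + _ = J%:R^-1 * \sum_k (s t * a k t + s t * e4 t * b k t)).
    rewrite ler_wpM2l//; apply: ler_sum => k _; apply: (le_trans (yw k (s t) s0)).
    by rewrite lerD2l ler_wpM2r.
  by rewrite big_split/= -!mulr_sumr /A /B; ring.
- apply: (le_trans (ler_wpM2l e20 hI)); rewrite le_eqVlt; apply/orP; left; apply/eqP.
  by rewrite /A /B /Fm /a /b /F; field; rewrite lamn0 natJ_neq0.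
- apply: (le_trans (ler_wpM2l e40 (ler_wpM2l J1 hT))).
  rewrite le_eqVlt; apply/orP; left; apply/eqP.
  by rewrite /A /B /Fm /a /b /F; field; rewrite lamn0 natJ_neq0.
Qed.

(** The integral of [growth_const] times s over the half-line; [weight] thus decreases from 1 and
    stays above exp (- g1). *)
Let g1 := 8 * growth_const / lam.
(* weight' = - growth_const s weight, which cancels the growth of [lyapunov]. *)
Let weight t := expR (g1 * (s t - 1)).

Let g10 : 0 <= g1.
Proof. by apply: divr_ge0; [rewrite mulr_ge0 ?growth_const_ge0|exact: ltW]. Qed.

Definition damped j t := weight t * lyapunov j t.

Definition damped_rate j t := - (growth_const * s t) * weight t * lyapunov j t +
  weight t * lyapunov_rate j t.

Lemma damped_sderiv j : sderiv (damped j) (damped_rate j).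
Proof.
have ds : sderiv s (fun t => - lam / 8 * s t) by exact: sderiv_expRM.
have dw := sderiv_expR (sderivZ g1 (sderivB ds (sderiv_cst 1))).
apply: sderiv_ext (sderivM dw (lyapunov_sderiv j)) _ _ => // t _.
rewrite /damped_rate -/(weight t); congr (_ * _ * _ + _).
by rewrite /g1; field; rewrite gt_eqF.
Qed.

Let weight_le1 t : 0 <= t -> weight t <= 1.
Proof.
move=> t0; rewrite -[leRHS]expR0 ler_expR.
by apply: mulr_ge0_le0; [exact: g10|rewrite subr_le0; exact: s_le1].
Qed.

Lemma damped_rate_le j t : 0 <= t -> damped_rate j t <=
  12 * (K ^+ 2 / lam) * e4 t * (F j t + J%:R^-1 * \sum_k F k t).
Proof.
move=> t0; have w0 : 0 < weight t by exact: expR_gt0.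
have h := ler_wpM2l (ltW w0) (lyapunov_rate_le j t0).
set S := 12 * _ * _ * _ in h *.
have S0 : 0 <= S.
  rewrite !mulr_ge0 ?sqr_ge0 ?invr_ge0 ?(ltW lam0) ?(ltW K0) ?expR_ge0//.
  rewrite addr_ge0 ?dotxx_ge0// mulr_ge0// sumr_ge0// => k _; exact: dotxx_ge0.
have h2 : weight t * S <= S by rewrite ler_piMl// weight_le1.
rewrite /damped_rate; move: (lyapunov_rate j t) (lyapunov j t) h h2 => x1 x2; lra.
Qed.

Lemma damped_ge j t : 0 <= t -> a j t + b j t <= expR g1 * damped j t.
Proof.
move=> t0; have h := lyapunov_ge j t0.
apply: (le_trans h); rewrite /damped mulrA -expRD ler_peMl//.
  by apply: le_trans h; rewrite addr_ge0 ?dotxx_ge0.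
rewrite -[leLHS]expR0 ler_expR; have := mulr_ge0 g10 (ltW (s_gt0 t)); lra.
Qed.

Lemma damped0 j : damped j 0 = 0.
Proof.
have z k : a k 0 = 0 /\ b k 0 = 0.
  by have [h1 h2] := dev0 k; rewrite /a /b h1 h2 !dot0r.
rewrite /damped /lyapunov (z j).1 (z j).2 !big1 => [|k _|k _].
- by rewrite !(mulr0, addr0).
- by have [] := z k.
- by have [] := z k.
Qed.

Let mean_norm_le (c : R) (x : 'I_J -> R) : (forall k, `|x k| <= c) ->
  `|J%:R^-1 * \sum_k x k| <= c.
Proof.
move=> h; rewrite normrM ger0_norm//.
apply: (@le_trans _ _ (J%:R^-1 * \sum_(k < J) c)).
  rewrite ler_wpM2l// (le_trans (ler_norm_sum _ _ _))//.
  by apply: ler_sum => k _; exact: h.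
by rewrite sum_cst mulKf ?natJ_neq0.
Qed.

(** A crude bound, the same for all samples, that justifies differentiation under the expectation;
    its size does not enter the constant of the theorem. N bounds the deviations, E both weights,
    and 9 K D = K (4 D + D + 4 D) the three sums of [deviation_rate]. *)
Definition damped_rate_bound (b : R) :=
  let N := 2 * (Dinf + D) in let E := expR (lam / 2 * b) in
  growth_const * (2 * (N ^+ 2 + E * N ^+ 2)) +
  2 * (2 * N ^+ 2 + (lam * E * N ^+ 2 + E * (2 * (N * (9 * K * D))))).

Lemma damped_rate_bounded (T t : R) j : 0 <= t <= T ->
  `|damped_rate j t| <= damped_rate_bound T.
Proof.
move=> /andP[t0 tT]; rewrite /damped_rate_bound /=.
set N := 2 * (Dinf + D); set E := expR (lam / 2 * T); set r := 9 * K * D.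
have decay1 : D * expR (- lam * t) <= D.
  rewrite ler_piMr// -[leRHS]expR0 ler_expR mulNr oppr_le0.
  by rewrite mulr_ge0// ltW.
have hU i k : enorm (U i t - U k t) <= D.
  by have [_ h] := flockY i k t0; exact: le_trans h decay1.
have hV i k : enorm (V i t - V k t) <= D.
  by have [_ h] := flockX i k t0; exact: le_trans h decay1.
have wN k : enorm (devV k t) <= 2 * D.
  rewrite (le_trans (enormB _ _))// mulr_natl mulr2n lerD//.
    by apply: enorm_recenter => // i; exact: hV.
  by apply: enorm_recenter => // i; exact: hU.
have xN k : enorm (devX k t) <= N.
  apply: (@le_trans _ _ (2 * Dinf)); last by rewrite /N mulrDr lerDl mulr_ge0.
  rewrite (le_trans (enormB _ _))// mulr_natl mulr2n lerD//.
    by apply: enorm_recenter => // i; have [] := flockX k i t0.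
  by apply: enorm_recenter => // i; have [] := flockY k i t0.
have vN k : enorm (devV k t) <= N by rewrite (le_trans (wN k))// /N mulrDr lerDr mulr_ge0.
have N0 : 0 <= N by rewrite mulr_ge0// addr_ge0.
have Kr0 : 0 <= r by rewrite /r !mulr_ge0// ltW.
have meanE (c : R) (x : 'I_J -> 'rV[R]_d) : (forall k, enorm (x k) <= c) ->
    enorm ((K / J%:R) *: \sum_k x k) <= K * c.
  move=> h; rewrite enormZ ger0_norm ?divr_ge0 ?(ltW K0)// -mulrA ler_wpM2l ?(ltW K0)//.
  apply: (@le_trans _ _ (J%:R^-1 * \sum_(k < J) c)).
    rewrite ler_wpM2l// (le_trans (enorm_sum _ _ _))//.
    by apply: ler_sum => k _; exact: h.
  by rewrite sum_cst mulKf ?natJ_neq0.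
have scale1 (c : R) (x : 'rV[R]_d) (m : R) : `|c| <= 1 -> enorm x <= m ->
    enorm (c *: x) <= m.
  move=> c1 xm; rewrite enormZ; apply: le_trans xm.
  by rewrite ler_piMl ?enorm_ge0.
have erD k : enorm (sampling_error k t) <= 2 * D.
  rewrite (le_trans (enormB _ _))// mulr_natl mulr2n lerD// ?mU_bound//.
  rewrite enormZ ger0_norm//.
  apply: (@le_trans _ _ (J%:R^-1 * \sum_(i < J) D)).
    rewrite ler_wpM2l// (le_trans (enorm_sum _ _ _))//.
    apply: ler_sum => i _; apply: scale1; last exact: hU.
    by have /andP[q0 q1] := q_bounds t k i; rewrite ger0_norm.
  by rewrite sum_cst mulKf ?natJ_neq0.
have rN k : enorm (rateV k t) <= r.
  rewrite /rateV /deviation_rate /r.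
  rewrite (_ : 9 * K * D = K * (4 * D) + K * D + K * (4 * D)); last by ring.
  apply: (le_trans (enormD _ _)); apply: lerD; last first.
    apply: meanE => i; apply: (le_trans (enormB _ _)).
    by have := erD k; have := erD i; lra.
  apply: (le_trans (enormB _ _)); apply: lerD.
    rewrite scaleNr enormN; apply: meanE => i; apply: scale1.
      have /andP[p0 p1] := p_bounds k i t0; rewrite ger0_norm//.
      by rewrite (le_trans _ p0)// ltW// (rate_gt0 rate).
    apply: (le_trans (enormB _ _)).
    by have := wN k; have := wN i; lra.
  apply: meanE => i; apply: scale1; last exact: hU.
  have /andP[p0 p1] := p_bounds k i t0; have /andP[q0 q1] := q_bounds t k i.
  have c0 : 0 <= psi Dinf by rewrite ltW// (rate_gt0 rate).
  by rewrite ler_norml; apply/andP; split; lra.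
have e4E' : e4 t <= E by rewrite ler_expR ler_wpM2l// divr_ge0// ltW.
have e2E' : e2 t <= E.
  apply: le_trans e4E'; rewrite ler_expR ler_wpM2r//.
  by have := lam0; lra.
have e20 : 0 <= e2 t by exact: expR_ge0.
have e40 : 0 <= e4 t by exact: expR_ge0.
have E0 : 0 <= E by exact: expR_ge0.
have dN x y (c c' : R) : enorm x <= c -> enorm y <= c' -> `|dot x y| <= c * c' :> R.
  move=> xc yc; apply: (le_trans (normr_dot_le _ _)).
  by apply: ler_pM => //; exact: enorm_ge0.
have aN k : `|a k t| <= N ^+ 2 by rewrite expr2; exact: dN.
have bN k : `|b k t| <= N ^+ 2 by rewrite expr2; exact: dN.
have lyN : `|lyapunov j t| <= 2 * (N ^+ 2 + E * N ^+ 2).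
  have -> : lyapunov j t = (a j t + e2 t * b j t) +
      J%:R^-1 * \sum_k (a k t + e4 t * b k t).
    by rewrite /lyapunov big_split/= -mulr_sumr.
  rewrite (le_trans (ler_normD _ _))// mulr_natl mulr2n lerD//.
    rewrite (le_trans (ler_normD _ _))// lerD// normrM ger0_norm// ler_pM//.
  apply: mean_norm_le => k.
  by rewrite (le_trans (ler_normD _ _))// lerD// normrM ger0_norm// ler_pM.
have term k (c e : R) : 0 <= c <= lam -> 0 <= e <= E ->
    `|2 * dot (devX k t) (devV k t) +
      (c * e * b k t + e * (2 * dot (devV k t) (rateV k t)))| <=
    2 * N ^+ 2 + (lam * E * N ^+ 2 + E * (2 * (N * r))).
  move=> /andP[c0 cl] /andP[e0 eE].
  have n2 : `|2| = 2 :> R by rewrite ger0_norm.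
  rewrite (le_trans (ler_normD _ _))// lerD//.
    by rewrite normrM n2 ler_wpM2l// expr2; exact: dN.
  rewrite (le_trans (ler_normD _ _))// lerD//.
    by rewrite !normrM (ger0_norm c0) (ger0_norm e0) !ler_pM ?mulr_ge0.
  by rewrite !normrM n2 (ger0_norm e0) ler_pM// ?mulr_ge0// ler_wpM2l//; exact: dN.
have rateN : `|lyapunov_rate j t| <=
    2 * (2 * N ^+ 2 + (lam * E * N ^+ 2 + E * (2 * (N * r)))).
  have -> : lyapunov_rate j t = (2 * dot (devX j t) (devV j t) +
   (lam / 4 * e2 t * b j t + e2 t * (2 * dot (devV j t) (rateV j t)))) +
   J%:R^-1 * (\sum_k (2 * dot (devX k t) (devV k t) +
   (lam / 2 * e4 t * b k t + e4 t * (2 * dot (devV k t) (rateV k t))))).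
    by rewrite /lyapunov_rate !big_split/= -!mulr_sumr.
  have two (x : R) : 2 * x = x + x by rewrite mulr_natl mulr2n.
  rewrite (le_trans (ler_normD _ _))// [leRHS]two lerD//.
    by apply: term; [have := lam0; lra|rewrite e20].
  apply: mean_norm_le => k.
  by apply: term; [have := lam0; lra|rewrite e40].
have w0 : 0 <= weight t by exact: expR_ge0.
have w1 := weight_le1 t0.
have s1 := s_le1 t0; have s0 := ltW (s_gt0 t).
have G0 := growth_const_ge0.
rewrite /damped_rate (le_trans (ler_normD _ _))// lerD//.
  rewrite !normrM normrN normrM (ger0_norm G0) (ger0_norm w0) (ger0_norm s0).
  apply: ler_pM => //; first by rewrite !mulr_ge0.
  by rewrite -mulrA ler_piMr// mulr_ile1.
rewrite normrM (ger0_norm w0); apply: le_trans rateN.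
by rewrite ler_piMl.
Qed.

End deviation.

(** * Expectations *)

Section expected_growth.
Context {R : realType} {dT : measure_display} {T : measurableType dT}.
Variables (P : probability T R) (f df S : R -> T -> R) (g dg : R -> R).
Hypothesis mf : forall t, 0 <= t -> measurable_fun setT (f t).
Hypothesis fdf : forall w, sderiv (f ^~ w) (df ^~ w).
Hypothesis f0 : forall w, f 0 w = 0.
Hypothesis df_bounded : forall T : R, exists M : R,
  forall t w, 0 <= t <= T -> `|df t w| <= M.
Hypothesis dfS : forall t w, 0 < t -> df t w <= S t w.
Hypothesis Si : forall t, 0 < t -> P.-integrable setT (EFin \o S t).
Hypothesis gdg : sderiv g dg.
Hypothesis Sdg : forall t, 0 < t -> \int[P]_w S t w <= dg t.

Let df_bound (b : R) : exists2 M : R, 0 <= M &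
  forall t w, 0 <= t <= b -> `|df t w| <= M.
Proof.
have [M hM] := df_bounded b; exists `|M| => // t w tb.
exact: le_trans (hM t w tb) (ler_norm _).
Qed.

Let f_lip (b M : R) (hM : forall t w, 0 <= t <= b -> `|df t w| <= M) s t w :
  0 <= s -> s < t -> t <= b -> `|f t w - f s w| <= M * (t - s).
Proof.
move=> s0 st tb; have [c /andP[sc ct] ->] := sderiv_MVT (fdf w) s0 st.
rewrite normrM [X in _ * X <= _]gtr0_norm ?subr_gt0// ler_wpM2r ?subr_ge0 ?(ltW st)//.
by apply: hM; rewrite (le_trans s0 (ltW sc)) (le_trans (ltW ct)).
Qed.

Lemma bounded_rate_integrable t : 0 <= t -> P.-integrable setT (EFin \o f t).
Proof.
move=> t0; have [M M0 hM] := df_bound t.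
apply: (bounded_integrable P (B := M * t)) => [|w]; first exact: mf.
move: t0; rewrite le_eqVlt => /predU1P[<-|t0]; first by rewrite f0 normr0 mulr0.
by have := f_lip hM w (lexx 0) t0 (lexx t); rewrite f0 !subr0.
Qed.

Let partialE t w : 0 < t -> partial1of2 f t w = df t w.
Proof.
move=> t0; have [d1 _] := fdf w; have h := d1 _ t0.
by rewrite partial1of2E; exact: derive_val.
Qed.

(** The rate is the limit of difference quotients along the steps 1 / (n + 1), each of them
    measurable. *)
Let df_measurable t : 0 < t -> measurable_fun setT (df t).
Proof.
move=> t0; pose h n w : R := (@harmonic R n)^-1 * (f (harmonic n + t) w - f t w).
apply: (@measurable_fun_cvg _ _ _ _ h) => [n|w _].
  apply: measurable_funM => //; apply: measurable_funB; apply: mf; last exact: ltW.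
  by rewrite addr_ge0 ?(ltW t0)// harmonic_ge0.
have [d1 _] := fdf w; have hd := d1 _ t0.
have := @ex_derive _ _ _ _ _ _ _ hd => /cvg_ex[l hl].
have -> : df t w = l.
  have <- : 'D_1 (f ^~ w) t = df t w by exact: derive_val.
  exact/cvg_lim.
move/cvgr_dnbhsP : hl => /(_ harmonic) hl.
have -> : h ^~ w = (fun n => (harmonic n)^-1 *: (f (harmonic n *: 1 + t) w - f t w)).
  by apply/funext => n; rewrite /h scaler1.
apply: hl; split; last exact: cvg_harmonic.
by move=> n; rewrite gt_eqF// harmonic_gt0.
Qed.

Let df_integrable t : 0 < t -> P.-integrable setT (EFin \o df t).
Proof.
move=> t0; have [M M0 hM] := df_bound t.
apply: (bounded_integrable P (B := M)) => [|w]; first exact: df_measurable.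
by apply: hM; rewrite (ltW t0) lexx.
Qed.

(** At positive times the constant bound on the rate dominates and allows differentiation under the
    integral; at 0, where only continuity is asked, the same bound gives a Lipschitz estimate. *)
Let expectation_sderiv : sderiv (fun t => \int[P]_w f t w) (fun t => \int[P]_w df t w).
Proof.
split=> [t t0|].
  have [M M0 hM] := df_bound (t + 1).
  have It : `]0, (t + 1)%R[%classic t by rewrite /= in_itv/= t0 ltrDl ltr01.
  have I0 s : `]0, (t + 1)%R[%classic s -> 0 < s /\ 0 <= s <= t + 1.
    by rewrite /= in_itv/= => /andP[s0 st]; rewrite s0 !ltW.
  have intf s : `]0, (t + 1)%R[%classic s -> P.-integrable setT (EFin \o f s).
    by move=> /I0[s0 _]; apply: bounded_rate_integrable; exact: ltW.
  have dert s w : `]0, (t + 1)%R[%classic s -> setT w -> derivable (f ^~ w) s 1.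
    by move=> /I0[s0 _] _; have [d1 _] := fdf w; have h := d1 _ s0; exact: ex_derive.
  have intM : P.-integrable setT (EFin \o cst M).
    exact: finite_measure_integrable_cst.
  have ub s w : `]0, (t + 1)%R[%classic s -> setT w -> `|partial1of2 f s w| <= M.
    by move=> /I0[s0 sb] _; rewrite partialE//; exact: hM.
  apply: DeriveDef.
    exact: (derivable_under_integral measurableT It intf dert (G := cst M)).
  rewrite -derive1E (differentiation_under_integral measurableT It intf dert (G := cst M))//.
  by apply: eq_Rintegral => w _; exact: partialE.
apply/subspace_continuousP => t /= t0; apply/cvgrPdist_lt => e e0.
have [M M0 hM] := df_bound (t + 1).
have lip s r : 0 <= s -> s < r -> r <= t + 1 ->
    `|\int[P]_w f r w - \int[P]_w f s w| <= M * (r - s).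
  move=> s0 sr rt; have r0 := le_trans s0 (ltW sr).
  rewrite -RintegralB//; [|exact: bounded_rate_integrable|exact: bounded_rate_integrable].
  apply: (le_trans (le_normr_Rintegral _ _)) => //.
    by apply: rintegrableB; exact: bounded_rate_integrable.
  apply: Rintegral_le_ae; last by apply: aeW => w; exact: f_lip hM _ _ _ _ _ _.
  rewrite (_ : EFin \o _ = abse \o (EFin \o (fun w => f r w - f s w)))//.
  by apply: integrable_abse; apply: rintegrableB; exact: bounded_rate_integrable.
exists (Num.min 1 (e / (M + 1))) => /=.
  by rewrite lt_min ltr01 divr_gt0// ltr_wpDl.
move=> s /=; rewrite lt_min => /andP[st1 ste] s0.
have [l1 l2] : s <= t + 1 /\ t <= t + 1.
  by move: st1; rewrite ltr_norml => /andP[? ?]; split; lra.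
have key : `|\int[P]_w f t w - \int[P]_w f s w| <= M * `|t - s|.
  have [st|ts|->] := ltgtP s t.
  - by rewrite (gtr0_norm (_ : 0 < t - s)) ?subr_gt0//; exact: lip.
  - by rewrite distrC (distrC t) (gtr0_norm (_ : 0 < s - t)) ?subr_gt0//; exact: lip.
  - by rewrite !subrr normr0 mulr0.
apply: (le_lt_trans key).
move: ste; rewrite ltr_pdivlMr ?ltr_wpDl// => ste; apply: le_lt_trans ste.
by rewrite mulrC ler_wpM2l// lerDl.
Qed.

Lemma expectation_le_primitive t : 0 <= t -> \int[P]_w f t w <= g t - g 0.
Proof.
move=> t0; have h := sderivB expectation_sderiv gdg.
have /= := sderiv_le0 h _ (lexx 0) t0.
have -> : \int[P]_w f 0 w = 0.
  rewrite (_ : f 0 = cst 0) ?Rintegral_cst ?mul0r//.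
  by apply/funext => w; rewrite f0.
move=> H; suff : \int[P]_w f t w - g t <= 0 - g 0 by lra.
apply: H => s /andP[s0 _]; rewrite subr_le0 (le_trans _ (Sdg s0))//.
apply: le_Rintegral => //; [exact: df_integrable|exact: Si|].
by move=> w _; exact: dfS.
Qed.

End expected_growth.

Section sampling_variance.
Context {R : realType} {dO dT : measure_display} {Om : measurableType dO}
  {T : measurableType dT}.
Variables (P : probability Om R) (mu : probability T R) (J : nat)
  (Z : 'I_J -> Om -> T).
Hypothesis J0 : (1 <= J)%N.
Hypothesis mZ : forall j, measurable_fun setT (Z j).
Hypothesis indZ : mutually_independent P Z.
Hypothesis lawZ : forall j, has_law P (Z j) mu.
Variables (d : nat) (f : T * T -> 'rV[R]_d) (B : R).
Hypothesis mf : forall i, measurable_fun setT (fun z => f z ord0 i).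
Hypothesis fB : forall z, enorm (f z) <= B.
Hypothesis f0 : forall z i, \int[mu]_w f (z, w) ord0 i = 0.

Definition empirical_mean j w : 'rV[R]_d := J%:R^-1 *: \sum_k f (Z j w, Z k w).

Lemma measurable_empirical_mean j i :
  measurable_fun setT (fun w => empirical_mean j w ord0 i).
Proof.
rewrite (_ : (fun w => _) = fun w => J%:R^-1 * \sum_k f (Z j w, Z k w) ord0 i).
  apply: measurable_funM => //; apply: measurable_sum => k.
  by apply: (measurableT_comp (mf i)); exact: measurable_fun_pair.
by apply/funext => w; rewrite mxE summxE.
Qed.

Lemma enorm_empirical_mean j w : enorm (empirical_mean j w) <= B.
Proof.
rewrite enormZ ger0_norm ?invr_ge0//.
apply: (@le_trans _ _ (J%:R^-1 * \sum_(k < J) B)).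
  rewrite ler_wpM2l ?invr_ge0// (le_trans (enorm_sum _ _ _))//.
  by apply: ler_sum => k _; exact: fB.
by rewrite sum_cst mulKf ?natJ_neq0.
Qed.

Let sqE j w : dot (empirical_mean j w) (empirical_mean j w) =
  J%:R^-1 ^+ 2 * \sum_i (\sum_k f (Z j w, Z k w) ord0 i) ^+ 2.
Proof.
rewrite dotZl dotZr mulrA -expr2 /dot; congr (_ * _); apply: eq_bigr => i _.
by rewrite summxE expr2.
Qed.

(** By [second_moment_sum] in each coordinate only J squares survive, each at most B^2 after summing
    over coordinates; the prefactor is J^-2. *)
Lemma variance_empirical_mean_le j :
  \int[P]_w (dot (empirical_mean j w) (empirical_mean j w)) <= B ^+ 2 / J%:R.
Proof.
have fiB i z : `|f z ord0 i| <= B := le_trans (normr_coord_le _ _) (fB z).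
have mfk i k : measurable_fun setT (fun w => f (Z j w, Z k w) ord0 i).
  by apply: (measurableT_comp (mf i)); exact: measurable_fun_pair.
have fi2 i k : P.-integrable setT (EFin \o (fun w => f (Z j w, Z k w) ord0 i ^+ 2)).
  apply: (bounded_integrable P (B := B ^+ 2)) => [|w]; first exact: measurable_funX.
  by rewrite normrX ler_pXn2r ?nnegrE// (le_trans _ (fiB i (Z j w, Z k w))).
have si i : P.-integrable setT
    (EFin \o (fun w => (\sum_k f (Z j w, Z k w) ord0 i) ^+ 2)).
  apply: (bounded_integrable P (B := (\sum_(k < J) B) ^+ 2)) => [|w].
    by apply: measurable_funX; apply: measurable_sum.
  have h : `|\sum_k f (Z j w, Z k w) ord0 i| <= \sum_(k < J) B.
    by apply: (le_trans (ler_norm_sum _ _ _)); apply: ler_sum => k _; exact: fiB.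
  by rewrite normrX ler_pXn2r ?nnegrE// (le_trans _ h).
have -> : (fun w => dot (empirical_mean j w) (empirical_mean j w)) =
    (fun w => J%:R^-1 ^+ 2 * \sum_i (\sum_k f (Z j w, Z k w) ord0 i) ^+ 2).
  by apply/funext => w; exact: sqE.
rewrite RintegralZl//; last by apply: rintegrable_sum.
rewrite Rintegral_sum//.
under eq_bigr => i _ do rewrite (second_moment_sum mZ indZ lawZ j (mf i) (fiB i) (f0 ^~ i)).
rewrite exchange_big/=.
have h k : \sum_i \int[P]_w (f (Z j w, Z k w) ord0 i ^+ 2) <= B ^+ 2.
  rewrite -Rintegral_sum//; apply: Rintegral_le_ae; first exact: rintegrable_sum.
  apply: aeW => w.
  have -> : \sum_i f (Z j w, Z k w) ord0 i ^+ 2 =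
      dot (f (Z j w, Z k w)) (f (Z j w, Z k w)).
    by apply: eq_bigr => i _; rewrite expr2.
  rewrite -enorm_sqr ler_pXn2r ?nnegrE ?enorm_ge0//.
  exact: le_trans (enorm_ge0 _) (fB (Z j w, Z k w)).
apply: (@le_trans _ _ (J%:R^-1 ^+ 2 * \sum_(k < J) B ^+ 2)).
  by rewrite ler_wpM2l ?sqr_ge0//; apply: ler_sum => k _; exact: h.
rewrite sum_cst le_eqVlt; apply/orP; left; apply/eqP; field.
exact: natJ_neq0.
Qed.

End sampling_variance.

Section laws.
Context {R : realType} {dO dO' dT dU : measure_display} {Om : measurableType dO}
  {Om' : measurableType dO'} {T : measurableType dT} {U : measurableType dU}.

Lemma ae_eq_has_law (P : probability Om R) (mu : probability T R) (Z Z' : Om -> T) :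
  measurable_fun setT Z -> measurable_fun setT Z' ->
  {ae P, forall w, Z w = Z' w} -> has_law P Z mu -> has_law P Z' mu.
Proof.
move=> mZ mZ' [N [mN N0 hN]] lZ A mA; rewrite -lZ//.
have mp (f : Om -> T) : measurable_fun setT f -> measurable (f @^-1` A).
  by move=> mf; rewrite -[X in measurable X]setTI; exact: mf.
have le (f g : Om -> T) : measurable_fun setT f -> measurable_fun setT g ->
    (forall w, ~ N w -> f w = g w) ->
    (pushforward P f A <= pushforward P g A)%E.
  move=> mf mg fg; rewrite /pushforward.
  apply: (@le_trans _ _ (P (g @^-1` A `|` N))).
    apply: le_measure; rewrite ?inE; [exact: mp|by apply: measurableU => //; exact: mp|].
    move=> w /= fA; have [Nw|nN] := pselect (N w); [by right|left].
    by rewrite /= -fg.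
  have h : (P (g @^-1` A `|` N) <= P (g @^-1` A) + P N)%E.
    by apply: measureU2 => //; exact: mp.
  by apply: (le_trans h); rewrite [X in (_ + X)%E](_ : _ = 0%E) ?adde0.
have nN w : ~ N w -> Z w = Z' w.
  by move=> nw; apply: contrapT => ne; apply: nw; exact: hN.
by apply/eqP; rewrite eq_le !le// => w /nN.
Qed.

(** The law of an image depends only on the law of its argument. This moves the mean-field law from
    the space on which it is realized to the space of the particles. *)
Lemma has_law_image (P : probability Om R) (P' : probability Om' R)
    (mu : probability T R) (nu : probability U R) (Z : Om -> T) (Z' : Om' -> T)
    (F : T -> U) : measurable_fun setT F -> has_law P Z mu -> has_law P' Z' mu ->
  has_law P (fun w => F (Z w)) nu -> has_law P' (fun w => F (Z' w)) nu.
Proof.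
move=> mF lZ lZ' lF A mA; rewrite -lF//.
have mFA : measurable (F @^-1` A) by rewrite -[X in measurable X]setTI; exact: mF.
by have := lZ _ mFA; rewrite -(lZ' _ mFA) /pushforward.
Qed.

Lemma iid_image (P : probability Om R) (J : nat) (Z : 'I_J -> Om -> T) (F : T -> U) :
  measurable_fun setT F -> mutually_independent P Z ->
  mutually_independent P (fun j w => F (Z j w)).
Proof.
move=> mF ind S A mA; apply: (ind S (fun j => F @^-1` A j)) => j.
by rewrite -[X in measurable X]setTI; exact: mF.
Qed.

End laws.

(** * The truncated interaction and its centred kernel *)

Section clipped_kernel.
Context {R : realType} (L : R) (psi : R -> R) {d : nat}.
Hypothesis rate : communication_rate L psi.
Variables (mu : probability (phase R d) R) (del : R).
Hypothesis del0 : 0 <= del.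
Implicit Types z w : phase R d.

(* The truncation only serves to have a kernel bounded everywhere: by flocking it
   is inactive almost surely when del is the velocity diameter at time t. *)
Definition clipped (p : phase R d * phase R d) : 'rV[R]_d :=
  if enorm (interaction psi (p.1 - p.2)) <= del then interaction psi (p.1 - p.2) else 0.

Definition clipped_conv z : 'rV[R]_d := \row_i \int[mu]_w clipped (z, w) ord0 i.

Definition centered_kernel (p : phase R d * phase R d) : 'rV[R]_d :=
  clipped_conv p.1 - clipped p.

Lemma measurable_clipped : measurable_fun setT clipped.
Proof.
have mi : measurable_fun setT
    (fun p : phase R d * phase R d => interaction psi (p.1 - p.2)).
  apply: measurable_fun_rV => i; apply: (measurableT_comp (measurable_interaction rate i)).
  by apply: measurable_phaseB; [exact: measurable_fst|exact: measurable_snd].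
apply: measurable_fun_ifT => //; apply: measurable_fun_ler => //.
exact: measurable_enormT.
Qed.

Lemma enorm_clipped p : enorm (clipped p) <= del.
Proof.
rewrite /clipped; case: ifP => // _.
by rewrite -(scale0r (0 : 'rV[R]_d)) enormZ normr0 mul0r.
Qed.

Let clipped_le p i : `|clipped p ord0 i| <= del.
Proof. exact: le_trans (normr_coord_le _ _) (enorm_clipped p). Qed.

Let mclipped i : measurable_fun setT (fun p => clipped p ord0 i).
Proof. by apply: measurable_coordT; exact: measurable_clipped. Qed.

Lemma integrable_clipped z i :
  mu.-integrable setT (EFin \o (fun w => clipped (z, w) ord0 i)).
Proof.
apply: (bounded_integrable mu (B := del)) => [|w]; last exact: clipped_le.
by apply: (measurableT_comp (mclipped i)); exact: measurable_pair1.
Qed.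

Lemma measurable_clipped_conv : measurable_fun setT clipped_conv.
Proof.
apply: measurable_fun_rV => i.
have pi : (mu \x mu)%E.-integrable setT (EFin \o (fun p => clipped p ord0 i)).
  exact: (bounded_integrable (mu \x mu)%E (mclipped i) (clipped_le ^~ i)).
have := measurable_fubini_F pi; rewrite /fubini_F => h.
rewrite (_ : (fun z => _) = fine \o (fun x => \int[mu]_y (clipped (x, y) ord0 i)%:E)%E).
  exact: (measurableT_comp _ h).
by apply/funext => z; rewrite mxE.
Qed.

Lemma enorm_clipped_conv z : enorm (clipped_conv z) <= del.
Proof.
apply: enorm_le_dual => // e.
have ii i := integrable_clipped z i.
have -> : dot e (clipped_conv z) = \int[mu]_w dot e (clipped (z, w)).
  rewrite /dot Rintegral_sum; last by move=> i; exact: rintegrableZ.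
  by apply: eq_bigr => i _; rewrite mxE RintegralZl.
apply: Rintegral_le_ae; first by apply: rintegrable_sum => i; exact: rintegrableZ.
apply: aeW => w; apply: (le_trans (dot_le _ _)).
by rewrite ler_wpM2l ?enorm_ge0// enorm_clipped.
Qed.

Lemma measurable_centered_kernel i :
  measurable_fun setT (fun p => centered_kernel p ord0 i).
Proof.
apply: measurable_coordT; apply: measurable_rVB; last exact: measurable_clipped.
by apply: (measurableT_comp measurable_clipped_conv); exact: measurable_fst.
Qed.

Lemma enorm_centered_kernel p : enorm (centered_kernel p) <= 2 * del.
Proof.
rewrite (le_trans (enormB _ _))// mulr_natl mulr2n lerD//.
  exact: enorm_clipped_conv.
exact: enorm_clipped.
Qed.

Lemma Rintegral_centered_kernel z i : \int[mu]_w centered_kernel (z, w) ord0 i = 0.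
Proof.
rewrite (_ : (fun w => _) =
    fun w => cst (clipped_conv z ord0 i) w - clipped (z, w) ord0 i); last first.
  by apply/funext => w; rewrite !mxE.
rewrite RintegralB//; [|exact: finite_measure_integrable_cst|exact: integrable_clipped].
rewrite Rintegral_cst// [X in _ * fine X](@probability_setT _ _ _ mu) mulr1.
by rewrite mxE subrr.
Qed.

Lemma enorm_interaction z : enorm (interaction psi z) <= enorm z.2.
Proof.
rewrite enormZ ger0_norm ?(ltW (rate_gt0 rate (enorm_ge0 _)))//.
by rewrite ler_piMl ?enorm_ge0// (rate_le1 rate) ?enorm_ge0.
Qed.

Lemma clippedE z w : enorm (z.2 - w.2) <= del -> clipped (z, w) = interaction psi (z - w).
Proof. by move=> h; rewrite /clipped ifT//= (le_trans (enorm_interaction _)). Qed.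

Lemma clipped_convE z : mu.-integrable setT (fun w : phase R d => (enorm w.2)%:E) ->
  {ae mu, forall w, enorm (z.2 - w.2) <= del} ->
  interaction_conv psi mu z = clipped_conv z.
Proof.
move=> mu1 h; apply/rowP => i; rewrite !mxE /Rintegral; congr fine.
apply: ae_eq_integral => //.
- by have /integrableP[] := integrable_interaction rate mu1 z i.
- by have /integrableP[] := integrable_clipped z i.
- by apply: filterS h => w hw _; rewrite clippedE.
Qed.

End clipped_kernel.

Definition growth_factor (R : realType) (L : R) (psi : R -> R) (K D Dinf : R) : R :=
  expR (8 * growth_const L psi K D Dinf / (K * psi Dinf)).

(** 96 = 12 * 2 * 4: the error coefficient of the Lyapunov functional, the own and the mean error,
    and the square of twice the velocity diameter. Integrating exp (- lam t / 8) contributes 8 /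
    lam, and 768 = 8 * 96. *)
Definition chaos_variance (R : realType) (L : R) (psi : R -> R) (K D Dinf : R) : R :=
  growth_factor L psi K D Dinf * (768 * K ^+ 2 * D ^+ 2 / (K * psi Dinf) ^+ 2).

(** * The expected deviation of the coupled systems *)

Section propagation_of_chaos.
Context {R : realType} (L : R) (psi : R -> R) {d : nat}.
Hypothesis rate : communication_rate L psi.
Context (K : R) (rho0 : probability (phase R d) R)
  (rho : R -> probability (phase R d) R).
Hypothesis K0 : 0 < K.
Hypothesis compS : compact (msupport rho0).
Hypothesis mf_law : mean_field_law K psi rho0 rho.
Variable Dinf : R.
Let DX := diameterX rho0.
Let DV := diameterV rho0.
Hypothesis Dinf_ge : DX <= Dinf.
Hypothesis DinfP : DV < K * (potential psi DX Dinf - potential psi DX DX).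
Context {J : nat} {dO : measure_display} {Om : measurableType dO}
  {P : probability Om R} (x0 v0 : 'I_J -> {RV P >-> 'rV[R]_d})
  (X V Xbar Vbar : 'I_J -> R -> {RV P >-> 'rV[R]_d}).
Hypothesis J0 : (1 <= J)%N.
Hypothesis ini_iid : iid P (fun j w => (x0 j w, v0 j w)) rho0.
Hypothesis cs : {ae P, forall w, cucker_smale K psi (x0 ^~ w) (v0 ^~ w)
  (fun j t => X j t w) (fun j t => V j t w)}.
Hypothesis mf : {ae P, forall w, forall j,
  [/\ Xbar j 0 w = x0 j w, Vbar j 0 w = v0 j w &
      mean_field_ode K psi rho (Xbar j ^~ w) (Vbar j ^~ w)]}.

Let lam := K * psi Dinf.
Let del t := DV * expR (- lam * t).

Let DX0 : 0 <= DX := diameterX_ge0 compS.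
Let DV0 : 0 <= DV := diameterV_ge0 compS.
Let Dinf0 : 0 <= Dinf := le_trans DX0 Dinf_ge.

Let lam0 : 0 < lam.
Proof. by rewrite mulr_gt0// (rate_gt0 rate). Qed.

Let del0 t : 0 <= del t.
Proof. by rewrite mulr_ge0// expR_ge0. Qed.

Let del_le t : 0 <= t -> del t <= DV.
Proof.
move=> t0; rewrite ler_piMr// -[leRHS]expR0 ler_expR mulNr oppr_le0.
by rewrite mulr_ge0// ltW.
Qed.

Let moments : forall T : R, exists M : R, forall t, 0 <= t <= T ->
  (\int[rho t]_z (enorm z.2)%:E <= M%:E)%E.
Proof. by have [] := mf_law. Qed.

Local Notation sol := (mf_sol psi K rho0 rho).

Let flock t (a b : sol) : 0 <= t ->
  enorm ((sval a).1 t - (sval b).1 t) <= Dinf /\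
  enorm ((sval a).2 t - (sval b).2 t) <= del t.
Proof.
have [mo [dO' [Om' [P' [X' [V' [l0 lt o]]]]]]] := mf_law.
exact: (mf_flocking rate K0 compS mo l0 lt o Dinf_ge DinfP).
Qed.

Let conv_clipped t (a : sol) : 0 <= t ->
  interaction_conv psi (rho t) ((sval a).1 t, (sval a).2 t) =
  clipped_conv psi (rho t) (del t) ((sval a).1 t, (sval a).2 t).
Proof.
have [mo [dO' [Om' [P' [X' [V' [l0 lt o]]]]]]] := mf_law.
move=> t0; apply: (clipped_convE rate (del0 t)); first exact: (integrable_rho_velocity mo t0).
have := mf_flocking_rho rate K0 compS mo l0 lt o Dinf_ge DinfP a t0.
by apply: filterS => w [].
Qed.

(** On the space realizing the mean-field law, the state at time t is almost surely the flow applied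
    to the initial state. The flow depends on the set of solutions alone, so the same map applied to
    the given initial data has law [rho t]. *)
Let exists_flow : exists F : R -> phase R d -> phase R d, forall t, 0 <= t ->
  [/\ measurable_fun setT (F t),
      forall a : sol, F t ((sval a).1 0, (sval a).2 0) = ((sval a).1 t, (sval a).2 t) &
      forall j, has_law P (fun w => F t (x0 j w, v0 j w)) (rho t)].
Proof.
have [mo [dO' [Om' [P' [X' [V' [l0 lt o]]]]]]] := mf_law.
suff /choice[F hF] : forall t, exists Ft : phase R d -> phase R d, 0 <= t ->
  [/\ measurable_fun setT Ft,
      forall a : sol, Ft ((sval a).1 0, (sval a).2 0) = ((sval a).1 t, (sval a).2 t) &
      forall j, has_law P (fun w => Ft (x0 j w, v0 j w)) (rho t)].
  by exists F.
(* Nothing is required at negative times; [id] is a default. *)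
move=> t; have [t0|t0] := leP 0 t; last by exists id.
have [Ft mFt FtE] := mf_flow_map rate K0 compS mo l0 lt o Dinf_ge DinfP t0.
exists Ft => _; split => //.
move=> j; have [_ lj] := ini_iid.
apply: (has_law_image mFt l0 (lj j)).
apply: ae_eq_has_law (lt t t0); first by apply: measurable_fun_pair.
  by apply: (measurableT_comp mFt); exact: measurable_fun_pair.
apply: filterS (ae_mf_sol l0 o) => w [a ea].
by have := FtE a; rewrite ea.
Qed.

(** All almost sure properties in one condition on the sample that does not mention time, so that
    pathwise estimates hold at all times off a single null set. *)
Let good w := [/\ cucker_smale K psi (x0 ^~ w) (v0 ^~ w)
    (fun j t => X j t w) (fun j t => V j t w),
  forall j, Xbar j 0 w = x0 j w /\ Vbar j 0 w = v0 j w,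
  forall j, msupport rho0 (x0 j w, v0 j w) &
  forall j, exists a : sol, sval a = (Xbar j ^~ w, Vbar j ^~ w)].

Let ae_good : {ae P, forall w, good w}.
Proof.
have supp j : {ae P, forall w, msupport rho0 (x0 j w, v0 j w)}.
  have [_ lj] := ini_iid; apply: has_law_ae (lj j) (ae_msupport rho0).
  exact: measurable_fun_pair.
have {}supp : {ae P, forall w, forall j, msupport rho0 (x0 j w, v0 j w)}.
  by apply: filter_forall => j; exact: supp.
apply: filterS3 cs mf supp => w c m s; split => // j.
  by have [] := m j.
have [ex ev o] := m j.
have sj : msupport rho0 (Xbar j 0 w, Vbar j 0 w) by rewrite ex ev; exact: s.
by exists (exist _ (Xbar j ^~ w, Vbar j ^~ w) (conj o sj)).
Qed.

Let sampleX w j t := X j t w.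
Let sampleV w j t := V j t w.
Let sampleXbar w j t := Xbar j t w.
Let sampleVbar w j t := Vbar j t w.
Let field w j t := interaction_conv psi (rho t) (Xbar j t w, Vbar j t w).

Let flock_particles w : good w -> forall t j k, 0 <= t ->
  enorm (sampleX w j t - sampleX w k t) <= Dinf /\
  enorm (sampleV w j t - sampleV w k t) <= del t.
Proof.
move=> [c _ s _] t j k t0; apply: (cs_flocking rate J0 K0 c DX0 _ _ Dinf_ge DinfP) => // j' k'.
  exact: (diameterX_ub compS (s j') (s k')).
exact: (diameterV_ub compS (s j') (s k')).
Qed.

Let flock_mean_field w : good w -> forall t j k, 0 <= t ->
  enorm (sampleXbar w j t - sampleXbar w k t) <= Dinf /\
  enorm (sampleVbar w j t - sampleVbar w k t) <= del t.
Proof.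
move=> [_ _ _ m] t j k t0; have [a ea] := m j; have [b eb] := m k.
by have := flock a b t0; rewrite ea eb.
Qed.

Let sample_derivative w : good w -> forall j,
  has_derivative (sampleXbar w j) (sampleVbar w j) /\
  has_derivative (sampleVbar w j) (fun t => - K *: field w j t).
Proof.
move=> [_ _ _ m] j; have [a ea] := m j; have [[h1 h2] _] := svalP a.
by rewrite ea in h1 h2.
Qed.

Let field_clipped w : good w -> forall t j, 0 <= t ->
  field w j t = clipped_conv psi (rho t) (del t) (Xbar j t w, Vbar j t w).
Proof.
move=> [_ _ _ m] t j t0; have [a ea] := m j.
by have := conv_clipped a t0; rewrite ea.
Qed.

Let field_bound w : good w -> forall t j, 0 <= t -> enorm (field w j t) <= DV.
Proof.
move=> gw t j t0; rewrite field_clipped//; apply: le_trans (del_le t0).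
exact: (enorm_clipped_conv rate).
Qed.

Local Notation growth := (growth_factor L psi K DV Dinf).
Local Notation variance := (chaos_variance L psi K DV Dinf).

Section flow.
Variable F : R -> phase R d -> phase R d.
Hypothesis hF : forall t, 0 <= t ->
  [/\ measurable_fun setT (F t),
      forall a : sol, F t ((sval a).1 0, (sval a).2 0) = ((sval a).1 t, (sval a).2 t) &
      forall j, has_law P (fun w => F t (x0 j w, v0 j w)) (rho t)].

Let Zt t j w := F t (x0 j w, v0 j w).

Let ZtE w : good w -> forall t j, 0 <= t -> Zt t j w = (Xbar j t w, Vbar j t w).
Proof.
move=> [_ i _ m] t j t0; have [a ea] := m j; have [_ h _] := hF t0.
by have := h a; rewrite ea/= /Zt; have [-> ->] := i j.
Qed.

Let error t j w := empirical_mean (Zt t) (centered_kernel psi (rho t) (del t)) j w.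

(** Flocking makes the truncation inactive along good samples, and the mean-field states are images
    of the initial data under the flow. The error is thus an empirical mean of a bounded centred
    kernel over independent variables. *)
Let sampling_errorE w : good w -> forall t j, 0 <= t ->
  sampling_error psi (sampleXbar w) (sampleVbar w) (field w) j t = error t j w.
Proof.
move=> gw t j t0; rewrite /error /empirical_mean /sampling_error.
have -> : \sum_k centered_kernel psi (rho t) (del t) (Zt t j w, Zt t k w) =
    J%:R *: field w j t - \sum_k psi (enorm (sampleXbar w j t - sampleXbar w k t)) *:
      (sampleVbar w j t - sampleVbar w k t).
  rewrite (_ : J%:R *: field w j t = \sum_(k < J) field w j t); last first.
    by rewrite sumr_const card_ord scaler_nat.
  rewrite -sumrB; apply: eq_bigr => k _; rewrite /centered_kernel/= !ZtE//.
  rewrite -field_clipped// (clippedE rate)//=.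
  by have [_] := flock_mean_field gw j k t0.
by rewrite scalerBr scalerA mulVf ?natJ_neq0// scale1r.
Qed.

Let mZt t j : 0 <= t -> measurable_fun setT (Zt t j).
Proof.
move=> t0; have [mF _ _] := hF t0.
by apply: (measurableT_comp mF); exact: measurable_fun_pair.
Qed.

Let indZt t : 0 <= t -> mutually_independent P (Zt t).
Proof.
move=> t0; have [mF _ _] := hF t0; have [ind _] := ini_iid.
exact: (iid_image mF ind).
Qed.

Let lawZt t j : 0 <= t -> has_law P (Zt t j) (rho t).
Proof. by move=> t0; have [_ _ h] := hF t0; exact: h. Qed.

Let errsq t j w := dot (error t j w) (error t j w).

Let errsq_integrable t j : 0 <= t -> P.-integrable setT (EFin \o errsq t j).
Proof.
move=> t0; have eB w : enorm (error t j w) <= 2 * del t.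
  apply: (enorm_empirical_mean _ J0) => p.
  exact: (enorm_centered_kernel rate).
apply: (bounded_integrable P (B := (2 * del t) ^+ 2)) => [|w].
  apply: measurable_sum => i; apply: measurable_funM;
    apply: measurable_empirical_mean => [k|i']; do ?exact: mZt;
    exact: (measurable_centered_kernel rate).
rewrite /errsq ger0_norm ?dotxx_ge0// -enorm_sqr ler_pXn2r ?nnegrE ?enorm_ge0//.
by rewrite mulr_ge0.
Qed.

Let errsq_le t j : 0 <= t -> \int[P]_w errsq t j w <= (2 * del t) ^+ 2 / J%:R.
Proof.
move=> t0; apply: (variance_empirical_mean_le J0 _ (indZt t0)).
- by move=> k; exact: mZt.
- by move=> k; exact: lawZt.
- by move=> i; exact: (measurable_centered_kernel rate).
- by move=> p; exact: (enorm_centered_kernel rate).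
- by move=> z i; exact: (Rintegral_centered_kernel rate).
Qed.

Let measurable_recentered (f : 'I_J -> {RV P >-> 'rV[R]_d}) j :
  measurable_fun setT (fun w => recenter (fun i => f i w) j).
Proof.
apply: measurable_rVB; first exact: measurable_funPT.
by apply: measurable_rVZ; apply: measurable_rV_sum => i; exact: measurable_funPT.
Qed.

Let dX t k w := devX (sampleX w) (sampleXbar w) k t.
Let dV t k w := devV (sampleV w) (sampleVbar w) k t.

Let mdX t k : measurable_fun setT (fun w => dot (dX t k w) (dX t k w)).
Proof.
rewrite (_ : (fun w => _) = fun w => enorm (dX t k w) ^+ 2).
  apply: measurable_funX; apply: measurable_enormT; apply: measurable_rVB.
    exact: (measurable_recentered (X ^~ t)).
  exact: (measurable_recentered (Xbar ^~ t)).
by apply/funext => w; rewrite enorm_sqr.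
Qed.

Let mdV t k : measurable_fun setT (fun w => dot (dV t k w) (dV t k w)).
Proof.
rewrite (_ : (fun w => _) = fun w => enorm (dV t k w) ^+ 2).
  apply: measurable_funX; apply: measurable_enormT; apply: measurable_rVB.
    exact: (measurable_recentered (V ^~ t)).
  exact: (measurable_recentered (Vbar ^~ t)).
by apply/funext => w; rewrite enorm_sqr.
Qed.

Let ly j t w := damped L psi K (sampleX w) (sampleV w) (sampleXbar w) (sampleVbar w)
  DV Dinf j t.
Let dly j t w := damped_rate L psi K (sampleX w) (sampleV w) (sampleXbar w)
  (sampleVbar w) (field w) DV Dinf j t.

Let mly j t : measurable_fun setT (ly j t).
Proof.
apply: measurable_funM => //; apply: measurable_funD.
  by apply: measurable_funD; [exact: mdX|apply: measurable_funM => //; exact: mdV].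
apply: measurable_funM => //; apply: measurable_funD.
  by apply: measurable_sum => k; exact: mdX.
by apply: measurable_funM => //; apply: measurable_sum => k; exact: mdV.
Qed.

Let dev_le w j t : good w -> 0 <= t ->
  dot (dX t j w) (dX t j w) + dot (dV t j w) (dV t j w) <= growth * ly j t w.
Proof.
by move=> gw t0; exact: (damped_ge rate _ _ _ _ K0 DV0 Dinf0 j t0).
Qed.

Let S j t w := 12 * (K ^+ 2 / lam) * expR (lam / 2 * t) *
  (errsq t j w + J%:R^-1 * \sum_k errsq t k w).

Let S_ge0 j t w : 0 <= S j t w.
Proof.
rewrite !mulr_ge0 ?sqr_ge0 ?invr_ge0 ?(ltW lam0) ?(ltW K0) ?expR_ge0//.
rewrite addr_ge0 ?dotxx_ge0// mulr_ge0 ?invr_ge0// sumr_ge0// => k _; exact: dotxx_ge0.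
Qed.

Let S_integrable j t : 0 <= t -> P.-integrable setT (EFin \o S j t).
Proof.
move=> t0; apply: rintegrableZ; apply: rintegrableD; first exact: errsq_integrable.
by apply: rintegrableZ; apply: rintegrable_sum => k; exact: errsq_integrable.
Qed.

Let S_le j t : 0 <= t -> \int[P]_w S j t w <=
  96 * K ^+ 2 * DV ^+ 2 / lam / J%:R * expR (- lam / 8 * t).
Proof.
move=> t0; have ei k := errsq_integrable k t0.
rewrite RintegralZl//; last first.
  by apply: rintegrableD => //; apply: rintegrableZ; exact: rintegrable_sum.
rewrite RintegralD//; last by apply: rintegrableZ; exact: rintegrable_sum.
rewrite RintegralZl//; last exact: rintegrable_sum.
rewrite Rintegral_sum//.
set e := (2 * del t) ^+ 2 / J%:R.
have h : J%:R^-1 * \sum_k \int[P]_w errsq t k w <= e.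
  apply: (@le_trans _ _ (J%:R^-1 * \sum_(k < J) e)).
    by rewrite ler_wpM2l ?invr_ge0//; apply: ler_sum => k _; exact: errsq_le.
  by rewrite sum_cst mulKf ?natJ_neq0.
have c0 : 0 <= 12 * (K ^+ 2 / lam) * expR (lam / 2 * t).
  by rewrite !mulr_ge0 ?sqr_ge0 ?invr_ge0 ?(ltW lam0) ?(ltW K0) ?expR_ge0.
apply: (le_trans (ler_wpM2l c0 (lerD (errsq_le j t0) h))).
have -> : 12 * (K ^+ 2 / lam) * expR (lam / 2 * t) * (e + e) =
    96 * K ^+ 2 * DV ^+ 2 / lam / J%:R * (expR (lam / 2 * t) * expR (- lam * t) ^+ 2).
  by rewrite /e /del; field; rewrite natJ_neq0// gt_eqF.
apply: ler_wpM2l.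
  by rewrite !mulr_ge0 ?sqr_ge0 ?invr_ge0 ?(ltW lam0) ?(ltW K0).
rewrite -expRM_natl -expRD ler_expR.
by have := mulr_ge0 (ltW lam0) t0; lra.
Qed.

Lemma expected_deviation_flow j t : 0 <= t ->
  ('E_P[fun w => (enorm (recenter (fun i => X i t w) j -
                  recenter (fun i => Xbar i t w) j) ^+ 2 +
           enorm (recenter (fun i => V i t w) j -
                  recenter (fun i => Vbar i t w) j) ^+ 2)%R]
   <= (variance / J%:R)%:E)%E.
Proof.
move=> t0; have [N [mN N0 hN]] := ae_good.
have goodN w : ~ N w -> good w by move=> nN; apply: contrapT => ng; exact/nN/hN.
(* Cutting off on the measurable null set N makes the hypotheses on growth hold for every sample,
   not only almost surely. *)
pose f s w := \1_(~` N) w * ly j s w; pose df s w := \1_(~` N) w * dly j s w.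
have indN w : N w -> \1_(~` N) w = 0 :> R.
  by move=> Nw; rewrite indicE memNset//=; apply.
have indG w : ~ N w -> \1_(~` N) w = 1 :> R.
  by move=> Nw; rewrite indicE mem_set.
pose c := 96 * K ^+ 2 * DV ^+ 2 / lam / J%:R.
have c0 : 0 <= c by rewrite !mulr_ge0 ?sqr_ge0 ?invr_ge0 ?(ltW lam0) ?(ltW K0).
(* A primitive of the bound on the expected errors; its total increase is at most 8 / lam times
   c. *)
pose g s := - (8 / lam * c) * expR (- lam / 8 * s).
have mfs s : 0 <= s -> measurable_fun setT (f s).
  move=> _; apply: measurable_funM; last exact: mly.
  by apply: measurable_indic; exact: measurableC.
have fdf w : sderiv (f ^~ w) (df ^~ w).
  have [Nw|/[dup] Nw /goodN gw] := pselect (N w).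
    by apply: sderiv_ext (sderiv_cst 0) _ _ => s *; rewrite /f /df indN// mul0r.
  have [c' i _ _] := gw; have sd := sample_derivative gw.
  apply: sderivZ; apply: (damped_sderiv rate J0 K0 c') => // k.
    by have [] := sd k.
  by have [] := sd k.
have f0 w : f 0 w = 0.
  have [Nw|/[dup] Nw /goodN gw] := pselect (N w); first by rewrite /f indN// mul0r.
  have [c' i _ _] := gw; rewrite /f /ly (damped0 L c') ?mulr0// => k.
    by have [] := i k.
  by have [] := i k.
have df_bounded (b : R) : exists M : R, forall s w, 0 <= s <= b -> `|df s w| <= M.
  exists `|damped_rate_bound L psi K DV Dinf b| => s w sb.
  have [Nw|/[dup] Nw /goodN gw] := pselect (N w).
    by rewrite /df indN// mul0r normr0.
  rewrite /df indG// mul1r.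
  apply: (le_trans (damped_rate_bounded rate J0 K0 DV0 Dinf0
    (flock_particles gw) (flock_mean_field gw) (field_bound gw) j sb)).
  exact: ler_norm.
have dfS s w : 0 < s -> df s w <= S j s w.
  move=> /ltW s0; have [Nw|/[dup] Nw /goodN gw] := pselect (N w).
    by rewrite /df indN// mul0r.
  rewrite /df indG// mul1r.
  have := damped_rate_le rate J0 (field w) K0 DV0 Dinf0
    (flock_particles gw) (flock_mean_field gw) j s0.
  rewrite /= sampling_errorE//; under eq_bigr do rewrite sampling_errorE//.
  exact.
have Si s : 0 < s -> P.-integrable setT (EFin \o S j s).
  by move=> /ltW; exact: S_integrable.
have gdg : sderiv g (fun s => c * expR (- lam / 8 * s)).
  apply: sderiv_ext (sderivZ _ (sderiv_expRM _)) _ _ => // s _.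
  by field; rewrite gt_eqF.
have Sdg s : 0 < s -> \int[P]_w S j s w <= c * expR (- lam / 8 * s).
  by move=> /ltW; exact: S_le.
have main := expectation_le_primitive mfs fdf f0 df_bounded dfS Si gdg Sdg t0.
have fi := bounded_rate_integrable P mfs fdf f0 df_bounded t0.
have fle : \int[P]_w f t w <= 8 / lam * c.
  apply: (le_trans main); rewrite /g mulr0 expR0.
  have h1 : 0 <= 8 / lam * c by rewrite mulr_ge0// divr_ge0// ltW.
  by have := mulr_ge0 h1 (expR_ge0 (- lam / 8 * t)); lra.
have Gf0 : 0 <= growth by exact: expR_ge0.
have dev_ge0 w : 0 <= dot (dX t j w) (dX t j w) + dot (dV t j w) (dV t j w).
  by rewrite addr_ge0// dotxx_ge0.
rewrite unlock.
under eq_integral do rewrite !enorm_sqr.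
apply: (@le_trans _ _ (\int[P]_w (growth * f t w)%:E)%E).
  apply: ae_ge0_le_integral => //.
  - by move=> w _; rewrite lee_fin; exact: (dev_ge0 w).
  - by apply/measurable_EFinP; apply: measurable_funD; [exact: mdX|exact: mdV].
  - move=> w _; rewrite lee_fin mulr_ge0//.
    have [Nw|/[dup] Nw /goodN gw] := pselect (N w); first by rewrite /f indN// mul0r.
    rewrite /f indG// mul1r -(pmulr_rge0 _ (expR_gt0 (8 * growth_const L psi K DV Dinf / lam))).
    exact: le_trans (dev_ge0 w) (dev_le j gw t0).
  - by apply/measurable_EFinP; apply: measurable_funM => //; exact: mfs.
  - exists N; split => // w /=; apply: contra_notP => Nw _.
    by rewrite lee_fin /f indG// mul1r; apply: dev_le => //; exact: goodN.
have Gfi : P.-integrable setT (EFin \o (fun w => growth * f t w)).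
  exact: rintegrableZ.
rewrite -[leLHS]fineK ?lee_fin; last exact: integrable_fin_num.
rewrite -/(Rintegral P setT (fun w => growth * f t w)) RintegralZl//.
rewrite /chaos_variance -/lam -mulrA ler_wpM2l// (le_trans fle)// /c.
by rewrite le_eqVlt; apply/orP; left; apply/eqP; field; rewrite natJ_neq0// gt_eqF.
Qed.

Lemma has_law_sample_flow t : 0 <= t ->
  has_law P (fun w => [tuple (Xbar j t w, Vbar j t w) | j < J]) (tensor_power (rho t) J).
Proof.
move=> t0; have mt (f : 'I_J -> Om -> phase R d) : (forall j, measurable_fun setT (f j)) ->
    measurable_fun setT (fun w => [tuple f j w | j < J]).
  move=> mf'; apply/measurable_fun_tnthP => j.
  by rewrite (_ : _ \o _ = f j)//; apply/funext => w /=; rewrite tnth_mktuple.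
apply: ae_eq_has_law (has_law_tuple (fun j => mZt j t0) (indZt t0) (fun j => lawZt j t0)).
- by apply: mt => j; exact: mZt.
- by apply: mt => j; apply: measurable_fun_pair; exact: measurable_funPT.
- apply: filterS ae_good => w gw; apply: eq_from_tnth => j.
  by rewrite !tnth_mktuple; exact: ZtE.
Qed.

End flow.

Lemma expected_deviation j t : 0 <= t ->
  ('E_P[fun w => (enorm (recenter (fun i => X i t w) j -
                  recenter (fun i => Xbar i t w) j) ^+ 2 +
           enorm (recenter (fun i => V i t w) j -
                  recenter (fun i => Vbar i t w) j) ^+ 2)%R]
   <= (variance / J%:R)%:E)%E.
Proof. by have [F hF] := exists_flow; exact: expected_deviation_flow hF j t. Qed.

Lemma has_law_sample t : 0 <= t ->
  has_law P (fun w => [tuple (Xbar j t w, Vbar j t w) | j < J]) (tensor_power (rho t) J).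
Proof. by have [F hF] := exists_flow; exact: has_law_sample_flow hF t. Qed.

End propagation_of_chaos.

(** * Transport of the recentered laws *)

Section recentered_transport.
Context {R : realType} {d J : nat}.
Hypothesis J0 : (1 <= J)%N.
Implicit Types z w : J.-tuple (phase R d).

Lemma fst_recenter (f : 'I_J -> phase R d) j :
  (recenter f j).1 = recenter (fun i => (f i).1) j.
Proof. by rewrite /recenter /= raddf_sum. Qed.

Lemma snd_recenter (f : 'I_J -> phase R d) j :
  (recenter f j).2 = recenter (fun i => (f i).2) j.
Proof. by rewrite /recenter /= raddf_sum. Qed.

Lemma measurable_recenter_tuple : measurable_fun setT (@recenter_tuple R d J).
Proof.
have m1 (i : 'I_J) : measurable_fun setT (fun z : J.-tuple (phase R d) => (tnth z i).1).
  by apply: (measurableT_comp measurable_fst); exact: measurable_tnth.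
have m2 (i : 'I_J) : measurable_fun setT (fun z : J.-tuple (phase R d) => (tnth z i).2).
  by apply: (measurableT_comp measurable_snd); exact: measurable_tnth.
have mr (f : 'I_J -> J.-tuple (phase R d) -> 'rV[R]_d) j :
    (forall i, measurable_fun setT (f i)) ->
    measurable_fun setT (fun z => recenter (fun i => f i z) j).
  move=> mf; apply: measurable_rVB => //.
  by apply: measurable_rVZ; exact: measurable_rV_sum.
apply/measurable_fun_tnthP => j.
rewrite (_ : _ \o _ = fun z => (recenter (fun i => (tnth z i).1) j,
                              recenter (fun i => (tnth z i).2) j)).
  by apply: measurable_fun_pair; exact: mr.
by apply/funext => z; rewrite /= tnth_mktuple -fst_recenter -snd_recenter -surjective_pairing.
Qed.

Lemma normalized_dist_sqr z w : normalized_dist z w ^+ 2 =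
  J%:R^-1 ^+ 2 * \sum_(j < J) (enorm ((tnth z j).1 - (tnth w j).1) ^+ 2 +
                              enorm ((tnth z j).2 - (tnth w j).2) ^+ 2).
Proof.
have pE (x : phase R d) : phase_norm x ^+ 2 = enorm x.1 ^+ 2 + enorm x.2 ^+ 2.
  by rewrite sqr_sqrtr// addr_ge0 ?sqr_ge0.
rewrite exprMn sqr_sqrtr; last by apply: sumr_ge0 => j _; rewrite sqr_ge0.
by congr (_ * _); apply: eq_bigr => j _; rewrite pE.
Qed.

Context {dO : measure_display} {Om : measurableType dO} (P : probability Om R).

(** The joint law of the two recentred samples is an admissible coupling, so its cost bounds the
    infimum. *)
Lemma wasserstein2_recentered_le (Z W : Om -> J.-tuple (phase R d))
    (nu : probability (J.-tuple (phase R d)) R) (c : \bar R) :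
  measurable_fun setT Z -> measurable_fun setT W -> has_law P W nu ->
  (\int[P]_w (normalized_dist (recenter_tuple (Z w)) (recenter_tuple (W w)) ^+ 2)%:E
    <= c)%E ->
  (wasserstein2 (@normalized_dist R d J) (recenter_law (pushforward P Z))
    (recenter_law nu) <= poweR c 2^-1)%E.
Proof.
move=> mZ mW lW hc.
pose T x := (recenter_tuple (Z x), recenter_tuple (W x)).
have mT : measurable_fun setT T.
  apply: measurable_fun_pair; apply: (measurableT_comp measurable_recenter_tuple) => //.
pose T' : {RV P >-> (J.-tuple (phase R d) * J.-tuple (phase R d))%type} :=
  HB.pack T (isMeasurableFun.Build _ _ _ _ _ mT).
have md : measurable_fun setT (fun p : J.-tuple (phase R d) * J.-tuple (phase R d) =>
    (normalized_dist p.1 p.2 ^+ 2)%:E).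
  apply/measurable_EFinP; rewrite (_ : (fun p => _) = fun p => J%:R^-1 ^+ 2 *
    \sum_(j < J) (enorm ((tnth p.1 j).1 - (tnth p.2 j).1) ^+ 2 +
                  enorm ((tnth p.1 j).2 - (tnth p.2 j).2) ^+ 2)); last first.
    by apply/funext => p; rewrite normalized_dist_sqr.
  have mt1 (j : 'I_J) : measurable_fun setT (fun p : J.-tuple (phase R d) *
      J.-tuple (phase R d) => tnth p.1 j).
    apply: (measurableT_comp (measurable_tnth j)); exact: measurable_fst.
  have mt2 (j : 'I_J) : measurable_fun setT (fun p : J.-tuple (phase R d) *
      J.-tuple (phase R d) => tnth p.2 j).
    apply: (measurableT_comp (measurable_tnth j)); exact: measurable_snd.
  apply: measurable_funM => //; apply: measurable_sum => j.
  apply: measurable_funD; apply: measurable_funX; apply: measurable_enormT;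
    apply: measurable_rVB.
  - by apply: (measurableT_comp measurable_fst).
  - by apply: (measurableT_comp measurable_fst).
  - by apply: (measurableT_comp measurable_snd).
  - by apply: (measurableT_comp measurable_snd).
apply: gt0_ler_poweR => //.
- rewrite in_itv/= leey andbT; apply: le_ereal_inf_tmp => _ [g _ <-].
  by apply: integral_ge0 => p _; rewrite lee_fin sqr_ge0.
- rewrite in_itv/= leey andbT (le_trans _ hc)//.
  by apply: integral_ge0 => p _; rewrite lee_fin sqr_ge0.
apply: ge_ereal_inf; exists (\int[distribution P T']_p (normalized_dist p.1 p.2 ^+ 2)%:E)%E.
  exists (distribution P T') => // A mA; split.
    rewrite /distribution/= /recenter_law /pushforward/=; congr (P _).
    by apply/seteqP; split => w /=; [case|].
  have mRA : measurable (@recenter_tuple R d J @^-1` A).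
    by rewrite -[X in measurable X]setTI; exact: measurable_recenter_tuple.
  rewrite -[RHS](lW _ mRA) /distribution/= /pushforward/=; congr (P _).
  by apply/seteqP; split => w /=; [case|].
rewrite ge0_integral_distribution//.
by move=> p; rewrite lee_fin sqr_ge0.
Qed.

End recentered_transport.

(** With the factor 1 / J outside the square root the coupling costs C^2 / J^2, and C / J is at most
    C J^(-1/2) for J >= 1. *)
Lemma sqrt_bound_le (R : realType) (C : R) (J : nat) : (1 <= J)%N -> 0 <= C ->
  (poweR (C ^+ 2 / J%:R ^+ 2)%:E 2^-1 <= (C * J%:R `^ (- 2^-1))%:E)%E.
Proof.
move=> J0 C0; have J1 : 1 <= J%:R :> R by rewrite ler1n.
have J0' : 0 <= J%:R :> R by [].
rewrite poweR_EFin lee_fin powR12_sqrt ?divr_ge0 ?sqr_ge0//.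
rewrite -expr_div_n sqrtr_sqr ger0_norm ?divr_ge0//.
rewrite powRN powR12_sqrt// ler_wpM2l// lef_pV2 ?posrE ?sqrtr_gt0 ?ltr0n//.
rewrite -[leRHS]sqr_sqrtr// expr2 ler_peMl ?sqrtr_ge0//.
by rewrite -[leLHS]sqrtr1 ler_sqrt// ltr0n.
Qed.

Lemma wasserstein2_recentered_samples (R : realType) (d J : nat) (dO : measure_display)
    (Om : measurableType dO) (P : probability Om R) (C : R)
    (X V Xbar Vbar : 'I_J -> {RV P >-> 'rV[R]_d})
    (nu : probability (J.-tuple (phase R d)) R) :
  (1 <= J)%N -> 0 <= C ->
  has_law P (fun w => [tuple (Xbar j w, Vbar j w) | j < J]) nu ->
  (forall j, ('E_P[fun w =>
     (enorm (recenter (fun i => X i w) j - recenter (fun i => Xbar i w) j) ^+ 2 +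
      enorm (recenter (fun i => V i w) j - recenter (fun i => Vbar i w) j) ^+ 2)%R]
    <= (C ^+ 2 / J%:R)%:E)%E) ->
  (wasserstein2 (@normalized_dist R d J)
    (recenter_law (pushforward P (fun w => [tuple (X j w, V j w) | j < J])))
    (recenter_law nu) <= (C * J%:R `^ (- 2^-1))%:E)%E.
Proof.
move=> J0 C0 lW; rewrite unlock => hE.
have mt (f g : 'I_J -> {RV P >-> 'rV[R]_d}) :
    measurable_fun setT (fun w => [tuple (f j w, g j w) | j < J]).
  apply/measurable_fun_tnthP => j; rewrite (_ : _ \o _ = fun w => (f j w, g j w)).
    by apply: measurable_fun_pair; exact: measurable_funPT.
  by apply/funext => w /=; rewrite tnth_mktuple.
have mr (f : 'I_J -> {RV P >-> 'rV[R]_d}) j :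
    measurable_fun setT (fun w => recenter (fun i => f i w) j).
  apply: measurable_rVB; first exact: measurable_funPT.
  by apply: measurable_rVZ; apply: measurable_rV_sum => i; exact: measurable_funPT.
apply: le_trans (sqrt_bound_le J0 C0).
apply: (wasserstein2_recentered_le (mt X V) (mt Xbar Vbar) lW).
pose D j w :=
  enorm (recenter (fun i => X i w) j - recenter (fun i => Xbar i w) j) ^+ 2 +
  enorm (recenter (fun i => V i w) j - recenter (fun i => Vbar i w) j) ^+ 2.
have D0 j w : 0 <= D j w by rewrite addr_ge0 ?sqr_ge0.
have mD j : measurable_fun setT (fun w => (D j w)%:E).
  apply/measurable_EFinP.
  by apply: measurable_funD; apply: measurable_funX; apply: measurable_enormT;
    apply: measurable_rVB; exact: mr.
have e w : (normalized_dist (recenter_tuple [tuple (X j w, V j w) | j < J])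
    (recenter_tuple [tuple (Xbar j w, Vbar j w) | j < J]) ^+ 2)%:E =
    ((J%:R^-1 ^+ 2)%:E * \sum_(j < J) (D j w)%:E)%E.
  rewrite normalized_dist_sqr EFinM -sumEFin; congr (_ * _)%E.
  have tE (f g : 'I_J -> {RV P >-> 'rV[R]_d}) :
      tnth [tuple (f j w, g j w) | j < J] = (fun i => (f i w, g i w)).
    by apply/funext => i; rewrite tnth_mktuple.
  apply: eq_bigr => j _; rewrite /recenter_tuple.
  rewrite !tnth_mktuple (tE X V) (tE Xbar Vbar).
  by rewrite !fst_recenter !snd_recenter.
under eq_integral do rewrite e.
have sD : measurable_fun setT (fun w => \sum_(j < J) (D j w)%:E)%E.
  exact: emeasurable_sum.
have s0 w : setT w -> (0 <= \sum_(j < J) (D j w)%:E)%E.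
  by move=> _; apply: sume_ge0 => j _; rewrite lee_fin.
rewrite (ge0_integralZl_EFin _ _ s0)// ?sqr_ge0//.
rewrite ge0_integral_sum//; last by move=> j w _; rewrite lee_fin.
have h : (\sum_(j < J) \int[P]_w (D j w)%:E <= (\sum_(j < J) C ^+ 2 / J%:R)%:E)%E.
  by rewrite -sumEFin; apply: lee_sum => j _; exact: hE.
apply: (@le_trans _ _ ((J%:R^-1 ^+ 2)%:E * (\sum_(j < J) C ^+ 2 / J%:R)%:E)%E).
  by rewrite lee_wpmul2l// lee_fin sqr_ge0.
rewrite -EFinM lee_fin sum_cst le_eqVlt; apply/orP; left; apply/eqP; field.
exact: natJ_neq0.
Qed.

(* The default 0 is irrelevant: the condition on K makes the set nonempty. *)
Definition reach_radius (R : realType) (psi : R -> R) (K DV DX : R) : R :=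
  xget 0 [set r | DX <= r /\ DV < K * (potential psi DX r - potential psi DX DX)].

Theorem theorem2p2 (R : realType) (psi : R -> R) :
  exists C : R -> R -> R -> R -> R,
  forall (L : R) (d : nat) (rho0 : probability (phase R d) R) (K : R),
    communication_rate L psi ->
    (1 <= d)%N ->
    compact (msupport rho0) ->
    0 < K ->
    ((diameterV rho0)%:E /
      \int[lebesgue_measure]_(s in `[diameterX rho0, +oo[) (psi s)%:E < K%:E)%E ->
    let CChaos := C K (diameterV rho0) (diameterX rho0) L in
    0 < CChaos /\
    forall (rho : R -> probability (phase R d) R) (J : nat)
      (dO : measure_display) (Om : measurableType dO) (P : probability Om R)
      (x0 v0 : 'I_J -> {RV P >-> 'rV[R]_d})
      (X V Xbar Vbar : 'I_J -> R -> {RV P >-> 'rV[R]_d}),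
      (1 <= J)%N ->
      mean_field_law K psi rho0 rho ->
      iid P (fun j w => (x0 j w, v0 j w)) rho0 ->
      {ae P, forall w, cucker_smale K psi (x0 ^~ w) (v0 ^~ w)
        (fun j t => X j t w) (fun j t => V j t w)} ->
      {ae P, forall w, forall j, [/\ Xbar j 0 w = x0 j w, Vbar j 0 w = v0 j w &
        mean_field_ode K psi rho (Xbar j ^~ w) (Vbar j ^~ w)]} ->
      (forall (j : 'I_J) (t : R), 0 <= t ->
        ('E_P[fun w =>
          (enorm (recenter (fun i => X i t w) j -
                  recenter (fun i => Xbar i t w) j) ^+ 2 +
           enorm (recenter (fun i => V i t w) j -
                  recenter (fun i => Vbar i t w) j) ^+ 2)%R]
         <= (CChaos ^+ 2 / J%:R)%:E)%E) /\
      (forall t : R, 0 <= t ->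
        (wasserstein2 (@normalized_dist R d J)
          (recenter_law
            (pushforward P (fun w => [tuple (X j t w, V j t w) | j < J])))
          (recenter_law (tensor_power (rho t) J))
        <= (CChaos * J%:R `^ (- 2^-1))%:E)%E).
Proof.
(* The variance constant can vanish, for instance at zero velocity diameter; adding 1 makes the root
   positive. *)
exists (fun K DV DX L =>
  Num.sqrt (1 + chaos_variance L psi K DV (reach_radius psi K DV DX))).
move=> L d rho0 K rate _ compS K0 hK CChaos.
set DV := diameterV rho0 in hK CChaos *; set DX := diameterX rho0 in hK CChaos *.
pose Dinf := reach_radius psi K DV DX.
have [Dinf_ge DinfP] : DX <= Dinf /\
    DV < K * (potential psi DX Dinf - potential psi DX DX).
  have [r rD rV] := potential_reach rate (diameterX_ge0 compS) K0
    (diameterV_ge0 compS) hK.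
  exact: (@xgetPex _ 0 [set r | DX <= r /\
    DV < K * (potential psi DX r - potential psi DX DX)] (ex_intro _ r (conj rD rV))).
have var0 : 0 <= chaos_variance L psi K DV Dinf.
  apply: mulr_ge0; first exact: expR_ge0.
  apply: divr_ge0; last exact: sqr_ge0.
  by rewrite -mulrA; apply: mulr_ge0; [exact: ler0n|apply: mulr_ge0; exact: sqr_ge0].
have C0 : 0 < CChaos by rewrite sqrtr_gt0 ltr_pwDl.
split=> // rho J dO Om P x0 v0 X V Xbar Vbar J0 mfl ini cs mf.
have dev j t : 0 <= t -> ('E_P[fun w =>
     (enorm (recenter (fun i => X i t w) j - recenter (fun i => Xbar i t w) j) ^+ 2 +
      enorm (recenter (fun i => V i t w) j - recenter (fun i => Vbar i t w) j) ^+ 2)%R]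
    <= (CChaos ^+ 2 / J%:R)%:E)%E.
  move=> t0.
  apply: (le_trans (expected_deviation rate K0 compS mfl Dinf_ge DinfP J0 ini cs mf j t0)).
  rewrite lee_fin ler_wpM2r ?invr_ge0// sqr_sqrtr ?addr_ge0//.
  by rewrite lerDr.
split=> // t t0; apply: wasserstein2_recentered_samples => //; first exact: ltW.
  exact: (has_law_sample rate K0 compS mfl Dinf_ge DinfP ini cs mf t0).
by move=> j; exact: dev.
Qed.
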